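(* Let $\Lambda$ be an artin algebra, $n$ a positive integer and $\mathcal{M}$ an $n$-cluster tilting subcategory of $\mathrm{mod}\text{-}\Lambda$. There are equivalences of abelian categories $$\mathcal{S}(\mathcal{M})/\mathcal{V}\simeq\mathrm{mod}\text{-}\underline{\mathcal{M}}\simeq(\overline{\mathcal{M}}\text{-}\mathrm{mod})^{\mathrm{op}}\simeq\mathcal{F}(\mathcal{M})/\mathcal{V}'.$$ Here $\mathcal{V}$ is the full subcategory of $\mathcal{S}(\mathcal{M})$ generated by all finite direct sums of objects of the form $(M\xrightarrow{1}M)$ and $(0\to M)$, and $\mathcal{V}'$ is the full subcategory of $\mathcal{F}(\mathcal{M})$ generated by all finite direct sums of objects of the form $(M\xrightarrow{1}M)$ and $(M\to 0)$, where $M$ runs over all objects of $\mathcal{M}$.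
   Context: $\mathrm{mod}\text{-}\Lambda$ is the category of finitely generated $\Lambda$-modules; all subcategories are full. A full additive subcategory $\mathcal{M}$ of $\mathrm{mod}\text{-}\Lambda$ is $n$-cluster tilting if it is functorially finite (every module has a right and a left $\mathcal{M}$-approximation), generating-cogenerating (every module is a quotient of an object of $\mathcal{M}$ and embeds in an object of $\mathcal{M}$), and $$\mathcal{M}=\{A: \mathrm{Ext}^i_\Lambda(\mathcal{M},A)=0,\ 0<i<n\}=\{A: \mathrm{Ext}^i_\Lambda(A,\mathcal{M})=0,\ 0<i<n\}.$$ $\mathcal{S}(\mathcal{M})$ (resp. $\mathcal{F}(\mathcal{M})$) is the category whose objects are monomorphisms (resp. epimorphisms) $f:M_1\to M_2$ of $\Lambda$-modules with $M_1,M_2\in\mathcal{M}$, and whose morphisms are commutative squares. $\mathrm{mod}\text{-}\underline{\mathcal{M}}$ is the category of finitely presented additive contravariant functors $\mathcal{M}\to\mathrm{Ab}$ vanishing on projective $\Lambda$-modules; $\overline{\mathcal{M}}\text{-}\mathrm{mod}$ is the category of finitely presented additive covariant functors $\mathcal{M}\to\mathrm{Ab}$ vanishing on injective $\Lambda$-modules. For a class $\mathcal{K}$ of objects of an additive category $\mathcal{X}$, $\mathcal{X}/\mathcal{K}$ is the quotient of $\mathcal{X}$ by the ideal of morphisms factoring through a finite direct sum of objects of $\mathcal{K}$. *)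

(* Defs.v *)
From HB Require Import structures.
From Stdlib Require Import Setoid Morphisms.
From mathcomp Require Import all_boot all_algebra.

Set Implicit Arguments.
Unset Strict Implicit.
Unset Printing Implicit Defensive.

Import GRing.Theory.
Local Open Scope ring_scope.

Declare Scope cat_scope.
Delimit Scope cat_scope with cat.
Local Open Scope cat_scope.

Reserved Notation "f ≡ g" (at level 70, no associativity).
Reserved Notation "g ∘ f" (at level 40, left associativity).

(* Equality of morphisms is part of the structure (heq): a quotient category
   X/K then has the objects and morphisms of X, with a coarser equality. *)
Record precat : Type := Precat {
  Ob :> Type;
  mor : Ob -> Ob -> Type;
  heq : forall {X Y}, mor X Y -> mor X Y -> Prop;
  idm : forall X, mor X X;
  mcomp : forall {X Y Z}, mor Y Z -> mor X Y -> mor X Z;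
  hadd : forall {X Y}, mor X Y -> mor X Y -> mor X Y;
  hzero : forall X Y, mor X Y;
  hopp : forall {X Y}, mor X Y -> mor X Y;
  heq_equiv : forall X Y, Equivalence (@heq X Y);
  comp_heq : forall X Y Z (g g' : mor Y Z) (f f' : mor X Y),
    heq g g' -> heq f f' -> heq (mcomp g f) (mcomp g' f');
  compA : forall X Y Z W (h : mor Z W) (g : mor Y Z) (f : mor X Y),
    heq (mcomp h (mcomp g f)) (mcomp (mcomp h g) f);
  comp1m : forall X Y (f : mor X Y), heq (mcomp (idm Y) f) f;
  compm1 : forall X Y (f : mor X Y), heq (mcomp f (idm X)) f;
  hadd_heq : forall X Y (f f' g g' : mor X Y),
    heq f f' -> heq g g' -> heq (hadd f g) (hadd f' g');
  haddA : forall X Y (f g h : mor X Y),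
    heq (hadd f (hadd g h)) (hadd (hadd f g) h);
  haddC : forall X Y (f g : mor X Y), heq (hadd f g) (hadd g f);
  hadd0m : forall X Y (f : mor X Y), heq (hadd (hzero X Y) f) f;
  haddNm : forall X Y (f : mor X Y), heq (hadd (hopp f) f) (hzero X Y);
  compDl : forall X Y Z (g g' : mor Y Z) (f : mor X Y),
    heq (mcomp (hadd g g') f) (hadd (mcomp g f) (mcomp g' f));
  compDr : forall X Y Z (g : mor Y Z) (f f' : mor X Y),
    heq (mcomp g (hadd f f')) (hadd (mcomp g f) (mcomp g f'))
}.

Arguments mor {p} X Y.
Arguments idm {p} X.
Arguments hzero {p X Y}.
Arguments comp_heq {p X Y Z g g' f f'}.
Arguments hadd_heq {p X Y f f' g g'}.

Notation "f ≡ g" := (heq f g) : cat_scope.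
Notation "g ∘ f" := (mcomp g f) : cat_scope.

#[export] Instance heq_Equivalence (C : precat) (X Y : C) :
  Equivalence (@heq C X Y) := heq_equiv X Y.
#[export] Instance comp_Proper (C : precat) (X Y Z : C) :
  Proper (@heq C Y Z ==> @heq C X Y ==> @heq C X Z) (@mcomp C X Y Z).
Proof. by move=> g g' eg f f' ef; apply: comp_heq. Qed.
#[export] Instance hadd_Proper (C : precat) (X Y : C) :
  Proper (@heq C X Y ==> @heq C X Y ==> @heq C X Y) (@hadd C X Y).
Proof. by move=> g g' eg f f' ef; apply: hadd_heq. Qed.

#[export] Hint Extern 0 (heq _ _) => reflexivity : core.

Section HomTheory.
Variable C : precat.
Implicit Types X Y Z : C.

Lemma haddm0 X Y (f : mor X Y) : hadd f hzero ≡ f.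
Proof. by rewrite haddC hadd0m. Qed.

Lemma haddmN X Y (f : mor X Y) : hadd f (hopp f) ≡ hzero.
Proof. by rewrite haddC haddNm. Qed.

Lemma haddI X Y (h f g : mor X Y) : hadd h f ≡ hadd h g -> f ≡ g.
Proof.
move=> e; have e' : hadd (hopp h) (hadd h f) ≡ hadd (hopp h) (hadd h g).
  by rewrite e.
by rewrite !haddA haddNm !hadd0m in e'.
Qed.

Lemma comp0m X Y Z (f : mor X Y) : (hzero : mor Y Z) ∘ f ≡ hzero.
Proof. by apply: (@haddI _ _ (hzero ∘ f)); rewrite -compDl !haddm0. Qed.

Lemma compm0 X Y Z (g : mor Y Z) : g ∘ (hzero : mor X Y) ≡ hzero.
Proof. by apply: (@haddI _ _ (g ∘ hzero)); rewrite -compDr !haddm0. Qed.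

Lemma hopp_uniq X Y (f g : mor X Y) : hadd g f ≡ hzero -> hopp f ≡ g.
Proof. by move=> e; apply: (@haddI _ _ f); rewrite haddmN haddC e. Qed.

Lemma compNm X Y Z (g : mor Y Z) (f : mor X Y) : hopp g ∘ f ≡ hopp (g ∘ f).
Proof. by symmetry; apply: hopp_uniq; rewrite -compDl haddNm comp0m. Qed.

Lemma compmN X Y Z (g : mor Y Z) (f : mor X Y) : g ∘ hopp f ≡ hopp (g ∘ f).
Proof. by symmetry; apply: hopp_uniq; rewrite -compDr haddNm compm0. Qed.

Lemma haddACA X Y (a b c d : mor X Y) :
  hadd (hadd a b) (hadd c d) ≡ hadd (hadd a c) (hadd b d).
Proof. by rewrite !haddA -(haddA a b c) (haddC b c) haddA. Qed.

Lemma hoppD X Y (f g : mor X Y) : hopp (hadd f g) ≡ hadd (hopp f) (hopp g).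
Proof. by apply: hopp_uniq; rewrite haddACA !haddNm hadd0m. Qed.

Lemma hoppK X Y (f : mor X Y) : hopp (hopp f) ≡ f.
Proof. by apply: hopp_uniq; rewrite haddmN. Qed.

End HomTheory.

#[export] Instance hopp_Proper (C : precat) (X Y : C) :
  Proper (@heq C X Y ==> @heq C X Y) (@hopp C X Y).
Proof. by move=> f f' ef; apply: hopp_uniq; rewrite ef haddNm. Qed.

Section Notions.
Variable C : precat.
Implicit Types X Y Z K Q : C.

Definition mono X Y (f : mor X Y) : Prop :=
  forall W (g h : mor W X), f ∘ g ≡ f ∘ h -> g ≡ h.

Definition epi X Y (f : mor X Y) : Prop :=
  forall W (g h : mor Y W), g ∘ f ≡ h ∘ f -> g ≡ h.

Definition isomorphic X Y : Prop :=
  exists (f : mor X Y) (g : mor Y X), g ∘ f ≡ idm X /\ f ∘ g ≡ idm Y.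

Definition zero_object Z : Prop :=
  forall X, (forall f : mor X Z, f ≡ hzero) /\ (forall f : mor Z X, f ≡ hzero).

Definition is_biproduct X Y S (i1 : mor X S) (i2 : mor Y S)
    (p1 : mor S X) (p2 : mor S Y) : Prop :=
  [/\ p1 ∘ i1 ≡ idm X, p2 ∘ i2 ≡ idm Y, p2 ∘ i1 ≡ hzero, p1 ∘ i2 ≡ hzero
    & hadd (i1 ∘ p1) (i2 ∘ p2) ≡ idm S].

Definition direct_sum X Y S : Prop :=
  exists i1 i2 p1 p2, @is_biproduct X Y S i1 i2 p1 p2.

Definition is_kernel X Y (f : mor X Y) K (k : mor K X) : Prop :=
  f ∘ k ≡ hzero /\
  forall W (g : mor W X), f ∘ g ≡ hzero ->
    exists h : mor W K, k ∘ h ≡ g /\ forall h', k ∘ h' ≡ g -> h' ≡ h.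

Definition is_cokernel X Y (f : mor X Y) Q (q : mor Y Q) : Prop :=
  q ∘ f ≡ hzero /\
  forall W (g : mor Y W), g ∘ f ≡ hzero ->
    exists h : mor Q W, h ∘ q ≡ g /\ forall h', h' ∘ q ≡ g -> h' ≡ h.

End Notions.

Definition additive_cat (C : precat) : Prop :=
  (exists Z : C, zero_object Z) /\
  (forall X Y : C, exists S, direct_sum X Y S).

Definition abelian_cat (C : precat) : Prop :=
  [/\ additive_cat C,
      forall (X Y : C) (f : mor X Y), exists K (k : mor K X), is_kernel f k,
      forall (X Y : C) (f : mor X Y), exists Q (q : mor Y Q), is_cokernel f q,
      forall (X Y : C) (f : mor X Y), mono f ->
        exists Z (g : mor Y Z), is_kernel g f
    & forall (X Y : C) (f : mor X Y), epi f ->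
        exists Z (g : mor Z X), is_cokernel g f].

Definition op (C : precat) : precat.
Proof.
refine {| Ob := C; mor := fun X Y => @mor C Y X;
  heq := fun X Y => @heq C Y X; idm := fun X => @idm C X;
  mcomp := fun X Y Z g f => @mcomp C Z Y X f g;
  hadd := fun X Y => @hadd C Y X; hzero := fun X Y => @hzero C Y X;
  hopp := fun X Y => @hopp C Y X |}.
- by move=> X Y Z g g' f f' eg ef; apply: comp_heq.
- by move=> *; rewrite compA.
- by move=> *; apply: compm1.
- by move=> *; apply: comp1m.
- by move=> *; apply: hadd_heq.
- by move=> *; apply: haddA.
- by move=> *; apply: haddC.
- by move=> *; apply: hadd0m.
- by move=> *; apply: haddNm.
- by move=> *; apply: compDr.
- by move=> *; apply: compDl.
Defined.

Definition full_sub (C : precat) (P : C -> Prop) : precat.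
Proof.
refine {| Ob := {X : C | P X};
  mor := fun X Y => mor (proj1_sig X) (proj1_sig Y);
  heq := fun X Y => @heq C _ _; idm := fun X => idm (proj1_sig X);
  mcomp := fun X Y Z => @mcomp C _ _ _;
  hadd := fun X Y => @hadd C _ _; hzero := fun X Y => hzero;
  hopp := fun X Y => @hopp C _ _ |}.
- by move=> *; apply: comp_heq.
- by move=> *; apply: compA.
- by move=> *; apply: comp1m.
- by move=> *; apply: compm1.
- by move=> *; apply: hadd_heq.
- by move=> *; apply: haddA.
- by move=> *; apply: haddC.
- by move=> *; apply: hadd0m.
- by move=> *; apply: haddNm.
- by move=> *; apply: compDl.
- by move=> *; apply: compDr.
Defined.

Record arrow (C : precat) : Type := Arrow {
  src : C; tgt : C; arr : mor src tgt
}.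
Arguments Arrow {C src tgt} arr.

Record square (C : precat) (f g : arrow C) : Type := Square {
  sq1 : mor (src f) (src g);
  sq2 : mor (tgt f) (tgt g);
  sq_comm : sq2 ∘ arr f ≡ arr g ∘ sq1
}.

Section ArrowCat.
Variable C : precat.
Implicit Types f g h : arrow C.

Definition sq_id f : square f f.
Proof. by exists (idm _) (idm _); rewrite comp1m compm1. Defined.

Definition sq_comp f g h (b : square g h) (a : square f g) : square f h.
Proof.
exists (sq1 b ∘ sq1 a) (sq2 b ∘ sq2 a).
by rewrite -compA sq_comm compA sq_comm compA.
Defined.

Definition sq_add f g (a b : square f g) : square f g.
Proof.
exists (hadd (sq1 a) (sq1 b)) (hadd (sq2 a) (sq2 b)).
by rewrite compDl compDr !sq_comm.
Defined.

Definition sq_zero f g : square f g.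
Proof. by exists hzero hzero; rewrite comp0m compm0. Defined.

Definition sq_opp f g (a : square f g) : square f g.
Proof. by exists (hopp (sq1 a)) (hopp (sq2 a)); rewrite compNm compmN sq_comm. Defined.

Definition arrow_cat : precat.
Proof.
refine {| Ob := arrow C; mor := @square C;
  heq := fun f g a b => sq1 a ≡ sq1 b /\ sq2 a ≡ sq2 b;
  idm := sq_id; mcomp := sq_comp; hadd := sq_add; hzero := sq_zero;
  hopp := sq_opp |}.
- move=> f g; split.
  + by move=> a.
  + by move=> a b [-> ->].
  + by move=> a b c [-> ->] [-> ->].
- by move=> f g h b b' a a' [eb1 eb2] [ea1 ea2] /=; rewrite eb1 eb2 ea1 ea2.
- by move=> *; split; apply: compA.
- by move=> *; split; apply: comp1m.
- by move=> *; split; apply: compm1.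
- by move=> f g a a' b b' [ea1 ea2] [eb1 eb2] /=; rewrite eb1 eb2 ea1 ea2.
- by move=> *; split; apply: haddA.
- by move=> *; split; apply: haddC.
- by move=> *; split; apply: hadd0m.
- by move=> *; split; apply: haddNm.
- by move=> *; split; apply: compDl.
- by move=> *; split; apply: compDr.
Defined.

End ArrowCat.

Inductive finite_sum (C : precat) (K : C -> Prop) : C -> Prop :=
| finite_sum0 Z : zero_object Z -> finite_sum K Z
| finite_sum1 X : K X -> finite_sum K X
| finite_sumD X Y S : finite_sum K X -> finite_sum K Y ->
    direct_sum X Y S -> finite_sum K S.

Definition factors_through (C : precat) (K : C -> Prop) (X Y : C)
    (f : mor X Y) : Prop :=
  exists S, finite_sum K S /\
    exists (a : mor X S) (b : mor S Y), f ≡ b ∘ a.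

(* Closing under addition makes this an ideal in any preadditive category; it
   adds nothing when direct sums exist, see ideal_of_factors below. *)
Inductive ideal_of (C : precat) (K : C -> Prop) (X Y : C) :
    mor X Y -> Prop :=
| ideal_of1 f : factors_through K f -> ideal_of K f
| ideal_of0 f : f ≡ hzero -> ideal_of K f
| ideal_ofD f g h : ideal_of K f -> ideal_of K g -> h ≡ hadd f g ->
    ideal_of K h.

Section Quotient.
Variables (C : precat) (K : C -> Prop).

Lemma ideal_of_factors : additive_cat C ->
  forall (X Y : C) (f : mor X Y), ideal_of K f <-> factors_through K f.
Proof.
move=> [[Z Z0] sums] X Y f; split; last exact: ideal_of1.
elim=> {f} [//|f f0|f g h _ [S [KS [a [b eb]]]] _ [T [KT [c [d ed]]]] eh].
  exists Z; split; first exact: finite_sum0.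
  by exists hzero, hzero; rewrite compm0.
have [U ST] := sums S T.
exists U; split; first exact: finite_sumD ST.
case: ST => i1 [i2 [p1 [p2 [e11 e22 e12 e21 _]]]].
exists (hadd (i1 ∘ a) (i2 ∘ c)), (hadd (b ∘ p1) (d ∘ p2)).
have E (A B : C) (x : mor A Y) (p : mor U A) (i : mor B U) (y : mor X B) :
    x ∘ p ∘ (i ∘ y) ≡ x ∘ (p ∘ i) ∘ y by rewrite !compA.
by rewrite compDl !compDr !E e11 e22 e12 e21 !compm1 !compm0 !comp0m
  haddm0 hadd0m eh eb ed.
Qed.

Lemma ideal_of_heq (X Y : C) (f g : mor X Y) :
  f ≡ g -> ideal_of K f -> ideal_of K g.
Proof.
move=> e If; apply: (@ideal_ofD _ _ _ _ f hzero) => //.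
  by apply: ideal_of0.
by rewrite haddm0 e.
Qed.

Lemma ideal_of_comp (X Y Z W : C) (h : mor Z W) (f : mor Y Z) (g : mor X Y) :
  ideal_of K f -> ideal_of K (h ∘ f ∘ g).
Proof.
elim=> {f} [f [S [KS [a [b e]]]]|f e|f f1 f2 _ I1 _ I2 e].
- apply: ideal_of1; exists S; split=> //.
  by exists (a ∘ g), (h ∘ b); rewrite e !compA.
- by apply: ideal_of0; rewrite e compm0 comp0m.
- by apply: ideal_ofD I1 I2 _; rewrite e compDr compDl.
Qed.

Lemma ideal_ofN (X Y : C) (f : mor X Y) : ideal_of K f -> ideal_of K (hopp f).
Proof.
move=> /(@ideal_of_comp _ _ _ _ (hopp (idm _)) _ (idm _)).
by apply: ideal_of_heq; rewrite compm1 compNm comp1m.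
Qed.

Definition quotient_cat : precat.
Proof.
refine {| Ob := C; mor := @mor C;
  heq := fun X Y f g => ideal_of K (hadd f (hopp g));
  idm := @idm C; mcomp := @mcomp C; hadd := @hadd C; hzero := @hzero C;
  hopp := @hopp C |}.
- move=> X Y; split.
  + by move=> f; apply: ideal_of0; rewrite haddmN.
  + move=> f g /ideal_ofN; apply: ideal_of_heq.
    by rewrite hoppD hoppK haddC.
  + move=> f g h Ifg Igh; apply: ideal_ofD Ifg Igh _.
    by rewrite haddA -(haddA f) haddNm haddm0.
- move=> X Y Z g g' f f' Ig If.
  have := @ideal_of_comp _ _ _ _ (idm _) _ f Ig.
  have := @ideal_of_comp _ _ _ _ g' _ (idm _) If.
  move=> I1 I2; apply: ideal_ofD I2 I1 _.
  rewrite comp1m compm1 compDl compDr compNm compmN.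
  by rewrite haddA -(haddA (g ∘ f)) haddNm haddm0.
- by move=> *; apply: ideal_of0; rewrite compA haddmN.
- by move=> *; apply: ideal_of0; rewrite comp1m haddmN.
- by move=> *; apply: ideal_of0; rewrite compm1 haddmN.
- move=> X Y f f' g g' If Ig; apply: ideal_ofD If Ig _.
  by rewrite hoppD haddACA.
- by move=> *; apply: ideal_of0; rewrite haddA haddmN.
- by move=> X Y f g; apply: ideal_of0; rewrite (haddC f) haddmN.
- by move=> *; apply: ideal_of0; rewrite hadd0m haddmN.
- by move=> *; apply: ideal_of0; rewrite haddNm haddmN.
- by move=> *; apply: ideal_of0; rewrite compDl haddmN.
- by move=> *; apply: ideal_of0; rewrite compDr haddmN.
Defined.

End Quotient.

Record functor (C D : precat) : Type := Functor {
  fob :> C -> D;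
  fhom : forall X Y, mor X Y -> mor (fob X) (fob Y);
  fhom_heq : forall X Y (f g : mor X Y), f ≡ g -> fhom f ≡ fhom g;
  fhom_id : forall X, fhom (idm X) ≡ idm (fob X);
  fhom_comp : forall X Y Z (g : mor Y Z) (f : mor X Y),
    fhom (g ∘ f) ≡ fhom g ∘ fhom f;
  fhom_add : forall X Y (f g : mor X Y),
    fhom (hadd f g) ≡ hadd (fhom f) (fhom g)
}.

#[export] Instance fhom_Proper (C D : precat) (F : functor C D) (X Y : C) :
  Proper (@heq C X Y ==> @heq D (F X) (F Y)) (@fhom C D F X Y).
Proof. by move=> f g e; apply: fhom_heq. Qed.

Definition id_functor (C : precat) : functor C C.
Proof. by exists id (fun _ _ f => f). Defined.

Definition comp_functor (C D E : precat) (G : functor D E) (F : functor C D) :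
  functor C E.
Proof.
exists (fun X => G (F X)) (fun X Y f => fhom G (fhom F f)).
- by move=> X Y f g ->.
- by move=> X; rewrite !fhom_id.
- by move=> *; rewrite !fhom_comp.
- by move=> *; rewrite !fhom_add.
Defined.

Record nat_trans (C D : precat) (F G : functor C D) : Type := NatTrans {
  ncomp :> forall X, mor (F X) (G X);
  ncomp_nat : forall X Y (f : mor X Y), fhom G f ∘ ncomp X ≡ ncomp Y ∘ fhom F f
}.

Section FunctorCat.
Variables C D : precat.
Implicit Types F G H : functor C D.

Definition nat_id F : nat_trans F F.
Proof. by exists (fun X => idm (F X)) => X Y f; rewrite comp1m compm1. Defined.

Definition nat_comp F G H (b : nat_trans G H) (a : nat_trans F G) :
  nat_trans F H.
Proof.
exists (fun X => b X ∘ a X) => X Y f.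
by rewrite compA ncomp_nat -compA ncomp_nat compA.
Defined.

Definition nat_add F G (a b : nat_trans F G) : nat_trans F G.
Proof.
exists (fun X => hadd (a X) (b X)) => X Y f.
by rewrite compDl compDr !ncomp_nat.
Defined.

Definition nat_zero F G : nat_trans F G.
Proof. by exists (fun X => hzero) => X Y f; rewrite comp0m compm0. Defined.

Definition nat_opp F G (a : nat_trans F G) : nat_trans F G.
Proof.
exists (fun X => hopp (a X)) => X Y f.
by rewrite compNm compmN ncomp_nat.
Defined.

Definition functor_cat : precat.
Proof.
refine {| Ob := functor C D; mor := @nat_trans C D;
  heq := fun F G a b => forall X, a X ≡ b X;
  idm := nat_id; mcomp := nat_comp; hadd := nat_add; hzero := nat_zero;
  hopp := nat_opp |}.
- move=> F G; split.
  + by move=> a X.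
  + by move=> a b e X; rewrite e.
  + by move=> a b c e e' X; rewrite e e'.
- by move=> F G H b b' a a' eb ea X /=; rewrite eb ea.
- by move=> *; apply: compA.
- by move=> *; apply: comp1m.
- by move=> *; apply: compm1.
- by move=> F G a a' b b' ea eb X /=; rewrite ea eb.
- by move=> *; apply: haddA.
- by move=> *; apply: haddC.
- by move=> *; apply: hadd0m.
- by move=> *; apply: haddNm.
- by move=> *; apply: compDl.
- by move=> *; apply: compDr.
Defined.

End FunctorCat.

Definition equivalent (C D : precat) : Prop :=
  exists (F : functor C D) (G : functor D C),
    isomorphic (comp_functor G F : functor_cat C C) (id_functor C) /\
    isomorphic (comp_functor F G : functor_cat D D) (id_functor D).

Definition abelian_equivalent (C D : precat) : Prop :=
  [/\ abelian_cat C, abelian_cat D & equivalent C D].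

Definition Ab : precat.
Proof.
refine {| Ob := zmodType; mor := fun A B => {additive A -> B};
  heq := fun A B f g => f =1 g; idm := fun A => idfun : {additive A -> A};
  mcomp := fun A B D g f => g \o f : {additive A -> D};
  hadd := fun A B f g => f \+ g : {additive A -> B};
  hzero := fun A B => \0 : {additive A -> B};
  hopp := fun A B f => \- f : {additive A -> B} |}.
- move=> A B; split.
  + by move=> f x.
  + by move=> f g e x; rewrite e.
  + by move=> f g h e e' x; rewrite e e'.
- by move=> A B D g g' f f' eg ef x /=; rewrite ef eg.
- by [].
- by [].
- by [].
- by move=> A B f f' g g' ef eg x /=; rewrite ef eg.
- by move=> A B f g h x /=; rewrite addrA.
- by move=> A B f g x /=; rewrite addrC.
- by move=> A B f x /=; rewrite add0r.
- by move=> A B f x /=; rewrite addNr.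
- by [].
- by move=> A B D g f f' x /=; rewrite raddfD.
Defined.

(* Exactness of C(Y,-) --> C(X,-) --> F --> 0, where the first map is
   composition with f : X -> Y and the second one is pi. *)
Definition finitely_presented (C : precat) (F : functor C Ab) : Prop :=
  exists (X Y : C) (f : mor X Y) (pi : forall W, mor X W -> (F W : zmodType)),
  [/\ forall W (g h : mor X W), g ≡ h -> pi W g = pi W h,
      forall W (g h : mor X W), pi W (hadd g h) = pi W g + pi W h,
      forall W V (u : mor W V) (g : mor X W),
        pi V (u ∘ g) = (fhom F u : {additive F W -> F V}) (pi W g),
      forall W (x : (F W : zmodType)), exists g, pi W g = x
    & forall W (g : mor X W),
        pi W g = 0 <-> exists h : mor Y W, g ≡ h ∘ f].

Definition vanishes_on (C : precat) (F : functor C Ab) (K : C -> Prop) : Prop :=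
  forall X, K X -> forall x : (F X : zmodType), x = 0.

Definition fp_functors (C : precat) (K : C -> Prop) : precat :=
  @full_sub (functor_cat C Ab)
    (fun F => finitely_presented F /\ vanishes_on F K).

Definition surjective A B (f : A -> B) : Prop := forall y, exists x, f x = y.

Definition finitely_generated (R : pzRingType) (A : lmodType R) : Prop :=
  exists (m : nat) (v : 'I_m -> A),
    forall x, exists c : 'I_m -> R, x = \sum_(i < m) c i *: v i.

Definition projective (R : pzRingType) (P : lmodType R) : Prop :=
  forall (A B : lmodType R) (e : {linear A -> B}) (f : {linear P -> B}),
    surjective e -> exists g : {linear P -> A}, e \o g =1 f.

Definition injective_mod (R : pzRingType) (I : lmodType R) : Prop :=
  forall (A B : lmodType R) (m : {linear A -> B}) (f : {linear A -> I}),
    injective m -> exists g : {linear B -> I}, g \o m =1 f.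

Record projective_resolution (R : pzRingType) (A : lmodType R) : Type := {
  pr_term : nat -> lmodType R;
  pr_diff : forall i, {linear pr_term i.+1 -> pr_term i};
  pr_aug : {linear pr_term 0 -> A};
  pr_proj : forall i, projective (pr_term i);
  pr_aug_surj : surjective pr_aug;
  pr_exact0 : forall x, pr_aug x = 0 <-> exists y, pr_diff 0 y = x;
  pr_exact : forall i x, pr_diff i x = 0 <-> exists y, pr_diff i.+1 y = x
}.

Definition cohomology_zero (R : pzRingType) (A B : lmodType R)
    (P : projective_resolution A) (i : nat) : Prop :=
  forall phi : {linear pr_term P i -> B}, phi \o pr_diff P i =1 \0 ->
  match i return {linear pr_term P i -> B} -> Prop with
  | 0 => fun phi => phi =1 \0
  | j.+1 => fun phi =>
      exists psi : {linear pr_term P j -> B}, phi =1 psi \o pr_diff P j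
  end phi.

(* Ext^i_R(A, B) is the i-th cohomology of Hom_R(P, B); its vanishing does not
   depend on the projective resolution P of A. *)
Definition Ext_zero (R : pzRingType) (i : nat) (A B : lmodType R) : Prop :=
  exists P : projective_resolution A, cohomology_zero B P i.

Record fgmod (R : pzRingType) : Type := FGMod {
  fgmod_sort :> lmodType R;
  fgmod_fg : finitely_generated fgmod_sort
}.

Definition fgmod_cat (R : pzRingType) : precat.
Proof.
refine {| Ob := fgmod R; mor := fun A B => {linear A -> B};
  heq := fun A B f g => f =1 g; idm := fun A => idfun : {linear A -> A};
  mcomp := fun A B D g f => g \o f : {linear A -> D};
  hadd := fun A B f g => f \+ g : {linear A -> B};
  hzero := fun A B => \0 : {linear A -> B};
  hopp := fun A B f => \- f : {linear A -> B} |}.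
- move=> A B; split.
  + by move=> f x.
  + by move=> f g e x; rewrite e.
  + by move=> f g h e e' x; rewrite e e'.
- by move=> A B D g g' f f' eg ef x /=; rewrite ef eg.
- by [].
- by [].
- by [].
- by move=> A B f f' g g' ef eg x /=; rewrite ef eg.
- by move=> A B f g h x /=; rewrite addrA.
- by move=> A B f g x /=; rewrite addrC.
- by move=> A B f x /=; rewrite add0r.
- by move=> A B f x /=; rewrite addNr.
- by [].
- by move=> A B D g f f' x /=; rewrite raddfD.
Defined.

Definition is_ideal (k : comPzRingType) (I : k -> Prop) : Prop :=
  [/\ I 0, forall x y, I x -> I y -> I (x + y) & forall a x, I x -> I (a * x)].

Definition artinian (k : comPzRingType) : Prop :=
  forall I : nat -> k -> Prop,
    (forall i, is_ideal (I i)) -> (forall i x, I i.+1 x -> I i x) ->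
    exists N, forall i, (N <= i)%N -> forall x, I N x -> I i x.

Definition artin_algebra (k : comPzRingType) (L : algType k) : Prop :=
  artinian k /\ finitely_generated (L : lmodType k).

(* A right L-module is a left module over the opposite ring L^c. *)
Notation rmod L := (fgmod_cat L^c).

Section ClusterTilting.
Variables (R : pzRingType) (n : nat) (M : fgmod_cat R -> Prop).
Implicit Types A X Y : fgmod_cat R.

Definition right_approximation A X (f : mor X A) : Prop :=
  M X /\ forall Y (g : mor Y A), M Y -> exists h : mor Y X, g ≡ f ∘ h.

Definition left_approximation A X (f : mor A X) : Prop :=
  M X /\ forall Y (g : mor A Y), M Y -> exists h : mor X Y, g ≡ h ∘ f.

Record cluster_tilting : Prop := ClusterTilting {
  ct_additive : additive_cat (full_sub M);
  ct_right_approx : forall A, exists X (f : mor X A), right_approximation f;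
  ct_left_approx : forall A, exists X (f : mor A X), left_approximation f;
  ct_generating : forall A : fgmod R, exists (X : fgmod R)
    (f : {linear X -> A}), M X /\ surjective f;
  ct_cogenerating : forall A : fgmod R, exists (X : fgmod R)
    (f : {linear A -> X}), M X /\ injective f;
  ct_perp_right : forall A : fgmod R, M A <->
    forall X : fgmod R, M X -> forall i, (0 < i < n)%N -> Ext_zero i X A;
  ct_perp_left : forall A : fgmod R, M A <->
    forall X : fgmod R, M X -> forall i, (0 < i < n)%N -> Ext_zero i A X
}.

Definition mono_cat : precat := @full_sub (arrow_cat (fgmod_cat R))
  (fun f => [/\ M (src f), M (tgt f) & mono (arr f)]).

Definition epi_cat : precat := @full_sub (arrow_cat (fgmod_cat R))
  (fun f => [/\ M (src f), M (tgt f) & epi (arr f)]).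

Definition V_mono : mono_cat -> Prop := finite_sum (fun f : mono_cat =>
  (exists A, proj1_sig f = Arrow (idm A)) \/
  (exists Z A, zero_object Z /\ proj1_sig f = Arrow (hzero : mor Z A))).

Definition V_epi : epi_cat -> Prop := finite_sum (fun f : epi_cat =>
  (exists A, proj1_sig f = Arrow (idm A)) \/
  (exists A Z, zero_object Z /\ proj1_sig f = Arrow (hzero : mor A Z))).

(* The contravariant functors M -> Ab are the covariant functors on op M. *)
Definition mod_proj : precat := @fp_functors (op (full_sub M))
  (fun P => projective (proj1_sig P : fgmod R)).

Definition inj_mod : precat := @fp_functors (full_sub M)
  (fun I => injective_mod (proj1_sig I : fgmod R)).

End ClusterTilting.

(* Main.v *)
Require Import Defs.
From mathcomp Require Import all_boot all_algebra.
From HB Require Import structures.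
From Stdlib Require Import Setoid Morphisms.
From mathcomp Require Import boolp classical_sets zify ring.
Import Defs.

(* A finitely presented functor on M is the cokernel of Hom(-, f) for an arrow f of M; it
   vanishes on projectives iff f is an epimorphism, and a square f -> g induces zero iff its
   lower edge factors through g, iff it factors through V'. Hence F(M)/V' is mod-M_, and dually
   S(M)/V is the opposite of M^-mod; here the dual needs injective envelopes, which exist
   because the essential extensions of a finitely generated module over an artin algebra have
   bounded length.

   To compare F(M)/V' with S(M)/V, complete an epimorphism M_1 -> M_0 with kernel K_1 by right
   approximations M_(j+1) -> K_j with kernels K_(j+1) to an n-exact sequence; the Ext-vanishing
   puts K_n in M and makes K_j -> M_j a left approximation for j < n. At every joint K_j, maps
   of the sequences 0 -> K_j -> M_j -> K_(j-1) -> 0 up to homotopy are therefore the same as maps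
   of 0 -> K_(j+1) -> M_(j+1) -> K_j -> 0 up to homotopy, so that the categories of such
   sequences are equivalent for j = 1, ..., n; the two ends are F(M)/V' and S(M)/V.

   The functor categories are abelian because M has weak cokernels. *)

Set Implicit Arguments.
Unset Strict Implicit.
Unset Printing Implicit Defensive.

Import GRing.Theory.
Local Open Scope ring_scope.
Local Open Scope cat_scope.

(** * Submodules and quotients *)

(** Length is measured over the ground ring [k], because the annihilators of one-sided ideals that
    filter an essential extension are only k-submodules. That [k] has finite length over itself is
    drawn from the descending chain condition and Zorn's lemma, without a radical.

    Ext enters only through its vanishing. The resolutions of [Ext_zero] are traded for an extension
    property in degree one and dimension shifting above it; the fragments of long exact sequences
    come from pullbacks, the horseshoe and direct summands, and no connecting map is built.

    Most passages between the categories rest on choices (presentations, kernels, approximations,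
    lifts) that are not functorial. They are treated as relations between morphisms, and the point
    to check is that related morphisms vanish together.

    Extending a map along K_j -> M_j needs Ext^1(K_(j-1), M) = 0, which holds at n - 1 joints:
    exactly those that separate the two ends.

    The functor categories are compared through the arrow categories only. One of them is shown to
    be abelian, and the rest follows by equivalence and passage to opposites. *)

Lemma quotient_zmod (T : Type) (E : T -> T -> Prop) (z : T) (o : T -> T)
    (a : T -> T -> T) :
  Equivalence E ->
  (forall x x' y y', E x x' -> E y y' -> E (a x y) (a x' y')) ->
  (forall x y t, E (a x (a y t)) (a (a x y) t)) ->
  (forall x y, E (a x y) (a y x)) ->
  (forall x, E (a z x) x) ->
  (forall x, E (a (o x) x) z) ->
  {Z : zmodType & {cl : T -> Z |
    [/\ forall x y, cl x = cl y <-> E x y, forall y, exists x, cl x = y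
      & forall x y, cl (a x y) = cl x + cl y]}}.
Proof.
move=> eqE aE aA aC a0 aN.
pose Z := {P : T -> Prop | exists x, P = E x}.
pose cl x : Z := exist _ (E x) (ex_intro _ x erefl).
have clE x y : cl x = cl y <-> E x y.
  split=> [/(congr1 (@proj1_sig _ _))/(congr1 (@^~ y)) /= ->|xy]; first reflexivity.
  apply: eq_exist; apply/funext => t; apply/propext.
  by split=> h; [transitivity x; first symmetry | transitivity y].
have clS (y : Z) : exists x, cl x = y.
  by case: y => P [x Px]; exists x; apply: eq_exist.
pose r y := projT1 (cid (clS y)).
have rK y : cl (r y) = y by rewrite /r; case: cid.
have rE x : E (r (cl x)) x by apply/clE; rewrite rK.
pose ad u v := cl (a (r u) (r v)).
have adE x y : ad (cl x) (cl y) = cl (a x y).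
  by apply/clE; apply: aE.
pose op u := cl (o (r u)).
have adA : associative ad.
  by move=> u v w; rewrite -(rK u) -(rK v) -(rK w) !adE; apply/clE.
have adC : commutative ad.
  by move=> u v; rewrite -(rK u) -(rK v) !adE; apply/clE.
have ad0 : left_id (cl z) ad.
  by move=> u; rewrite -(rK u) !adE; apply/clE.
have adN : left_inverse (cl z) op ad.
  by move=> u; rewrite /op -{2}(rK u) !adE; apply/clE.
pose ZC : choiceType := HB.pack Z (gen_eqMixin Z) (gen_choiceMixin Z).
pose ZZ : zmodType :=
  HB.pack Z ZC (@GRing.isZmodule.Build ZC (cl z) op ad adA adC ad0 adN).
by exists ZZ, cl; split=> // x y; rewrite -[LHS]adE.
Qed.

Section LmodOf.
Variables (R : pzRingType) (Z : zmodType) (sc : R -> Z -> Z).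
Hypothesis scA : forall c d v, sc c (sc d v) = sc (c * d) v.
Hypothesis sc1 : left_id 1 sc.
Hypothesis scDr : right_distributive sc +%R.
Hypothesis scDl : forall v, {morph sc^~ v : c d / c + d}.

(** The phantom makes [R] a parameter of the alias, so that the scalar action can be attached to
    it. *)
Definition lmod_of of phant R : Type := Z.
HB.instance Definition _ := GRing.Zmodule.on (lmod_of (Phant R)).
HB.instance Definition _ := GRing.Zmodule_isLmodule.Build R
  (lmod_of (Phant R)) scA sc1 scDr scDl.

Lemma lmod_ofP : exists (Y : lmodType R) (h : Z -> Y),
  [/\ bijective h, {morph h : x y / x + y} & forall c x, h (sc c x) = c *: h x].
Proof. by exists (lmod_of (Phant R)), id; split=> //; exists id. Qed.

End LmodOf.

Lemma quotient_lmod (R : pzRingType) (T : Type) (E : T -> T -> Prop) (z : T)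
    (o : T -> T) (a : T -> T -> T) (s : R -> T -> T) :
  Equivalence E ->
  (forall x x' y y', E x x' -> E y y' -> E (a x y) (a x' y')) ->
  (forall x y t, E (a x (a y t)) (a (a x y) t)) ->
  (forall x y, E (a x y) (a y x)) ->
  (forall x, E (a z x) x) ->
  (forall x, E (a (o x) x) z) ->
  (forall c x x', E x x' -> E (s c x) (s c x')) ->
  (forall c d x, E (s c (s d x)) (s (c * d) x)) ->
  (forall x, E (s 1 x) x) ->
  (forall c x y, E (s c (a x y)) (a (s c x) (s c y))) ->
  (forall c d x, E (s (c + d) x) (a (s c x) (s d x))) ->
  exists (Z : lmodType R) (cl : T -> Z),
    [/\ forall x y, cl x = cl y <-> E x y, forall y, exists x, cl x = y,
        forall x y, cl (a x y) = cl x + cl y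
      & forall c x, cl (s c x) = c *: cl x].
Proof.
move=> eqE aE aA aC a0 aN sE sA s1 sDr sDl.
have [Z [cl [clE clS clD]]] := quotient_zmod eqE aE aA aC a0 aN.
pose r y := projT1 (cid (clS y)).
have rK y : cl (r y) = y by rewrite /r; case: cid.
have rE x : E (r (cl x)) x by apply/clE; rewrite rK.
pose sc c u := cl (s c (r u)).
have scE c x : sc c (cl x) = cl (s c x) by apply/clE; apply: sE.
have h1 c d v : sc c (sc d v) = sc (c * d) v.
  by rewrite -(rK v) !scE; apply/clE.
have h2 : left_id 1 sc by move=> v; rewrite -(rK v) scE; apply/clE.
have h3 : right_distributive sc +%R.
  by move=> c u v; rewrite -(rK v) -(rK u) -clD !scE -clD; apply/clE.
have h4 v : {morph sc^~ v: c d / c + d}.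
  by move=> c d; rewrite -(rK v) !scE -clD; apply/clE.
have [Y [h [[g hK gK] hD hZ]]] := lmod_ofP h1 h2 h3 h4.
exists Y, (h \o cl); split=> [x y|y|x y|c x] /=.
- by rewrite -clE; split=> [/(can_inj hK)|->].
- by have [x e] := clS (g y); exists x; rewrite e gK.
- by rewrite clD hD.
- by rewrite -scE hZ.
Qed.

Section Modules.
Variable R : pzRingType.
Implicit Types A B C : lmodType R.

Definition submod A (U : A -> Prop) : Prop :=
  [/\ U 0, forall x y, U x -> U y -> U (x + y)
    & forall c x, U x -> U (c *: x)].

Lemma submodN A (U : A -> Prop) x : submod U -> U x -> U (- x).
Proof. by move=> [_ _ UZ] Ux; rewrite -scaleN1r; apply: UZ. Qed.

Lemma linear_ex A B (f : A -> B) :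
  (forall x y, f (x + y) = f x + f y) -> (forall c x, f (c *: x) = c *: f x) ->
  exists g : {linear A -> B}, g =1 f.
Proof.
move=> fD fZ.
have fl : linear f by move=> c x y; rewrite fD fZ.
pose m := GRing.isLinear.Build R A B *:%R f fl.
by exists (HB.pack f m : {linear A -> B}).
Qed.

(** The subset type is taken modulo equality of underlying elements, so that [quotient_lmod] yields
    submodules as well as quotients. *)
Lemma ex_sub A (U : A -> Prop) : submod U ->
  exists (K : lmodType R) (i : {linear K -> A}),
    injective i /\ forall x, U x <-> exists y, i y = x.
Proof.
move=> sU; have [U0 UD UZ] := sU.
pose T := {x | U x}; pose v (x : T) := proj1_sig x.
pose mk x (h : U x) : T := exist _ x h.
have [|||||||||||Z [cl [clE clS clD clZ]]] := @quotient_lmod R T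
  (fun x y => v x = v y) (mk 0 U0) (fun x => mk _ (submodN sU (proj2_sig x)))
  (fun x y => mk _ (UD _ _ (proj2_sig x) (proj2_sig y)))
  (fun c x => mk _ (UZ c _ (proj2_sig x))).
- by split=> [x|x y|x y t] //=; apply: etrans.
- by move=> x x' y y' ex ey; congr (_ + _).
- by move=> x y t; apply: addrA.
- by move=> x y; apply: addrC.
- by move=> x; apply: add0r.
- by move=> x; apply: addNr.
- by move=> c x x' ex; congr (_ *: _).
- by move=> c d x; apply: scalerA.
- by move=> x; apply: scale1r.
- by move=> c x y; apply: scalerDr.
- by move=> c d x; apply: scalerDl.
pose r y := projT1 (cid (clS y)).
have rK y : cl (r y) = y by rewrite /r; case: cid.
have rE x : v (r (cl x)) = v x by apply/clE; rewrite rK.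
have [||i iE] := @linear_ex Z A (fun y => v (r y)).
- by move=> x y; rewrite -(rK x) -(rK y) -clD !rE.
- by move=> c x; rewrite -(rK x) -clZ !rE.
exists Z, i; split=> [x y|x].
  by rewrite !iE => e; rewrite -(rK x) -(rK y); apply/clE.
split=> [Ux|[y <-]]; last by rewrite iE; apply: proj2_sig.
by exists (cl (mk x Ux)); rewrite iE rE.
Qed.

Lemma ex_quot A (U : A -> Prop) : submod U ->
  exists (Q : lmodType R) (q : {linear A -> Q}),
    surjective q /\ forall x, q x = 0 <-> U x.
Proof.
move=> sU; have [U0 UD UZ] := sU.
have EE x y : x = y -> U (x - y) by move=> ->; rewrite subrr.
have [|||||||||||Z [cl [clE clS clD clZ]]] := @quotient_lmod R A
  (fun x y => U (x - y)) 0 -%R +%R *:%R.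
- split=> [x|x y h|x y t h h']; first exact: EE.
    by rewrite -opprB; apply: submodN.
  by rewrite -(subrKA y); apply: UD.
- by move=> x x' y y' h h'; rewrite opprD addrACA; apply: UD.
- by move=> x y t; apply: EE; apply: addrA.
- by move=> x y; apply: EE; apply: addrC.
- by move=> x; apply: EE; apply: add0r.
- by move=> x; apply: EE; apply: addNr.
- by move=> c x x' h; rewrite -scalerBr; apply: UZ.
- by move=> c d x; apply: EE; apply: scalerA.
- by move=> x; apply: EE; apply: scale1r.
- by move=> c x y; apply: EE; apply: scalerDr.
- by move=> c d x; apply: EE; apply: scalerDl.
have [q qE] := linear_ex clD clZ.
exists Z, q; split=> [y|x].
  by have [x <-] := clS y; exists x.
have -> : 0 = q 0 by rewrite linear0.
by rewrite !qE clE subr0.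
Qed.

Lemma factor_surj A B C (p : {linear A -> B}) (h : {linear A -> C}) :
  surjective p -> (forall x, p x = 0 -> h x = 0) ->
  exists h' : {linear B -> C}, forall x, h' (p x) = h x.
Proof.
move=> ps ph.
pose r y := projT1 (cid (ps y)).
have rK y : p (r y) = y by rewrite /r; case: cid.
have hE x y : p x = p y -> h x = h y.
  by move=> e; apply/eqP; rewrite -subr_eq0 -linearB; apply/eqP/ph; rewrite linearB e subrr.
have [||h' h'E] := @linear_ex B C (fun y => h (r y)).
- by move=> x y; rewrite -linearD; apply: hE; rewrite linearD !rK.
- by move=> c x; rewrite -linearZ; apply: hE; rewrite linearZ !rK.
by exists h' => x; rewrite h'E; apply: hE.
Qed.

Lemma factor_inj A B C (i : {linear A -> B}) (h : {linear C -> B}) :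
  injective i -> (forall x, exists y, i y = h x) ->
  exists h' : {linear C -> A}, forall x, i (h' x) = h x.
Proof.
move=> ii ih.
pose r y := projT1 (cid (ih y)).
have rK y : i (r y) = h y by rewrite /r; case: cid.
have [||h' h'E] := @linear_ex C A r.
- by move=> x y; apply: ii; rewrite linearD !rK linearD.
- by move=> c x; apply: ii; rewrite linearZ !rK linearZ.
by exists h' => x; rewrite h'E rK.
Qed.

Lemma linear_inj0 A B (i : {linear A -> B}) :
  (forall x, i x = 0 -> x = 0) -> injective i.
Proof.
move=> h x y e; apply/eqP; rewrite -subr_eq0; apply/eqP.
by apply: h; rewrite linearB e subrr.
Qed.

Lemma submod_ker A B (f : {linear A -> B}) : submod (fun x => f x = 0).
Proof.
split=> [|x y|c x]; first exact: linear0.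
  by rewrite linearD => -> ->; rewrite addr0.
by rewrite linearZ => ->; rewrite /= scaler0.
Qed.

Lemma submod_im A B (f : {linear A -> B}) : submod (fun x => exists y, f y = x).
Proof.
split=> [|_ _ [x <-] [y <-]|c _ [x <-]]; first by exists 0; rewrite linear0.
  by exists (x + y); rewrite linearD.
by exists (c *: x); rewrite linearZ.
Qed.

Lemma submod_add A (U V : A -> Prop) : submod U -> submod V ->
  submod (fun x => exists u v, [/\ U u, V v & x = u + v]).
Proof.
move=> [U0 UD UZ] [V0 VD VZ]; split.
- by exists 0, 0; rewrite addr0.
- move=> _ _ [u [v [? ? ->]]] [u' [v' [? ? ->]]].
  by exists (u + u'), (v + v'); split; [exact: UD|exact: VD|rewrite addrACA].
- move=> c _ [u [v [? ? ->]]].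
  by exists (c *: u), (c *: v); split; [exact: UZ|exact: VZ|rewrite scalerDr].
Qed.

Lemma submod_line A (a : A) : submod (fun x => exists c, x = c *: a).
Proof.
split=> [|_ _ [c ->] [d ->]|c _ [d ->]]; first by exists 0; rewrite scale0r.
  by exists (c + d); rewrite scalerDl.
by exists (c * d); rewrite scalerA.
Qed.

End Modules.

(** * Length of modules with operators *)

Local Open Scope classical_set_scope.

Lemma max_avoiding (R : pzRingType) (A : lmodType R) (S : set A) : ~ S 0 ->
  exists N : set A, [/\ submod N, forall x, N x -> ~ S x
    & forall N', submod N' -> N `<=` N' -> (forall x, N' x -> ~ S x) -> N' `<=` N].
Proof.
move=> S0.
pose P (X : set A) := X = set0 \/ (submod X /\ forall x, X x -> ~ S x).
have [F FP tF|N [PN maxN]] := @Zorn_bigcup A P.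
  have [e|/existsNP [X0 /not_implyP [FX0 nX0]]] := pselect (forall X, F X -> X = set0).
    by left; apply/seteqP; split=> // x [X FX]; rewrite (e X FX).
  right; have PX X x : F X -> X x -> submod X /\ forall x, X x -> ~ S x.
    by move=> FX Xx; case: (FP _ FX) => // e; rewrite e in Xx.
  split; last by move=> x [X FX Xx]; apply: (PX X x FX Xx).2.
  split.
  - exists X0 => //; case: (FP _ FX0) => [//|[[]] //].
  - move=> x y [X FX Xx] [Y FY Yy].
    have [h|h] := tF _ _ FX FY.
      by exists Y => //; have [[_ D _] _] := PX _ _ FY Yy; apply: D => //; apply: h.
    by exists X => //; have [[_ D _] _] := PX _ _ FX Xx; apply: D => //; apply: h.
  - move=> c x [X FX Xx]; exists X => //.
    by have [[_ _ Z] _] := PX _ _ FX Xx; apply: Z.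
case: PN => [N0|[sN aN]]; last first.
  exists N; split=> // N' sN' NN' aN'.
  apply: contrapT => h; apply: (maxN N'); last by right.
  by split.
exfalso; apply: (maxN [set 0]).
  by rewrite N0; split=> // /(_ 0); apply.
right; split; last by move=> x ->.
by split=> [//|x y -> ->|c x ->]; rewrite /= ?addr0 ?scaler0.
Qed.

Section Length.
Variables (T : Type) (R : pzRingType) (phi : T -> R) (A : lmodType R).
Implicit Types U V W Y : set A.

(** Stability is asked for the scalars [phi c] only. With [phi c = c%:A] these are the k-submodules
    of a module over the algebra; with [phi = id] on [k^o] they are the ideals of [k]. *)
Definition opsub U : Prop :=
  [/\ U 0, forall x y, U x -> U y -> U (x + y), forall x, U x -> U (- x)
    & forall c x, U x -> U (phi c *: x)].

Lemma submod_opsub U : submod U -> opsub U.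
Proof. by move=> sU; have [U0 UD UZ] := sU; split=> // [x Ux|c x]; [apply: submodN|apply: UZ]. Qed.

Lemma opsubB U x y : opsub U -> U x -> U y -> U (x - y).
Proof. by move=> [_ UD UN _] Ux Uy; apply: UD => //; apply: UN. Qed.

Lemma opsubI U V : opsub U -> opsub V -> opsub (U `&` V).
Proof.
move=> [U0 UD UN UZ] [V0 VD VN VZ]; split=> //.
- by move=> x y [? ?] [? ?]; split; [apply: UD|apply: VD].
- by move=> x [? ?]; split; [apply: UN|apply: VN].
- by move=> c x [? ?]; split; [apply: UZ|apply: VZ].
Qed.

Lemma opsub_add U V : opsub U -> opsub V ->
  opsub [set x | exists u v, [/\ U u, V v & x = u + v]].
Proof.
move=> [U0 UD UN UZ] [V0 VD VN VZ]; split.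
- by exists 0, 0; rewrite addr0.
- move=> _ _ [u [v [? ? ->]]] [u' [v' [? ? ->]]].
  by exists (u + u'), (v + v'); split; [exact: UD|exact: VD|rewrite addrACA].
- move=> _ [u [v [? ? ->]]].
  by exists (- u), (- v); split; [exact: UN|exact: VN|rewrite opprD].
- move=> c _ [u [v [? ? ->]]].
  by exists (phi c *: u), (phi c *: v); split; [exact: UZ|exact: VZ|rewrite scalerDr].
Qed.

Definition nstrict (W : nat -> set A) N :=
  (\sum_(i < N) ~~ `[< W i.+1 `<=` W i >])%N.

(** Chains may repeat terms and only their strict steps are counted. Intersections, sums, images and
    preimages of a chain are then chains again, without reindexing. *)
Definition length_le b V U : Prop :=
  forall N (W : nat -> set A), (forall i, opsub (W i)) ->
    (forall i, V `<=` W i) -> (forall i, W i `<=` U) ->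
    (forall i, W i `<=` W i.+1) -> (nstrict W N <= b)%N.

Lemma length_le_sub b V U V' U' : V `<=` V' -> U' `<=` U ->
  length_le b V U -> length_le b V' U'.
Proof.
move=> VV' UU' h N W sW VW WU W1; apply: h => // i x.
  by move=> /VV'; apply: VW.
by move=> /WU; apply: UU'.
Qed.

Lemma length_leW b c V U : (b <= c)%N -> length_le b V U -> length_le c V U.
Proof. by move=> bc h N W *; apply: leq_trans bc; apply: h. Qed.

Lemma length_le0 V : length_le 0 V V.
Proof.
move=> N W sW VW WV W1; rewrite /nstrict big1 // => i _.
by apply/eqP; rewrite eqb0 negbK; apply/asboolP => x /WV /VW.
Qed.

(** By the modular law a strict step of [W] remains strict after intersecting with [Y] or after
    adding [Y]. *)
Lemma length_leD a b V Y U : opsub Y -> V `<=` Y -> Y `<=` U -> opsub U ->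
  length_le a V Y -> length_le b Y U -> length_le (a + b) V U.
Proof.
move=> sY VY YU sU ha hb N W sW VW WU W1.
pose S i := [set x | exists u v, [/\ W i u, Y v & x = u + v]].
have Y0 : Y 0 by case: sY.
have := ha N (fun i => W i `&` Y); have := hb N S.
move=> h1 h2; apply: leq_trans (leq_add (h2 _ _ _ _) (h1 _ _ _ _)).
- rewrite /nstrict -big_split /=; apply: leq_sum => i _.
  case: (asboolP (W i.+1 `<=` W i)) => //= h.
  case: asboolP => //= e1; case: asboolP => //= e2; exfalso; apply: h => x Wx.
  have [w [y [Ww Yy xE]]] : S i x by apply: e2; exists x, 0; rewrite addr0.
  have Wy : W i y.
    apply: (e1 _ _).1; split=> //.
    have -> : y = x - w by rewrite xE addrC addKr.
    by apply: opsubB => //; apply: W1.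
  by rewrite xE; case: (sW i) => _ D _ _; apply: D.
- by move=> i; apply: opsubI.
- by move=> i x Vx; split; [apply: VW|apply: VY].
- by move=> i x [].
- by move=> i x [Wx Yx]; split=> //; apply: W1.
- by move=> i; apply: opsub_add.
- by move=> i y Yy; exists 0, y; rewrite add0r; split=> //; case: (sW i).
- move=> i _ [w [y [Ww Yy ->]]]; case: sU => _ D _ _.
  by apply: D; [apply: WU Ww|apply: YU].
- by move=> i _ [w [y [Ww Yy ->]]]; exists w, y; split=> //; apply: W1.
Qed.

(** Putting [V] in front of a chain between [V'] and [U] adds a strict step, so such a chain has
    fewer than [b] of them; the constant chain at [V'] shows that [b] is positive. *)
Lemma length_le_below b V V' U : opsub V -> opsub V' -> V `<=` V' -> V' `<=` U ->
  ~ (V' `<=` V) -> length_le b V U -> (0 < b)%N /\ length_le b.-1 V' U.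
Proof.
move=> sV sV' VV' V'U nV'V h.
have H N (W : nat -> set A) : (forall i, opsub (W i)) -> (forall i, V' `<=` W i) ->
    (forall i, W i `<=` U) -> (forall i, W i `<=` W i.+1) -> (nstrict W N < b)%N.
  move=> sW VW WU W1.
  have := h N.+1 (fun i => if i is j.+1 then W j else V).
  rewrite /nstrict big_ord_recl /=.
  case: asboolP => [h'|_ /=]; first by case: nV'V => x /VW /h'.
  rewrite add1n; apply; case=> [|i] //.
  - by move=> x /VV'; apply: VW.
  - by move=> x /VV'; apply: V'U.
  - by move=> x /VV'; apply: VW.
have lt0 : (0 < b)%N.
  by apply: leq_ltn_trans (H 0%N (fun=> V') (fun=> sV') _ (fun=> V'U) _) => // _ x.
split=> // N W sW VW WU W1.
by rewrite -ltnS prednK //; apply: H.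
Qed.

Lemma length_le_above b V V' U : opsub U -> V `<=` V' -> V' `<=` U ->
  ~ (U `<=` V') -> length_le b V U -> length_le b.-1 V V'.
Proof.
move=> sU VV' V'U nUV' h N W sW VW WV' W1.
have := h N.+1 (fun i => if (i <= N)%N then W i else U).
rewrite /nstrict big_ord_recr /= leqnn ltnn.
have -> : `[< U `<=` W N >] = false.
  by apply/asboolP => h'; apply: nUV' => x /h' /WV'.
rewrite addn1 => H.
rewrite -ltnS (leq_trans _ (leqSpred _)) //.
apply: leq_trans (H _ _ _ _).
- rewrite ltnS leq_eqVlt; apply/orP; left; apply/eqP.
  by apply: eq_bigr => i _; rewrite (ltn_ord i) (ltnW (ltn_ord i)).
- by move=> i; case: ifP.
- by move=> i x Vx; case: ifP => _; [apply: VW|apply/V'U/VV'].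
- by move=> i x; case: ifP => _ // /WV'; apply: V'U.
- move=> i; case: ltnP => [lt|le]; first by rewrite (ltnW lt); apply: W1.
  by case: ifP => _ // x /WV' /V'U.
Qed.

Lemma length_le_simple V U :
  (forall Y, opsub Y -> V `<=` Y -> Y `<=` U -> Y `<=` V \/ U `<=` Y) ->
  length_le 1 V U.
Proof.
move=> h N W sW VW WU W1.
(* The induction also has to know that the first strict step already reaches all of [U]. *)
suff: (nstrict W N <= 1)%N /\ ((0 < nstrict W N)%N -> U `<=` W N) by case.
elim: N => [|N [le1 hN]]; first by rewrite /nstrict big_ord0.
rewrite /nstrict big_ord_recr /= -/(nstrict W N).
case: (posnP (nstrict W N)) => [->|/[dup] p /hN UW].
  rewrite add0n; split; first by case: asboolP.
  case: asboolP => // nh _; have [hV|//] := h _ (sW N.+1) (VW _) (WU _).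
  by case: nh => x /hV /VW.
have -> : `[< W N.+1 `<=` W N >] by apply/asboolP => x /WU /UW.
by rewrite addn0; split=> // _ x /UW; apply: W1.
Qed.

Lemma length_le_add b U Y : opsub Y -> length_le b [set 0] Y -> opsub U ->
  length_le b U [set x | exists u v, [/\ U u, Y v & x = u + v]].
Proof.
move=> sY h sU N W sW VW WU W1.
apply: leq_trans (h N (fun i => W i `&` Y) _ _ _ _); first last.
- by move=> i x [/W1].
- by move=> i x [].
- by move=> i _ ->; split; [case: (sW i)|case: sY].
- by move=> i; apply: opsubI.
apply: leq_sum => i _.
case: (asboolP (W i.+1 `<=` W i)) => //= hW; case: asboolP => //= hI.
exfalso; apply: hW => x /[dup] Wx /WU [u [y [Uu Yy E]]].
have Wu := VW i _ Uu; rewrite E; case: (sW i) => _ D _ _; apply: D => //.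
apply: (hI _ _).1; split=> //.
have -> : y = u + y - u by rewrite addrC addKr.
by rewrite -E; apply: opsubB => //; apply: W1.
Qed.

Lemma opsub0 : opsub [set 0].
Proof. by split=> [|x y -> ->|x ->|c x ->] //=; rewrite ?addr0 ?oppr0 ?scaler0. Qed.

(** The clause for a new generator has the shape of [opsub_add] and [submod_add]: adjoining an
    element to a span is, by conversion, a sum with its multiples. *)
Fixpoint opspan (ws : seq A) : set A := if ws is w :: ws' then
  [set x | exists u v, [/\ opspan ws' u, (exists c, v = phi c *: w) & x = u + v]]
  else [set 0].

End Length.

(** The map [f] only respects addition and the operators. This covers multiplication by an element
    of the algebra, which is linear over [k] but in general not over the algebra. *)
Lemma length_le_preimage (T : Type) (R R' : pzRingType) (phi : T -> R) (phi' : T -> R')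
    (A : lmodType R)
    (C : lmodType R') (f : A -> C) b (U : set A) (V' U' : set C) :
  {morph f : x y / x + y} -> (forall c x, f (phi c *: x) = phi' c *: f x) ->
  opsub phi U -> (forall x, U x -> U' (f x)) ->
  (forall y, V' y -> exists2 x, U x & f x = y) -> V' 0 ->
  length_le phi' b V' U' -> length_le phi b [set x | U x /\ V' (f x)] U.
Proof.
move=> fD fZ sU UU' V'U V'0 h N W sW VW WU W1.
have f0 : f 0 = 0 by apply: (addrI (f 0)); rewrite -fD !addr0.
have fN x : f (- x) = - f x by apply: (addrI (f x)); rewrite -fD !addrN.
apply: leq_trans (h N (fun i => f @` W i) _ _ _ _); first last.
- by move=> i _ [x Wx <-]; exists x => //; apply: W1.
- by move=> i _ [x Wx <-]; apply: UU'; apply: (WU i).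
- by move=> i y Vy; have [x Ux e] := V'U y Vy; exists x => //; apply: VW; rewrite /= e.
- move=> i; have [W0 WD WN WZ] := sW i; split.
  + by exists 0.
  + by move=> _ _ [x Wx <-] [y Wy <-]; exists (x + y) => //; apply: WD.
  + by move=> _ [x Wx <-]; exists (- x) => //; apply: WN.
  + by move=> c _ [x Wx <-]; exists (phi c *: x) => //; apply: WZ.
apply: leq_sum => i _.
case: (asboolP (W i.+1 `<=` W i)) => //= hW; case: asboolP => //= hI.
exfalso; apply: hW => x Wx.
have [w Ww e] : (f @` W i) (f x) by apply: hI; exists x.
have -> : x = w + (x - w) by rewrite addrC subrK.
case: (sW i) => _ D _ _; apply: D => //; apply: VW; split.
  exact: (opsubB sU (WU _ _ Wx) (WU _ _ Ww)).
by rewrite fD fN e subrr.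
Qed.

Lemma length_le_image (T : Type) (R R' : pzRingType) (phi : T -> R) (phi' : T -> R')
    (A : lmodType R)
    (C : lmodType R') (f : A -> C) b (V U : set A) (V' U' : set C) :
  {morph f : x y / x + y} -> (forall c x, f (phi c *: x) = phi' c *: f x) ->
  opsub phi U -> (forall y, U' y -> exists2 x, U x & f x = y) ->
  (forall x, V x -> U x /\ V' (f x)) ->
  length_le phi b V U -> length_le phi' b V' U'.
Proof.
move=> fD fZ sU U'U VV' h N W sW VW WU W1.
have f0 : f 0 = 0 by apply: (addrI (f 0)); rewrite -fD !addr0.
have fN x : f (- x) = - f x by apply: (addrI (f x)); rewrite -fD !addrN.
have [U0 UD UN UZ] := sU.
apply: leq_trans (h N (fun i => [set x | U x /\ W i (f x)]) _ _ _ _); first last.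
- by move=> i x [Ux /W1].
- by move=> i x [].
- by move=> i x /VV' [Ux /VW].
- move=> i; have [W0 WD WN WZ] := sW i; split=> /=.
  + by rewrite f0.
  + by move=> x y [? ?] [? ?]; rewrite fD; split; [apply: UD|apply: WD].
  + by move=> x [? ?]; rewrite fN; split; [apply: UN|apply: WN].
  + by move=> c x [? ?]; rewrite fZ; split; [apply: UZ|apply: WZ].
apply: leq_sum => i _.
case: (asboolP (W i.+1 `<=` W i)) => //= hW; case: asboolP => //= hI.
exfalso; apply: hW => y Wy; have [x Ux e] := U'U y (WU _ _ Wy).
by rewrite -e; apply: (hI x _).2; split=> //; rewrite e.
Qed.

(** * Commutative artinian rings have finite length *)

Section Artinian.
Variable k : comPzRingType.
Hypothesis kA : artinian k.
Let len := @length_le k k id (k^o).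

Lemma ideal_opsub (I : set k) : is_ideal I <-> opsub id (I : set k^o).
Proof.
split=> [[I0 ID IM]|[I0 ID IN IM]]; last by split.
by split=> // x Ix; rewrite -mulN1r; apply: IM.
Qed.

Lemma artinian_min (Q : set k -> Prop) : (exists I, is_ideal I /\ Q I) ->
  exists I, [/\ is_ideal I, Q I &
    forall J, is_ideal J -> Q J -> J `<=` I -> I `<=` J].
Proof.
move=> [I0 [iI0 QI0]]; apply: contrapT => H.
pose T := {I : set k | is_ideal I /\ Q I}.
have step (I : T) : exists J : T, proj1_sig J `<=` proj1_sig I /\
    ~ (proj1_sig I `<=` proj1_sig J).
  case: I => I [iI QI] /=; apply: contrapT => n; apply: H.
  exists I; split=> // J iJ QJ JI; apply: contrapT => nIJ.
  by apply: n; exists (exist _ J (conj iJ QJ)).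
pose f I := projT1 (cid (step I)).
have fP I : proj1_sig (f I) `<=` proj1_sig I /\ ~ (proj1_sig I `<=` proj1_sig (f I)).
  by rewrite /f; case: cid.
pose s := fix s i : T := if i is j.+1 then f (s j) else exist _ I0 (conj iI0 QI0).
have [] := kA (I := fun i => proj1_sig (s i)).
- by move=> i; case: (proj2_sig (s i)).
- by move=> i x; apply: (fP (s i)).1.
move=> N hN; apply: (fP (s N)).2; exact: (hN N.+1 (leqnSn N)).
Qed.

(** The ideals generated by the powers of [y] descend, whence y^N = y^(N+1) z for some N and z. As
    [D] lies in y D, each of its elements is a multiple of y^N, and on such multiples z y is the
    identity. *)
Lemma artinian_inv (y : k) (D : set k) :
  (forall d, D d -> exists2 d', D d' & d = y * d') ->
  exists z, forall d, D d -> d = z * y * d.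
Proof.
move=> yD.
have [||N hN] := kA (I := fun i => [set x | exists a, x = y ^+ i * a]).
- move=> i; split=> [|_ _ [a ->] [b ->]|c _ [a ->]].
  + by exists 0; rewrite mulr0.
  + by exists (a + b); rewrite mulrDr.
  + by exists (c * a); rewrite mulrCA.
- by move=> i _ [a ->]; exists (y * a); rewrite exprSr mulrA.
have [z zE] : exists z, y ^+ N = y ^+ N.+1 * z.
  by apply: (hN N.+1 (leqnSn N)); exists 1; rewrite mulr1.
exists z => d Dd.
have [d' -> ] : exists d', d = y ^+ N * d'.
  elim: {zE hN} N d Dd => [|n IH] d /yD [d' Dd' ->]; first by exists (y * d'); rewrite mul1r.
  by have [e ->] := IH d' Dd'; exists e; rewrite exprS mulrA.
by rewrite {1}zE exprS; ring.
Qed.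

(* Let [I] be the least ideal of finite colength. If [I] is nonzero, take [D] minimal among the
   nonzero ideals [x I]: every scalar acts on [D] by zero or invertibly, so [D] has a maximal
   subideal, which pulls back along [x] to an ideal of finite colength smaller than [I]. *)
Lemma artinian_length : exists b, len b [set 0] [set: k].
Proof.
have [|I [iI [b lI] minI]] := @artinian_min (fun I => exists b, len b I [set: k]).
  by exists [set: k]; split=> //; exists 0%N; apply: length_le0.
have [I0 ID IM] := iI.
have [I00|nI] := pselect (I `<=` [set 0]).
  by exists b; apply: length_le_sub lI => //.
exfalso.
pose m x : set k := [set y | exists2 i, I i & y = x * i].
have im x : is_ideal (m x).
  split=> [|_ _ [i Ii ->] [j Ij ->]|c _ [i Ii ->]].
  - by exists 0; rewrite ?mulr0.
  - by exists (i + j); [exact: ID|rewrite mulrDr].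
  - by exists (c * i); [exact: IM|rewrite mulrCA].
have [|D [iD [[x DE] nD] minD]] :=
    @artinian_min (fun D => (exists x, D = m x) /\ ~ (D `<=` [set 0])).
  exists (m 1); split=> //; split; first by exists 1.
  by move=> h; apply: nI => i Ii; apply: h; exists i => //; rewrite mul1r.
have [D0 DD DM] := iD.
have fieldD y : (exists2 d, D d & y * d <> 0) ->
    exists z, forall d, D d -> d = z * y * d.
  move=> [d Dd yd]; apply: artinian_inv => e De.
  have : m (y * x) e.
    apply: minD => //.
    - split; first by exists (y * x).
      move=> h; apply: yd; apply: h.
      by move: Dd; rewrite DE => -[i Ii ->]; exists i => //; rewrite mulrA.
    - move=> _ [i Ii ->]; rewrite -mulrA; apply: DM; rewrite DE; by exists i.
  move=> [i Ii ->]; exists (x * i); last by rewrite mulrA.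
  by rewrite DE; exists i.
have [d0 Dd0 d00] : exists2 d, D d & d <> 0.
  apply: contrapT => h; apply: nD => d Dd; apply: contrapT => n.
  by apply: h; exists d.
(* Avoiding [d0] together with the complement of [D] makes [N] maximal among the ideals inside [D]
   that miss [d0]. *)
have [|N [sN aN maxN]] :=
    @max_avoiding k k^o [set d | d = d0 \/ ~ D d].
  by move=> [e|//]; apply: d00; rewrite -e.
have ND : N `<=` D.
  by move=> n Nn; apply: contrapT => nDn; apply: (aN _ Nn); right.
have nNd0 : ~ N d0 by move=> h; apply: (aN _ h); left.
(* By maximality d0 = n + c v for some n in [N]. Here c v is nonzero, so c acts invertibly on [D]
   and the relation can be solved for v. Hence nothing lies strictly between [N] and [D]. *)
have reach v : D v -> ~ N v -> exists n c,
    [/\ N n, v = n + c * d0 & exists n' c', N n' /\ d0 = n' + c' * v].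
  move=> Dv nNv.
  have [d0E|] := pselect (exists n c, N n /\ d0 = n + c * v); last first.
    move=> h; exfalso; apply: nNv.
    have sNv := submod_add sN (submod_line (v : k^o)).
    apply: (maxN _ sNv).
    - by move=> n Nn; exists n, 0; split=> //; [exists 0; rewrite scale0r|rewrite addr0].
    - move=> _ [n [_ [Nn [c ->] ->]]] [e|nD'].
        by apply: h; exists n, c.
      by apply: nD'; apply: DD; [apply: ND|apply: DM].
    - exists 0, v; split; [by case: sN|by exists 1; rewrite scale1r|by rewrite add0r].
  have [n [c [Nn E]]] := d0E.
  have [|z zE] := fieldD c.
    exists v => // cv; apply: nNd0; by rewrite E cv addr0.
  exists (- (z * n)), z; split; last by exists n, c.
    by rewrite -mulNr; case: sN => _ _ NZ; apply: (NZ (- z) n).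
  by rewrite {1}(zE v Dv) E mulrDr addKr mulrA.
pose I' : set k := [set i | I i /\ N (x * i)].
have sI' : is_ideal I'.
  have [N0 NDD NZ] := sN; split=> [|i j [? ?] [? ?]|c i [? ?]].
  - by split=> //; rewrite mulr0.
  - by split; [apply: ID|rewrite mulrDr; apply: NDD].
  - by split; [apply: IM|rewrite mulrCA; apply: NZ].
have l1 : len 1 N D.
  apply: length_le_simple => Y sY NY YD.
  have [YN|nYN] := pselect (Y `<=` N); [by left|right].
  have [v Yv nNv] : exists2 v, Y v & ~ N v.
    apply: contrapT => h; apply: nYN => v Yv; apply: contrapT => n.
    by apply: h; exists v.
  have [_ YY _ YZ] := sY.
  have Yd0 : Y d0.
    have [_ [_ [_ _ [n [c [Nn ->]]]]]] := reach v (YD _ Yv) nNv.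
    by apply: YY; [apply: NY|apply: YZ].
  move=> d Dd; have [/NY //|nNd] := pselect (N d).
  have [n [c [Nn -> _]]] := reach d Dd nNd.
  by apply: YY; [apply: NY|apply: YZ].
have l2 : len 1 I' I.
  apply: (@length_le_preimage k k k id id k^o k^o (fun i => x * i) 1 I N D _ _ _ _ _ _ l1).
  - by move=> i j; rewrite mulrDr.
  - by move=> c i; rewrite mulrCA.
  - exact/ideal_opsub.
  - by move=> i Ii; rewrite DE; exists i.
  - by move=> n /ND; rewrite DE => -[i Ii ->]; exists i.
  - by case: sN.
have l3 : len (1 + b) I' [set: k].
  by apply: length_leD lI => //; [exact/ideal_opsub|move=> i []].
have II' : I `<=` I'.
  by apply: minI => //; [exists (1 + b)%N|move=> i []].
apply: nNd0; move: Dd0; rewrite DE => -[i /II' [Ii Ni] ->]; exact: Ni.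
Qed.

End Artinian.

(** * Modules over artin algebras *)

Section ArtinAlgebra.
Variables (k : comPzRingType) (L : algType k).
Hypothesis hL : artin_algebra L.
Let phi (c : k) : L^c := c%:A.

Lemma phiC (A : lmodType L^c) c (l : L^c) (a : A) :
  phi c *: (l *: a) = l *: (phi c *: a).
Proof.
rewrite !scalerA; congr (_ *: _).
by rewrite /GRing.mul /= mulr_algl mulr_algr.
Qed.

Lemma phiA (A : lmodType L^c) c (l : L^c) (a : A) :
  phi c *: (l *: a) = ((c *: (l : L)) : L^c) *: a.
Proof.
rewrite scalerA; congr (_ *: _).
by rewrite /GRing.mul /= mulr_algr.
Qed.

Lemma phiD c d : phi (c + d) = phi c + phi d.
Proof. exact: scalerDl. Qed.

Lemma phiM c d : phi (c * d) = phi c * phi d.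
Proof. by rewrite /phi /GRing.mul /= mulr_algl scalerA mulrC. Qed.

Lemma opsub_span (T : Type) (R : pzRingType) (psi : T -> R) (A : lmodType R) (ws : seq A) :
  (forall c d, exists e, forall a : A, psi c *: a + psi d *: a = psi e *: a) ->
  (forall c d, exists e, forall a : A, psi c *: (psi d *: a) = psi e *: a) ->
  (exists e, forall a : A, psi e *: a = 0) ->
  (forall c, exists e, forall a : A, - (psi c *: a) = psi e *: a) ->
  opsub psi (opspan psi ws).
Proof.
move=> pD pM [z pz] pN; elim: ws => [|w ws IH]; first exact: opsub0.
apply: (@opsub_add _ _ psi A _ [set v | exists c, v = psi c *: w] IH); split.
- by exists z; rewrite pz.
- by move=> _ _ [c ->] [d ->]; have [e E] := pD c d; exists e.
- by move=> _ [c ->]; have [e E] := pN c; exists e.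
- by move=> c _ [d ->]; have [e E] := pM c d; exists e.
Qed.

Lemma opsub_phi_span (A : lmodType L^c) (ws : seq A) : opsub phi (opspan phi ws).
Proof.
apply: opsub_span => [c d|c d||c].
- by exists (c + d) => a; rewrite phiD scalerDl.
- by exists (c * d) => a; rewrite scalerA phiM.
- by exists 0 => a; rewrite /phi scale0r scale0r.
- by exists (- c) => a; rewrite /phi scaleNr scaleNr.
Qed.

Lemma mem_opspan (A : lmodType L^c) (ws : seq A) c w : w \in ws ->
  opspan phi ws (phi c *: w).
Proof.
elim: ws => //= x ws IH; rewrite inE; case/orP => [/eqP ->|/IH h].
  by exists 0, (phi c *: x); rewrite add0r; split=> //; [case: (opsub_phi_span ws)|exists c].
exists (phi c *: w), 0; rewrite addr0; split=> //.
by exists 0; rewrite /phi scale0r scale0r.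
Qed.

Lemma finite_length (A : lmodType L^c) : finitely_generated A ->
  exists b, length_le phi b [set 0] [set: A].
Proof.
move=> [m [v vP]]; have [kA [p [l lP]]] := hL.
have [b kb] := artinian_length kA.
(* Products of generators of the algebra over [k] with generators of [A] span [A] over [k]. Each
   spans an image of [k], so it adds at most the length [b] of [k]. *)
pose ws := [seq (l j : L^c) *: v i | i <- enum 'I_m, j <- enum 'I_p].
exists (size ws * b)%N.
have : length_le phi (size ws * b) [set 0] (opspan phi ws).
  elim: ws => [|w ws IH] /=; first by apply: length_le0.
  rewrite mulSn addnC.
  have sl : opsub phi [set v | exists c, v = phi c *: w].
    split.
    - by exists 0; rewrite /phi scale0r scale0r.
    - by move=> _ _ [c ->] [d ->]; exists (c + d); rewrite phiD scalerDl.
    - by move=> _ [c ->]; exists (- c); rewrite /phi scaleNr scaleNr.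
    - by move=> c _ [d ->]; exists (c * d); rewrite scalerA phiM.
  apply: length_leD IH _ => //.
  - exact: opsub_phi_span.
  - by move=> _ ->; case: (opsub_phi_span ws).
  - by move=> x; exists x, 0; rewrite addr0; split=> //; case: sl.
  - exact: opsub_phi_span (w :: ws).
  apply: length_le_add => //; last exact: opsub_phi_span.
  apply: (@length_le_image k k _ id phi k^o A (fun c => phi c *: w)) kb.
  - by move=> c d; rewrite phiD scalerDl.
  - by move=> c d; rewrite scalerA -phiM.
  - exact/ideal_opsub.
  - by move=> _ [c ->]; exists c.
  - by move=> _ ->; split=> //=; rewrite /phi scale0r scale0r.
apply: length_le_sub => // x _.
have [c ->] := vP x.
have [s0 sD _ _] := opsub_phi_span ws.
elim/big_ind: _ => // i _; have [d E] := lP (c i).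
have -> : c i = \sum_j (d j *: l j : L) :> L^c by [].
rewrite scaler_suml; elim/big_ind: _ => // j _.
rewrite -phiA; apply: mem_opspan.
by apply/allpairsP; exists (i, j); rewrite !mem_enum.
Qed.

End ArtinAlgebra.

Lemma opspan_sum (R : pzRingType) (A : lmodType R) (ws : seq A) x :
  opspan (@id R) ws x -> exists c : 'I_(size ws) -> R, x = \sum_i c i *: ws`_i.
Proof.
elim: ws x => [|w ws IH] x /=; first by move=> ->; exists (fun=> 0); rewrite big_ord0.
move=> [_ [_ [/IH [c ->] [d ->] ->]]].
exists (fun i => if unlift ord0 i is Some j then c j else d).
rewrite big_ord_recl /= unlift_none addrC; congr (_ + _).
by apply: eq_bigr => i _; rewrite liftK.
Qed.

Definition essential (R : pzRingType) (X A : lmodType R) (i : {linear X -> A}) :=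
  forall U : set A, submod U -> (forall x, U (i x) -> x = 0) -> U `<=` [set 0].

Section ArtinAlgebra.
Variables (k : comPzRingType) (L : algType k).
Hypothesis hL : artin_algebra L.
Let phi (c : k) : L^c := c%:A.
Notation len := (length_le phi).

(** As long as the finitely generated [V] is not all of [U], adjoining an element of [U] lowers the
    remaining length, so finitely many generators suffice. *)
Lemma fg_of_length (A : lmodType L^c) b (V U : set A) :
  submod V -> submod U -> V `<=` U -> len b V U ->
  (exists ws : seq A, V = opspan (@id L^c) ws) -> exists ws, U = opspan (@id L^c) ws.
Proof.
have [n] := ubnP b; elim: n b V => // n IH b V ltbn sV sU VU h [ws VE].
have [UV|nUV] := pselect (U `<=` V); first by exists ws; rewrite -VE; apply/seteqP.
have [u Uu nVu] : exists2 u, U u & ~ V u.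
  by apply: contrapT => nn; apply: nUV => u Uu; apply: contrapT => n'; apply: nn; exists u.
have sV' := submod_add sV (submod_line u); set V' := (fun x => _) in sV'.
have V'U : V' `<=` U.
  by move=> _ [v [_ [/VU Vv [c ->] ->]]]; case: sU => _ D Z; apply: D => //; apply: Z.
have VV' : V `<=` V'.
  by move=> v Vv; exists v, 0; rewrite addr0; split=> //; exists 0; rewrite scale0r.
have V'u : V' u.
  by exists 0, u; rewrite add0r; split=> //; [case: sV|exists 1; rewrite scale1r].
have [b0 h'] := length_le_below (submod_opsub phi sV) (submod_opsub phi sV')
  VV' V'U (fun s => nVu (s _ V'u)) h.
apply: (IH b.-1 V') => //; first by rewrite prednK.
by exists (u :: ws); rewrite /= -VE.
Qed.

Lemma submod_fg (A : lmodType L^c) (U : A -> Prop) : finitely_generated A ->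
  submod U -> exists (K : fgmod L^c) (i : {linear K -> A}),
    injective i /\ forall x, U x <-> exists y, i y = x.
Proof.
move=> fA sU; have [b hb] := finite_length hL fA.
have [|||||ws UE] := @fg_of_length A b [set 0] U.
- by split=> [|x y -> ->|c x ->] //=; rewrite ?addr0 ?scaler0.
- by [].
- by move=> _ ->; case: sU.
- exact: length_le_sub hb.
- by exists [::].
have [K [i [ii iU]]] := ex_sub sU.
have wsU j : j \in ws -> U j.
  rewrite UE; elim: (ws) => //= x s IH; rewrite inE => /orP [/eqP ->|/IH h].
    exists 0, x; rewrite add0r; split=> //; last by exists 1; rewrite scale1r.
    by elim: (s) => //= y t h; exists 0, 0; rewrite addr0; split=> //; exists 0; rewrite scale0r.
  by exists j, 0; rewrite addr0; split=> //; exists 0; rewrite scale0r.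
have g j : exists y, i y = ws`_(j : 'I_(size ws)).
  by apply/iU/wsU; rewrite mem_nth.
have fK : finitely_generated K.
  exists (size ws), (fun j => projT1 (cid (g j))) => y.
  have : U (i y) by apply/iU; exists y.
  rewrite UE => /opspan_sum [c E]; exists c; apply: ii.
  rewrite E linear_sum; apply: eq_bigr => j _.
  by rewrite linearZ; case: cid => z /= ->.
by exists (FGMod fK), i.
Qed.

(** * Essential extensions and enough injectives *)

Section EssentialLength.
Variables (X A : lmodType L^c) (i : {linear X -> A}) (lX : nat).
Hypotheses (ii : injective i) (essi : essential i) (hX : len lX [set 0] [set: X]).

Let Ann (V : set (L^c)^o) : set A := [set a | forall v, V v -> (v : L^c) *: a = 0].

Lemma opsub_Ann V : opsub phi (Ann V).
Proof.
split=> [v _|a b ha hb v Vv|a ha v Vv|c a ha v Vv] /=.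
- by rewrite scaler0.
- by rewrite scalerDr ha // hb // addr0.
- by rewrite scalerN ha // oppr0.
- by rewrite -(phiC c v) ha // scaler0.
Qed.

(* If U covers V and l is in U but not in V, then a |-> l a maps Ann V to X with kernel Ann U:
   a nonzero l a generates a simple module, which meets X because X is essential in A. *)
Lemma length_Ann b V : submod V -> len b V [set: (L^c)^o] ->
  len (b * lX) [set 0] (Ann V).
Proof.
have [n] := ubnP b; elim: n b V => // n IH b V ltbn sV h.
have [TV|nTV] := pselect ([set: (L^c)^o] `<=` V).
  apply: (@length_leW _ _ _ _ 0) => //; apply: length_le_sub (@length_le0 _ _ _ _ [set 0]) => //.
  by move=> a /(_ 1 (TV _ I)); rewrite scale1r.
(* A submodule strictly above [V] with the least length bound over [V] has nothing strictly between:
   it is generated over [V] by any one of its elements outside [V]. *)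
pose P c := `[< exists U : set (L^c)^o, [/\ submod U, V `<=` U, ~ (U `<=` V) & len c V U] >].
have exP : exists c, P c.
  by exists b; apply/asboolP; exists [set: (L^c)^o]; split.
case: (ex_minnP exP) => c /asboolP [U [sU VU nUV hc]] minc.
have [l Ul nVl] : exists2 l, U l & ~ V l.
  by apply: contrapT => nn; apply: nUV => u Uu; apply: contrapT => n'; apply: nn; exists u.
have oV := submod_opsub phi sV; have oU := submod_opsub phi sU.
have reach m : U m -> ~ V m -> forall u, U u -> exists v (d : L^c), V v /\ u = v + d * (m : L^c).
  move=> Um nVm.
  have sU' := submod_add sV (submod_line m).
  set U' := (fun x => _) in sU'.
  have VU' : V `<=` U'.
    by move=> v Vv; exists v, 0; rewrite addr0; split=> //; exists 0; rewrite scale0r.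
  have U'U : U' `<=` U.
    by move=> _ [v [_ [/VU Vv [d ->] ->]]]; case: sU => _ D Z; apply: D => //; apply: Z.
  have U'm : U' m.
    by exists 0, m; rewrite add0r; split=> //; [case: sV|exists 1; rewrite scale1r].
  have UU' : U `<=` U'.
    apply: contrapT => nUU'.
    have h1 := length_le_above oU VU' U'U nUU' hc.
    have [c0 _] := length_le_below oV oU VU (@subset_refl _ U) nUV hc.
    have : P c.-1 by apply/asboolP; exists U'; split=> // /(_ m U'm).
    by move=> /minc; rewrite -ltnS prednK // ltnn.
  by move=> u /UU' [v [_ [Vv [d ->] ->]]]; exists v, d.
have [b0 hb] := length_le_below oV oU VU (@subsetT _ U) nUV h.
have IHU : len (b.-1 * lX) [set 0] (Ann U).
  by apply: IH => //; rewrite prednK.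
have hi : len lX [set 0] (range i).
  apply: (length_le_image (phi := phi) (f := i)) hX => //.
  - exact: linearD.
  - by move=> d x; rewrite linearZ.
  - by move=> _ ->; split=> //=; rewrite linear0.
pose Y := [set a | Ann V a /\ [set 0] ((l : L^c) *: a)].
have hY : len lX Y (Ann V).
  apply: (length_le_preimage (phi' := phi) (f := fun a => (l : L^c) *: a)) hi.
  - by move=> a a'; rewrite scalerDr.
  - by move=> d a; rewrite (phiC d).
  - exact: opsub_Ann.
  - move=> a Va.
    have [->|la0] := pselect ((l : L^c) *: a = 0); first by exists 0; rewrite ?linear0.
    (* Essentiality gives a nonzero i x = d l a. Then d l is not in [V], so l = v + e d l with v in
       [V], and l a = i (e x). *)
    have [x0|] := pselect (forall x, (exists d, i x = d *: ((l : L^c) *: a)) -> x = 0).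
      exfalso; apply: la0; apply: (essi (submod_line ((l : L^c) *: a)) x0).
      by exists 1; rewrite scale1r.
    move=> /existsNP [x /not_implyP [[d ixE] nx]].
    have nVdl : ~ V ((d * (l : L^c)) : L^c).
      by move=> /Va; rewrite -scalerA -ixE => ix0; apply/nx/ii; rewrite linear0.
    have Udl : U ((d * (l : L^c)) : L^c) by case: sU => _ _ Z; apply: (Z d).
    have [v [e [Vv lE]]] := reach _ Udl nVdl _ Ul.
    exists (e *: x) => //.
    by rewrite linearZ /= ixE [in RHS]lE scalerDl (Va v Vv) add0r -!scalerA.
  - by move=> _ ->; exists 0; [case: (opsub_Ann V)|rewrite scaler0].
  - by [].
have YU : Y `<=` Ann U.
  move=> a [Va la0] u Uu; have [v [e [Vv ->]]] := reach _ Ul nVl _ Uu.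
  by rewrite scalerDl (Va v Vv) add0r -scalerA la0 scaler0.
have oY : opsub phi Y.
  have [A0 AD AN AZ] := opsub_Ann V; rewrite /Y; split=> /=.
  - by rewrite scaler0.
  - by move=> a a' [? e] [? e']; rewrite scalerDr e e' addr0; split=> //; apply: AD.
  - by move=> a [? e]; rewrite scalerN e oppr0; split=> //; apply: AN.
  - by move=> d a [? e]; rewrite -(phiC d) e scaler0; split=> //; apply: AZ.
have -> : (b * lX = b.-1 * lX + lX)%N by rewrite -{1}(prednK b0) mulSn addnC.
apply: (@length_leD _ _ _ _ _ _ _ Y) => //.
- by move=> _ ->; case: oY.
- by move=> a [].
- exact: opsub_Ann.
- exact: length_le_sub IHU.
Qed.

Lemma essential_length b : len b [set 0] [set: (L^c)^o] ->
  len (b * lX) [set 0] [set: A].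
Proof.
have s0 : submod ([set 0] : set (L^c)^o).
  by split=> [//|x y -> ->|c x ->]; rewrite /= ?addr0 ?scaler0.
by move=> /(length_Ann s0); apply: length_le_sub => // a _ v ->; rewrite scale0r.
Qed.

End EssentialLength.

Lemma essential_comp (X A B : lmodType L^c) (i : {linear X -> A}) (j : {linear A -> B}) :
  essential i -> essential j -> essential (j \o i).
Proof.
move=> ei ej U sU h; apply: ej => // a; have [U0 UD UZ] := sU.
apply: (ei [set a | U (j a)]) => //; split=> [|x y|c x] /=.
- by rewrite linear0.
- by rewrite linearD; apply: UD.
- by rewrite linearZ; apply: UZ.
Qed.

(** Divide out a submodule [N] maximal among those that meet the image of [A] trivially. A submodule
    of the quotient that meets it trivially pulls back to such a submodule containing [N], hence is
    zero. *)
Lemma essential_quotient (A Q : lmodType L^c) (j : {linear A -> Q}) : injective j ->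
  exists (E : lmodType L^c) (r : {linear Q -> E}),
    injective (r \o j) /\ essential (r \o j).
Proof.
move=> ij.
have [|N [sN aN maxN]] := @max_avoiding _ Q [set x | x <> 0 /\ exists a, j a = x].
  by move=> [].
have [E [r [rs rN]]] := ex_quot sN.
have jN a : N (j a) -> a = 0.
  move=> Na; apply: contrapT => a0; apply: (aN _ Na); split; last by exists a.
  by move=> ja0; apply/a0/ij; rewrite linear0.
exists E, r; split=> [|U sU h].
  by apply: linear_inj0 => a /rN /jN.
move=> x Ux; have [y yx] := rs x; rewrite -yx; apply/rN.
have [U0 UD UZ] := sU.
apply: (maxN [set y | U (r y)]).
- split=> [|u v|c u] /=; first by rewrite linear0.
    by rewrite linearD; apply: UD.
  by rewrite linearZ; apply: UZ.
- by move=> n /rN /= ->.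
- by move=> z Uy [y0 [a E1]]; apply: y0; move: Uy; rewrite -E1 => /h ->; rewrite linear0.
- by rewrite /= yx.
Qed.

(* An extension problem for A is solved in its pushout, of which A is a retract: a quotient of
   the pushout is an essential extension of A. *)
Lemma max_essential_injective (A : lmodType L^c) :
  (forall (E : lmodType L^c) (j : {linear A -> E}), injective j -> essential j ->
     forall e, exists a, j a = e) -> injective_mod A.
Proof.
move=> maxA B C m f im.
have sU : submod (fun x : A * C => exists b, x = (f b, - m b)).
  split=> [|_ _ [b ->] [b' ->]|c _ [b ->]].
  - by exists 0; rewrite !linear0.
  - by exists (b + b'); rewrite !linearD.
  - by exists (c *: b); rewrite !linearZ.
have [Q [q [qs qU]]] := ex_quot sU.
have [||jA jAE] := @linear_ex _ A Q (fun a => q (a, 0)).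
- by move=> a a'; rewrite -linearD; congr (q _); rewrite /GRing.add /= /add_pair /= addr0.
- by move=> c a; rewrite -linearZ; congr (q _); rewrite /GRing.scale /= /scale_pair /= scaler0.
have [||jC jCE] := @linear_ex _ C Q (fun a => q (0, a)).
- by move=> a a'; rewrite -linearD; congr (q _); rewrite /GRing.add /= /add_pair /= addr0.
- by move=> c a; rewrite -linearZ; congr (q _); rewrite /GRing.scale /= /scale_pair /= scaler0.
have jAi : injective jA.
  apply: linear_inj0 => a; rewrite jAE => /qU [b [-> /esym/eqP]].
  rewrite oppr_eq0 => /eqP mb0; have -> : b = 0 by apply: im; rewrite linear0.
  by rewrite linear0.
have jE b : jA (f b) = jC (m b).
  apply/eqP; rewrite -subr_eq0 jAE jCE -linearB; apply/eqP/qU; exists b.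
  by congr pair; rewrite /= ?subr0 ?sub0r.
have [E [r [ri re]]] := essential_quotient jAi.
have [s sE] := @factor_inj _ _ _ E (r \o jA) idfun ri (maxA E (r \o jA) ri re).
exists (s \o (r \o jC)) => b /=; apply: ri.
by rewrite sE /= jE.
Qed.

(* Essential extensions of X have bounded k-length, so there is a maximal one. *)
Lemma enough_injectives (X : fgmod L^c) : exists (I : fgmod L^c) (i : {linear X -> I}),
  injective i /\ injective_mod I.
Proof.
have [lX hX] := finite_length hL (fgmod_fg X).
have [bL hb] : exists b, len b [set 0] [set: (L^c)^o].
  apply: finite_length hL _ _; exists 1%N, (fun=> 1) => x; exists (fun=> x).
  by rewrite big_ord1; apply: esym; apply: mulr1.
pose P b := `[< forall (A : lmodType L^c) (i : {linear X -> A}), injective i ->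
  essential i -> len b [set 0] [set: A] >].
have exP : exists b, P b.
  by exists (bL * lX)%N; apply/asboolP => A i ii ei; exact: (essential_length ii ei hX hb).
case: (ex_minnP exP) => b /asboolP hbb minb.
(* Since [b] is the least common bound, some essential extension is not bounded by b - 1. For b = 0
   the requirement is void and [X] itself serves. *)
have [A [i [ii ei hA]]] : exists (A : lmodType L^c) (i : {linear X -> A}),
    [/\ injective i, essential i & (0 < b)%N -> ~ len b.-1 [set 0] [set: A]].
  case: (posnP b) => [_|b0].
    by exists X, idfun; split=> // U _ h x /h ->.
  apply: contrapT => H; have : P b.-1.
    apply/asboolP => A i ii ei; apply: contrapT => n; apply: H.
    by exists A, i.
  by move=> /minb; rewrite -ltnS prednK // ltnn.
(* A proper essential extension of [A] is also essential over [X], so its length is at most [b];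
   this would leave at most b - 1 for [A]. *)
have injA : injective_mod A.
  apply: max_essential_injective => E j ij ej e; apply: contrapT => ne.
  have hE : len b [set 0] [set: E].
    apply: (hbb E (j \o i)); last exact: essential_comp.
    exact: inj_comp.
  have orj : opsub phi (range j).
    apply: submod_opsub; have := submod_im j.
    by congr submod; apply/funext => x; apply/propext; split=> -[y]; [exists y|move=> _ <-; exists y].
  have nr : ~ ([set: E] `<=` range j) by move=> /(_ e I) [a _ ae]; apply: ne; exists a.
  have [b0 _] : (0 < b)%N /\ len b.-1 [set: E] [set: E].
    have h : len b (range j) [set: E].
      by apply: length_le_sub hE => // _ ->; case: orj.
    by apply: (length_le_below orj _ _ _ nr h).
  have := hA b0; apply.
  have : len b.-1 [set 0] (range j).
    by apply: (@length_le_above _ _ _ _ _ _ _ [set: E]) => // _ ->; case: orj.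
  move=> h; have := @length_le_preimage _ _ _ phi phi A E j b.-1 [set: A] [set 0] _
    _ _ _ _ _ _ h.
  move=> h'; apply: length_le_sub (h' _ _ _ _ _ _) => //.
  - by move=> a [_ /= ja0]; apply: ij; rewrite linear0.
  - exact: linearD.
  - by move=> c a; rewrite linearZ.
  - by move=> _ ->; exists 0; rewrite ?linear0.
have fA : finitely_generated A.
  have [|||||ws WE] := @fg_of_length A b [set 0] [set: A].
  - by split=> [|x y -> ->|c x ->] //=; rewrite ?addr0 ?scaler0.
  - by [].
  - by [].
  - exact: hbb ii ei.
  - by exists [::].
  exists (size ws), (fun i => ws`_i) => x.
  by apply: opspan_sum; rewrite -WE.
by exists (FGMod fA), i.
Qed.

End ArtinAlgebra.

(** * Vanishing of Ext *)

Section Ext.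
Variable R : pzRingType.
Implicit Types A B C E K L P Q X : lmodType R.

Definition ses K E A (i : {linear K -> E}) (p : {linear E -> A}) : Prop :=
  [/\ injective i, surjective p & forall x, p x = 0 <-> exists y, i y = x].

Lemma sesK K E A (i : {linear K -> E}) (p : {linear E -> A}) y :
  ses i p -> p (i y) = 0.
Proof. by move=> [_ _ h]; apply/h; exists y. Qed.

Lemma ses_lift K E A X (i : {linear K -> E}) (p : {linear E -> A}) (f : {linear X -> E}) :
  ses i p -> (forall x, p (f x) = 0) -> exists g : {linear X -> K}, forall x, i (g x) = f x.
Proof. by move=> [ii _ h] pf; apply: (factor_inj ii) => x; apply/h. Qed.

Lemma ses_desc K E A X (i : {linear K -> E}) (p : {linear E -> A}) (f : {linear E -> X}) :
  ses i p -> (forall x, f (i x) = 0) -> exists g : {linear A -> X}, forall x, g (p x) = f x.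
Proof. by move=> [_ ps h] fi; apply: (factor_surj ps) => x /h [y <-]. Qed.

(** By pushout, this says that all extensions of [A] by [B] split, that is Ext^1(A, B) = 0. In this
    form it applies to any inclusion with cokernel [A], without a projective presentation. *)
Definition ext1_zero A B : Prop :=
  forall K E (i : {linear K -> E}) (p : {linear E -> A}), ses i p ->
  forall g : {linear K -> B}, exists h : {linear E -> B}, forall x, h (i x) = g x.

(* [extS_zero i A B] is the vanishing of Ext^(i+1)(A, B): the index is shifted by one. *)
Fixpoint extS_zero (i : nat) A B : Prop := if i is j.+1 then
  exists K P (u : {linear K -> P}) (p : {linear P -> A}),
    [/\ ses u p, projective P & extS_zero j K B]
  else ext1_zero A B.

(** The middle term [E] of any other sequence is a quotient of P + K', through a lift [w] of [p] and
    the inclusion [i]. The pair formed by the extension [h] and the given [g] vanishes on the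
    kernel, hence descends to [E]. *)
Lemma ext1_of_projective K P A B (u : {linear K -> P}) (p : {linear P -> A}) :
  ses u p -> projective P ->
  (forall g : {linear K -> B}, exists h : {linear P -> B}, forall x, h (u x) = g x) ->
  ext1_zero A B.
Proof.
move=> sup projP H K' E i q siq g.
have [w wE] : exists w : {linear P -> E}, q \o w =1 p by apply: projP; case: siq.
have [wK wKE] : exists wK : {linear K -> K'}, forall x, i (wK x) = (w \o u) x.
  by apply: ses_lift siq _ => x /=; have := wE (u x); rewrite /= => ->; apply: sesK.
have [h hE] := H (g \o wK).
have [||s sE] := @linear_ex _ (P * K')%type E (fun x => w x.1 + i x.2).
- by move=> x y; rewrite !linearD addrACA.
- by move=> c x; rewrite !linearZ scalerDr.
have [||t tE] := @linear_ex _ (P * K')%type B (fun x => h x.1 + g x.2).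
- by move=> x y; rewrite !linearD addrACA.
- by move=> c x; rewrite !linearZ scalerDr.
have [| |H' H'E] := @factor_surj _ _ _ _ s t.
- move=> e; have [_ ps _] := sup; have [x xE] := ps (q e).
  have [_ _ iq] := siq.
  have [y yE] : exists y, i y = e - w x.
    by apply/iq; rewrite linearB -xE; have /= -> := wE x; rewrite subrr.
  by exists (x, y); rewrite sE /= yE addrC subrK.
- move=> [x y]; rewrite sE tE /= => e.
  have [_ _ pu] := sup; have [ii _ _] := siq.
  have px : p x = 0.
    by have /= <- := wE x; rewrite -[w x](addrK (i y)) e sub0r linearN (sesK _ siq) oppr0.
  have [k kE] : exists k, u k = x by apply/pu.
  have -> : y = - wK k.
    apply: ii; rewrite linearN wKE /= kE; apply/eqP; rewrite -addr_eq0 addrC; exact/eqP.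
  by rewrite -kE hE /= linearN subrr.
exists H' => y.
have := H'E (0, y); rewrite sE tE /= !linear0 !add0r => ->; done.
Qed.

Hypothesis noeth : forall A (U : A -> Prop), finitely_generated A ->
  submod U -> exists (K : fgmod R) (i : {linear K -> A}),
    injective i /\ forall x, U x <-> exists y, i y = x.

Lemma fg_surj A B (p : {linear A -> B}) : surjective p ->
  finitely_generated A -> finitely_generated B.
Proof.
move=> ps [m [v vP]]; exists m, (fun i => p (v i)) => y.
have [x <-] := ps y; have [c ->] := vP x; exists c.
by rewrite linear_sum; apply: eq_bigr => i _; rewrite linearZ.
Qed.

Lemma fg_prod A B : finitely_generated A -> finitely_generated B ->
  finitely_generated (A * B)%type.
Proof.
move=> [m [v vP]] [n [w wP]].
exists (m + n)%N, (fun i =>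
  match fintype.split i with inl j => (v j, 0) | inr j => (0, w j) end) => -[x y].
have [c xE] := vP x; have [d yE] := wP y.
exists (fun i => match fintype.split i with inl j => c j | inr j => d j end).
rewrite big_split_ord /= (eq_bigr (fun i => (c i *: v i, 0))); last first.
  by move=> i _; rewrite (unsplitK (inl i)) /GRing.scale /= /scale_pair /= scaler0.
rewrite [X in _ + X](eq_bigr (fun i => (0, d i *: w i))); last first.
  by move=> i _; rewrite (unsplitK (inr i)) /GRing.scale /= /scale_pair /= scaler0.
have -> : \sum_(i < m) (c i *: v i, 0 : B) = (x, 0).
  rewrite xE; elim/big_rec2: _ => // i s t _ ->.
  by rewrite /GRing.add /= /add_pair /= addr0.
have -> : \sum_(i < n) (0 : A, d i *: w i) = (0, y).
  rewrite yE; elim/big_rec2: _ => // i s t _ ->.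
  by rewrite /GRing.add /= /add_pair /= addr0.
by rewrite /GRing.add /= /add_pair /= addr0 add0r.
Qed.

Lemma projective_free m : projective 'rV[R]_m.
Proof.
move=> A B e f es.
pose a j := projT1 (cid (es (f (delta_mx 0 j)))).
have aE j : e (a j) = f (delta_mx 0 j) by rewrite /a; case: cid.
have [||g gE] := @linear_ex _ 'rV[R]_m A (fun u => \sum_j u 0 j *: a j).
- by move=> u v; rewrite -big_split; apply: eq_bigr => j _; rewrite mxE scalerDl.
- by move=> c u; rewrite scaler_sumr; apply: eq_bigr => j _; rewrite mxE scalerA.
exists g => u /=; rewrite gE [in RHS](row_sum_delta u) !linear_sum.
by apply: eq_bigr => j _; rewrite !linearZ aE.
Qed.

Lemma fg_free m : finitely_generated 'rV[R]_m.
Proof.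
by exists m, (fun j => delta_mx 0 j) => u; exists (fun j => u 0 j); exact: row_sum_delta.
Qed.

Lemma free_cover (X : fgmod R) : exists (P : fgmod R) (p : {linear P -> X}),
  projective P /\ surjective p.
Proof.
have [m [v vP]] := fgmod_fg X.
have [||p pE] := @linear_ex _ 'rV[R]_m X (fun u => \sum_j u 0 j *: v j).
- by move=> u w; rewrite -big_split; apply: eq_bigr => j _; rewrite mxE scalerDl.
- by move=> c u; rewrite scaler_sumr; apply: eq_bigr => j _; rewrite mxE scalerA.
exists (FGMod (fg_free m)), p; split; first exact: projective_free.
move=> x; have [c ->] := vP x; exists (\row_j c j); rewrite pE.
by apply: eq_bigr => j _; rewrite mxE.
Qed.

Lemma fg_ker E A (f : {linear E -> A}) : finitely_generated E ->
  exists (K : fgmod R) (i : {linear K -> E}),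
    injective i /\ forall x, f x = 0 <-> exists y, i y = x.
Proof. by move=> fE; apply: noeth (submod_ker f). Qed.

Lemma syzygy (X : fgmod R) : exists (K P : fgmod R) (u : {linear K -> P})
  (p : {linear P -> X}), ses u p /\ projective P.
Proof.
have [P [p [pP ps]]] := free_cover X.
have [K [u [ui uK]]] := fg_ker p (fgmod_fg P).
by exists K, P, u, p; split.
Qed.

(** A lift from the projective cover of [A] restricts on the syzygy to a map into [K]. Extending
    that map to the cover and subtracting it makes the lift descend to [A]. *)
Lemma ext1_lift K E C (A : fgmod R) (i : {linear K -> E}) (p : {linear E -> C})
    (f : {linear A -> C}) :
  ses i p -> ext1_zero A K -> exists g : {linear A -> E}, forall x, p (g x) = f x.
Proof.
move=> sip eA; have [L [P [u [q [suq pP]]]]] := syzygy A.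
have [g gE] : exists g : {linear P -> E}, p \o g =1 f \o q by apply: pP; case: sip.
have [gL gLE] : exists gL : {linear L -> K}, forall x, i (gL x) = (g \o u) x.
  apply: ses_lift sip _ => x /=; have /= -> := gE (u x).
  by rewrite (sesK _ suq) linear0.
have [h hE] := eA _ _ _ _ suq gL.
have [|g' g'E] := ses_desc (f := (g \- (i \o h) : {linear P -> E})) suq.
  by move=> x /=; rewrite hE gLE subrr.
exists g' => a; have [_ qs _] := suq; have [x <-] := qs a.
by rewrite g'E /= linearB (sesK _ sip) subr0; apply: gE.
Qed.

Lemma syzygy_retract A A' Q K P K' P' (j : {linear K -> P}) (p : {linear P -> A})
    (j' : {linear K' -> P'}) (p' : {linear P' -> A'}) (u : {linear A' -> A})
    (v : {linear A -> A'}) (t : {linear A' -> Q}) (s : {linear Q -> A'}) :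
  ses j p -> ses j' p' -> projective P -> projective P' -> projective Q ->
  (forall x, x = v (u x) + s (t x)) ->
  exists (uK : {linear K' -> K}) (vK : {linear K -> K'}) (w : {linear P' -> K'})
    (uP : {linear P' -> P}),
    (forall x, j (uK x) = uP (j' x)) /\ (forall x, x = vK (uK x) + w (j' x)).
Proof.
move=> sjp s' pP pP' pQ uv.
have [_ ps _] := sjp; have [ij' ps' _] := s'.
have [uP uPE] := pP' _ _ p (u \o p') ps.
have [vP vPE] := pP _ _ p' (v \o p) ps'.
have [sP sPE] := pQ _ _ p' s ps'.
have [|uK uKE] := ses_lift (f := uP \o j') sjp.
  by move=> x /=; have /= -> := uPE (j' x); rewrite (sesK _ s') linear0.
have [|vK vKE] := ses_lift (f := vP \o j) s'.
  by move=> x /=; have /= -> := vPE (j x); rewrite (sesK _ sjp) linear0.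
have [|w wE] := ses_lift
  (f := idfun \- ((vP \o uP) \+ (sP \o (t \o p'))) : {linear P' -> P'}) s'.
  move=> x /=; rewrite linearB linearD.
  have /= -> := vPE (uP x); have /= -> := uPE x; have /= -> := sPE (t (p' x)).
  by rewrite -uv subrr.
exists uK, vK, w, uP; split=> // x; apply: ij'.
rewrite linearD vKE wE /= uKE /= (sesK _ s') !linear0 addr0.
by rewrite addrC subrK.
Qed.

(* The syzygies of a retract modulo projectives are again retracts modulo projectives, so
   that [extS_zero] does not depend on the syzygy chosen in its definition. *)
Lemma extS_retract i A (A' : fgmod R) B Q (u : {linear A' -> A})
    (v : {linear A -> A'}) (t : {linear A' -> Q}) (s : {linear Q -> A'}) :
  projective Q -> (forall x, x = v (u x) + s (t x)) ->
  extS_zero i A B -> extS_zero i A' B.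
Proof.
elim: i A A' Q u v t s => [|i IH] A A' Q u v t s pQ uv /=.
  move=> eA K E j p sjp g; have [ij ps pj] := sjp.
  have [sE sEE] := pQ _ _ p s ps.
  have [||d dE] := @linear_ex _ (A * E)%type A' (fun x => v x.1 - p x.2).
  - by move=> x y; rewrite !linearD addrACA.
  - by move=> c x; rewrite !linearZ /= -scalerDr.
  (* [Y] is the pullback of [v] and [p], an extension of [A] by [K], so [g] extends to it. *)
  have [Y [m [im mY]]] := ex_sub (submod_ker d).
  have dm y : v (m y).1 = p (m y).2.
    by apply/eqP; rewrite -subr_eq0 -(dE (m y)); apply/eqP/mY; exists y.
  have [||k0 k0E] := @linear_ex _ K (A * E)%type (fun x => (0, j x)).
  - by move=> x y; rewrite linearD; congr pair; rewrite /= addr0.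
  - by move=> c x; rewrite linearZ; congr pair; rewrite /= scaler0.
  have [|k kE] := factor_inj (h := k0) im.
    by move=> x; apply/mY; rewrite dE k0E /= linear0 (sesK _ sjp) subr0.
  have [||q qE] := @linear_ex _ Y A (fun y => (m y).1).
  - by move=> x y; rewrite linearD.
  - by move=> c x; rewrite linearZ.
  have skq : ses k q.
    split=> [x y e|a|y].
    - by apply: ij; move: (congr1 m e); rewrite !kE !k0E => -[].
    - have [e ee] := ps (v a).
      have [y yE] : exists y, m y = (a, e) by apply/mY; rewrite dE /= ee subrr.
      by exists y; rewrite qE yE.
    - rewrite qE; split=> [y0|[x <-]]; last by rewrite kE k0E.
      have [x xE] : exists x, j x = (m y).2 by apply/pj; rewrite -dm y0 linear0.
      by exists x; apply: im; rewrite kE k0E xE -y0; case: (m y).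
  have [h hE] := eA _ _ _ _ skq g.
  (* This map carries the extension back from [Y] to [E]. The term with [sE] compensates for v u
     differing from the identity by s t; it vanishes on [K], so [U] restricts to [k] there. *)
  have [||U0 U0E] := @linear_ex _ E (A * E)%type
    (fun x => (u (p x), x - sE (t (p x)))).
  - by move=> x y; rewrite !linearD addrACA.
  - by move=> c x; rewrite !linearZ /= -scalerDr.
  have [|U UE] := factor_inj (h := U0) im.
    move=> x; apply/mY; rewrite dE U0E /= linearB.
    have /= -> := sEE (t (p x)).
    by rewrite {2}(uv (p x)) addrK subrr.
  exists (h \o U) => x /=; rewrite -hE; congr (h _); apply: im.
  by rewrite UE kE U0E k0E (sesK _ sjp) !linear0 addr0.
move=> [K [P [j [p [sjp pP zK]]]]].
have [K' [P' [j' [p' [s' pP']]]]] := syzygy A'.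
have [uK [vK [w [uP [_ vu]]]]] := syzygy_retract sjp s' pP pP' pQ uv.
by exists K', P', j', p'; split=> //; apply: (IH _ _ _ _ _ _ _ pP' vu zK).
Qed.

(** Schanuel's lemma in retract form: [A] is a retract of itself, so [K] is a retract, modulo
    projectives, of the syzygy hidden in the hypothesis. *)
Lemma extS_syzygy i A B P (K : fgmod R) (j : {linear K -> P}) (p : {linear P -> A}) :
  ses j p -> projective P -> extS_zero i.+1 A B -> extS_zero i K B.
Proof.
move=> sjp pP [K0 [P0 [j0 [p0 [s0 pP0 zK0]]]]].
have idE (x : A) : x = (idfun : {linear A -> A}) ((idfun : {linear A -> A}) x) +
    (\0 : {linear P -> A}) ((\0 : {linear A -> P}) x) by rewrite /= addr0.
have [uK [vK [w [_ [_ E]]]]] := syzygy_retract s0 sjp pP0 pP pP idE.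
exact: extS_retract pP E zK0.
Qed.

(** * Fragments of the long exact sequences of Ext *)

Lemma projective_prod P Q : projective P -> projective Q -> projective (P * Q)%type.
Proof.
move=> pP pQ A B e f es.
have [||i1 i1E] := @linear_ex _ P (P * Q)%type (fun x => (x, 0)).
- by move=> x y; congr pair; rewrite /= addr0.
- by move=> c x; congr pair; rewrite /= scaler0.
have [||i2 i2E] := @linear_ex _ Q (P * Q)%type (fun x => (0, x)).
- by move=> x y; congr pair; rewrite /= addr0.
- by move=> c x; congr pair; rewrite /= scaler0.
have [g gE] := pP _ _ e (f \o i1) es; have [h hE] := pQ _ _ e (f \o i2) es.
have [||s sE] := @linear_ex _ (P * Q)%type A (fun x => g x.1 + h x.2).
- by move=> x y; rewrite !linearD addrACA.
- by move=> c x; rewrite !linearZ scalerDr.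
exists s => -[x y] /=; rewrite sE linearD.
have /= -> := gE x; have /= -> := hE y; rewrite -linearD i1E i2E.
by congr (f _); congr pair; rewrite /= ?addr0 ?add0r.
Qed.

(** For Ext^1, given X -> E, a map is extended first to the preimage [X'] of A' and then to [X]. In
    higher degrees the horseshoe construction makes the syzygies form a short exact sequence. *)
Lemma extS_mid i (A' E A : fgmod R) B (j : {linear A' -> E}) (p : {linear E -> A}) :
  ses j p -> extS_zero i A' B -> extS_zero i A B -> extS_zero i E B.
Proof.
elim: i A' E A j p => [|i IH] A' E A j p sjp.
  move=> /= eA' eA K X k q skq g.
  have [[ij ps pj] [ik qs qk]] := (sjp, skq).
  have [X' [m [im mX']]] := ex_sub (submod_ker (p \o q)).
  have [|k' k'E] := factor_inj (h := k) im.
    by move=> x; apply/mX'; rewrite /= (sesK _ skq) linear0.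
  have [|q' q'E] := factor_inj (h := q \o m) ij.
    by move=> x; apply/pj; rewrite /=; apply/(mX' (m x)); exists x.
  have s1 : ses k' q'.
    split=> [x y e|a|y].
    - by apply: ik; rewrite -!k'E e.
    - have [x xE] := qs (j a).
      have [y yE] : exists y, m y = x by apply/mX'; rewrite /= xE (sesK _ sjp).
      by exists y; apply: ij; rewrite q'E /= yE.
    - split=> [y0|[x <-]]; last by apply: ij; rewrite q'E /= k'E (sesK _ skq) linear0.
      have [x xE] : exists x, k x = m y by apply/qk; rewrite -[q _]q'E y0 linear0.
      by exists x; apply: im; rewrite k'E.
  have s2 : ses m (p \o q).
    split=> // a; have [e <-] := ps a; have [x <-] := qs e; by exists x.
  have [h hE] := eA' _ _ _ _ s1 g; have [h' h'E] := eA _ _ _ _ s2 h.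
  by exists h' => x; rewrite -k'E h'E hE.
move=> zA' zA.
have [K1 [P1 [j1 [p1 [s1 pP1]]]]] := syzygy A'.
have [K2 [P2 [j2 [p2 [s2 pP2]]]]] := syzygy A.
have z1 := extS_syzygy s1 pP1 zA'; have z2 := extS_syzygy s2 pP2 zA.
have [[ij ps pj] [ij1 ps1 pj1]] := (sjp, s1); have [ij2 ps2 pj2] := s2.
have [l lE] := pP2 _ _ p p2 ps.
have [||q qE] := @linear_ex _ (P1 * P2)%type E (fun x => j (p1 x.1) + l x.2).
- by move=> x y; rewrite !linearD addrACA.
- by move=> c x; rewrite !linearZ scalerDr.
have pq x : p (q x) = p2 x.2.
  by rewrite qE linearD (sesK _ sjp) add0r; apply: lE.
have [K [m [im mK]]] := fg_ker q (fg_prod (fgmod_fg P1) (fgmod_fg P2)).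
have qm x : q (m x) = 0 by apply/mK; exists x.
have smq : ses m q.
  split=> // e; have [x xE] := ps2 (p e).
  have [a aE] : exists a, j a = e - l x.
    by apply/pj; rewrite linearB; have /= -> := lE x; rewrite xE subrr.
  by have [y yE] := ps1 a; exists (y, x); rewrite qE /= yE aE subrK.
have [||n0 n0E] := @linear_ex _ K1 (P1 * P2)%type (fun x => (j1 x, 0)).
- by move=> x y; rewrite linearD; congr pair; rewrite /= addr0.
- by move=> c x; rewrite linearZ; congr pair; rewrite /= scaler0.
have [|n nE] := factor_inj (h := n0) im.
  by move=> x; apply/mK; rewrite qE n0E /= (sesK _ s1) !linear0 addr0.
have [||r0 r0E] := @linear_ex _ K P2 (fun x => (m x).2).
- by move=> x y; rewrite linearD.
- by move=> c x; rewrite linearZ.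
have [|r rE] := ses_lift (f := r0) s2.
  by move=> x; rewrite r0E -pq qm linear0.
have snr : ses n r.
  split=> [x y e|x|x].
  - by apply: ij1; move: (congr1 m e); rewrite !nE !n0E => -[].
  - have [a aE] : exists a, j a = - l (j2 x).
      by apply/pj; rewrite linearN; have /= -> := lE (j2 x); rewrite (sesK _ s2) oppr0.
    have [y yE] := ps1 a.
    have [z zE] : exists z, m z = (y, j2 x).
      by apply/mK; rewrite qE /= yE aE addNr.
    by exists z; apply: ij2; rewrite rE r0E zE.
  - split=> [rx0|[y <-]]; last by apply: ij2; rewrite rE r0E nE n0E linear0.
    have m2 : (m x).2 = 0 by rewrite -r0E -rE rx0 linear0.
    have [y yE] : exists y, j1 y = (m x).1.
      apply/pj1/ij; rewrite linear0; have := qm x.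
      by rewrite qE m2 linear0 addr0.
    by exists y; apply: im; rewrite nE n0E yE -m2; case: (m x).
exists K, (P1 * P2)%type, m, q; split=> //; first exact: projective_prod.
exact: IH snr z1 z2.
Qed.

(** The pullback [Y] of [E] and a projective cover [P] over [A] is an extension of [E] by the syzygy
    of [A], which controls its Ext. Projectivity of [P] splits Y -> P, so its kernel A' is a direct
    summand of [Y]. *)
Lemma extS_sub i (A' E A : fgmod R) B (j : {linear A' -> E}) (p : {linear E -> A}) :
  ses j p -> extS_zero i E B -> extS_zero i.+1 A B -> extS_zero i A' B.
Proof.
move=> sjp zE zA; have [ij ps pj] := sjp.
have [L [P [u [q [suq pP]]]]] := syzygy A.
have zL := extS_syzygy suq pP zA; have [iu qs qu] := suq.
have [||d dE] := @linear_ex _ (E * P)%type A (fun x => p x.1 - q x.2).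
- by move=> x y; rewrite !linearD addrACA.
- by move=> c x; rewrite !linearZ /= -scalerDr.
have [Y [m [im mY]]] := fg_ker d (fg_prod (fgmod_fg E) (fgmod_fg P)).
have dm y : p (m y).1 = q (m y).2.
  by apply/eqP; rewrite -subr_eq0 -(dE (m y)); apply/eqP/mY; exists y.
have [||k0 k0E] := @linear_ex _ L (E * P)%type (fun x => (0, u x)).
- by move=> x y; rewrite linearD; congr pair; rewrite /= addr0.
- by move=> c x; rewrite linearZ; congr pair; rewrite /= scaler0.
have [|k kE] := factor_inj (h := k0) im.
  by move=> x; apply/mY; rewrite dE k0E /= linear0 (sesK _ suq) subr0.
have [||r rE] := @linear_ex _ Y E (fun y => (m y).1).
- by move=> x y; rewrite linearD.
- by move=> c x; rewrite linearZ.
have skr : ses k r.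
  split=> [x y e|a|y].
  - by apply: iu; move: (congr1 m e); rewrite !kE !k0E => -[].
  - have [e ee] := qs (p a).
    have [y yE] : exists y, m y = (a, e) by apply/mY; rewrite dE /= ee subrr.
    by exists y; rewrite rE yE.
  - rewrite rE; split=> [y0|[x <-]]; last by rewrite kE k0E.
    have [x xE] : exists x, u x = (m y).2 by apply/qu; rewrite -dm y0 linear0.
    by exists x; apply: im; rewrite kE k0E xE -y0; case: (m y).
have zY : extS_zero i Y B by apply: extS_mid skr zL zE.
have [||r2 r2E] := @linear_ex _ Y P (fun y => (m y).2).
- by move=> x y; rewrite linearD.
- by move=> c x; rewrite linearZ.
have [|sg sgE] := pP _ _ r2 idfun.
  move=> x; have [e ee] := ps (q x).
  have [y yE] : exists y, m y = (e, x) by apply/mY; rewrite dE /= ee subrr.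
  by exists y; rewrite r2E yE.
have [||n0 n0E] := @linear_ex _ A' (E * P)%type (fun x => (j x, 0)).
- by move=> x y; rewrite linearD; congr pair; rewrite /= addr0.
- by move=> c x; rewrite linearZ; congr pair; rewrite /= scaler0.
have [|n nE] := factor_inj (h := n0) im.
  by move=> x; apply/mY; rewrite dE n0E /= linear0 (sesK _ sjp) subr0.
have [|v vE] := ses_lift (f := r \o (idfun \- (sg \o r2)) : {linear Y -> E}) sjp.
  move=> y; rewrite /= rE dm -r2E linearB; have /= -> := sgE (r2 y).
  by rewrite subrr linear0.
apply: (@extS_retract i Y A' B P n v \0 \0) => // x.
rewrite /= addr0; apply: ij.
rewrite vE /= rE linearB nE n0E r2E nE n0E /= !linear0.
by rewrite addr0.
Qed.

(** The kernel of P -> E -> A is at once a syzygy of [A] and an extension of A' by the syzygy of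
    [E]. *)
Lemma extS_quotient i (A' E A : fgmod R) B (j : {linear A' -> E}) (p : {linear E -> A}) :
  ses j p -> extS_zero i A' B -> extS_zero i.+1 E B -> extS_zero i.+1 A B.
Proof.
move=> sjp zA' zE; have [ij ps pj] := sjp.
have [K [P [u [q [suq pP]]]]] := syzygy E.
have zK := extS_syzygy suq pP zE; have [iu qs qu] := suq.
have [L [m [im mL]]] := fg_ker (p \o q) (fgmod_fg P).
have smpq : ses m (p \o q).
  by split=> // a; have [e <-] := ps a; have [x <-] := qs e; exists x.
have [|k kE] := factor_inj (h := u) im.
  by move=> x; apply/mL; rewrite /= (sesK _ suq) linear0.
have [|r rE] := ses_lift (f := q \o m) sjp.
  by move=> x; apply: (sesK _ smpq).
exists L, P, m, (p \o q); split=> //.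
apply: (extS_mid (j := k) (p := r)) zK zA'.
split=> [x y e|a|y].
- by apply: iu; rewrite -!kE e.
- have [x xE] := qs (j a).
  have [y yE] : exists y, m y = x by apply/mL; rewrite /= xE (sesK _ sjp).
  by exists y; apply: ij; rewrite rE /= yE.
- split=> [y0|[x <-]]; last by apply: ij; rewrite rE /= kE (sesK _ suq) linear0.
  have [x xE] : exists x, u x = m y by apply/qu; rewrite -[q _]rE y0 linear0.
  by exists x; apply: im; rewrite kE.
Qed.

(** On the pullback [Y] of [E] and [X] over [A], the map [g] extends because Ext^1(E, B) = 0. Its
    restriction to A' extends to [E]; after subtracting this extension the map descends from [Y] to
    [X]. *)
Lemma ext1_quotient A' E A B (j : {linear A' -> E}) (p : {linear E -> A}) :
  ses j p -> (forall g : {linear A' -> B}, exists h : {linear E -> B}, forall x, h (j x) = g x) ->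
  ext1_zero E B -> ext1_zero A B.
Proof.
move=> sjp ext zE K X k q skq g.
have [[ij ps pj] [ik qs qk]] := (sjp, skq).
have [||d dE] := @linear_ex _ (E * X)%type A (fun x => p x.1 - q x.2).
- by move=> x y; rewrite !linearD addrACA.
- by move=> c x; rewrite !linearZ /= -scalerDr.
have [Y [m [im mY]]] := ex_sub (submod_ker d).
have dm y : p (m y).1 = q (m y).2.
  by apply/eqP; rewrite -subr_eq0 -(dE (m y)); apply/eqP/mY; exists y.
have [||k0 k0E] := @linear_ex _ K (E * X)%type (fun x => (0, k x)).
- by move=> x y; rewrite linearD; congr pair; rewrite /= addr0.
- by move=> c x; rewrite linearZ; congr pair; rewrite /= scaler0.
have [|k1 k1E] := factor_inj (h := k0) im.
  by move=> x; apply/mY; rewrite dE k0E /= linear0 (sesK _ skq) subr0.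
have [||n0 n0E] := @linear_ex _ A' (E * X)%type (fun x => (j x, 0)).
- by move=> x y; rewrite linearD; congr pair; rewrite /= addr0.
- by move=> c x; rewrite linearZ; congr pair; rewrite /= scaler0.
have [|n nE] := factor_inj (h := n0) im.
  by move=> x; apply/mY; rewrite dE n0E /= linear0 (sesK _ sjp) subr0.
have [||r1 r1E] := @linear_ex _ Y E (fun y => (m y).1).
- by move=> x y; rewrite linearD.
- by move=> c x; rewrite linearZ.
have [||r2 r2E] := @linear_ex _ Y X (fun y => (m y).2).
- by move=> x y; rewrite linearD.
- by move=> c x; rewrite linearZ.
have s1 : ses k1 r1.
  split=> [x y e|a|y].
  - by apply: ik; move: (congr1 m e); rewrite !k1E !k0E => -[].
  - have [e ee] := qs (p a).
    have [y yE] : exists y, m y = (a, e) by apply/mY; rewrite dE /= ee subrr.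
    by exists y; rewrite r1E yE.
  - rewrite r1E; split=> [y0|[x <-]]; last by rewrite k1E k0E.
    have [x xE] : exists x, k x = (m y).2 by apply/qk; rewrite -dm y0 linear0.
    by exists x; apply: im; rewrite k1E k0E xE -y0; case: (m y).
have s2 : ses n r2.
  split=> [x y e|a|y].
  - by apply: ij; move: (congr1 m e); rewrite !nE !n0E => -[].
  - have [e ee] := ps (q a).
    have [y yE] : exists y, m y = (e, a) by apply/mY; rewrite dE /= ee subrr.
    by exists y; rewrite r2E yE.
  - rewrite r2E; split=> [y0|[x <-]]; last by rewrite nE n0E.
    have [x xE] : exists x, j x = (m y).1 by apply/pj; rewrite dm y0 linear0.
    by exists x; apply: im; rewrite nE n0E xE -y0; case: (m y).
have [h hE] := zE _ _ _ _ s1 g.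
have [h' h'E] := ext (h \o n).
have [|g' g'E] := ses_desc (f := h \- (h' \o r1) : {linear Y -> B}) s2.
  by move=> x; rewrite /= r1E nE n0E h'E /= subrr.
exists g' => x.
have -> : k x = r2 (k1 x) by rewrite r2E k1E k0E.
by rewrite g'E /= hE r1E k1E k0E linear0 subr0.
Qed.

Lemma ext1_kernel (A : fgmod R) B' E B (j : {linear B' -> E}) (p : {linear E -> B}) :
  ses j p -> (forall g : {linear A -> B}, exists h : {linear A -> E}, forall x, p (h x) = g x) ->
  ext1_zero A E -> ext1_zero A B'.
Proof.
move=> sjp lft zE; have [K [P [u [q [suq pP]]]]] := syzygy A.
apply: (ext1_of_projective suq pP) => g.
have [h hE] := zE _ _ _ _ suq (j \o g).
have [|f fE] := ses_desc (f := p \o h) suq.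
  by move=> x; rewrite /= hE /= (sesK _ sjp).
have [f' f'E] := lft f.
have [|t tE] := ses_lift (f := h \- (f' \o q) : {linear P -> E}) sjp.
  by move=> x; rewrite /= linearB f'E fE /= subrr.
exists t => x; have [ij _ _] := sjp; apply: ij.
by rewrite tE /= hE (sesK _ suq) linear0 subr0.
Qed.

Lemma extS_kernel i (A : fgmod R) B' E B (j : {linear B' -> E}) (p : {linear E -> B}) :
  ses j p -> extS_zero i A B -> extS_zero i.+1 A E -> extS_zero i.+1 A B'.
Proof.
move=> sjp; elim: i A => [|i IH] A zB zE.
all: have [K [P [u [q [suq pP]]]]] := syzygy A.
all: exists K, P, u, q; split=> //.
  apply: (ext1_kernel sjp); last exact: extS_syzygy suq pP zE.
  move=> g; have [h hE] := zB _ _ _ _ suq g.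
  have [h' h'E] : exists h' : {linear P -> E}, p \o h' =1 h by apply: pP; case: sjp.
  by exists (h' \o u) => x; have /= -> := h'E (u x).
by apply: IH; [exact: extS_syzygy suq pP zB|exact: extS_syzygy suq pP zE].
Qed.

Lemma extS_cokernel i (A : fgmod R) B' E B (j : {linear B' -> E}) (p : {linear E -> B}) :
  ses j p -> extS_zero i A E -> extS_zero i.+1 A B' -> extS_zero i A B.
Proof.
move=> sjp; elim: i A => [|i IH] A zE zB'.
all: have [K [P [u [q [suq pP]]]]] := syzygy A.
all: have zKB' := extS_syzygy suq pP zB'.
  apply: (ext1_of_projective suq pP) => g.
  have [g' g'E] := ext1_lift g sjp zKB'.
  have [h hE] := zE _ _ _ _ suq g'.
  by exists (p \o h) => x; rewrite /= hE.
exists K, P, u, q; split=> //; apply: IH => //; exact: extS_syzygy suq pP zE.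
Qed.

(** * Comparison with projective resolutions *)

Lemma resolution_syzygy A (P : projective_resolution A) :
  exists K (u : {linear K -> pr_term P 0}) (a : {linear pr_term P 1 -> K}),
    [/\ ses u (pr_aug P), forall x, u (a x) = pr_diff P 0 x, surjective a
      & forall x, a x = 0 <-> exists y, pr_diff P 1 y = x].
Proof.
have [K [u [iu uK]]] := ex_sub (submod_ker (pr_aug P)).
have sua : ses u (pr_aug P) by split=> //; exact: pr_aug_surj.
have [|a aE] := ses_lift (f := pr_diff P 0) sua.
  by move=> x; apply/(pr_exact0 (p := P)); exists x.
exists K, u, a; split=> // [y|x].
  have [x xE] := proj1 (pr_exact0 (p := P) (u y)) (sesK _ sua).
  by exists x; apply: iu; rewrite aE.
rewrite -(pr_exact (p := P)) -aE; split=> [->|e]; first by rewrite linear0.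
by apply: iu; rewrite linear0.
Qed.

Lemma cohomology_extS i A B (P : projective_resolution A) :
  cohomology_zero B P i.+1 -> extS_zero i A B.
Proof.
elim: i A P => [|i IH] A P H.
  have [K [u [a [sua aE as_ a0]]]] := resolution_syzygy P.
  apply: (ext1_of_projective sua (@pr_proj _ _ P 0)) => g.
  have [|psi psiE] := H (g \o a).
    move=> x /=; have -> : a (pr_diff P 1 x) = 0 by apply/a0; exists x.
    by rewrite linear0.
  exists psi => x; have [y <-] := as_ x.
  by rewrite aE; have /= <- := psiE y.
have [K [u [a [sua aE as_ a0]]]] := resolution_syzygy P.
exists K, (pr_term P 0), u, (pr_aug P); split=> //; first exact: (@pr_proj _ _ P 0).
pose Q : projective_resolution K := @Build_projective_resolution R K
  (fun j => pr_term P j.+1) (fun j => pr_diff P j.+1) a (fun j => @pr_proj _ _ P j.+1)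
  as_ a0 (fun j => @pr_exact _ _ P j.+1).
exact: (IH K Q H).
Qed.

(** [Ext_zero] asks for some resolution only, so one spliced from chosen syzygies is enough. A
    cocycle factors through the next syzygy, and extends from there because Ext^1 of the preceding
    one vanishes. *)
Lemma free_resolution (A : fgmod R) : exists P : projective_resolution A,
  forall i B, extS_zero i A B -> cohomology_zero B P i.+1.
Proof.
pose Om (X : fgmod R) := projT1 (cid (syzygy X)).
pose Om_ (X : fgmod R) := projT2 (cid (syzygy X)).
pose Cv (X : fgmod R) := projT1 (cid (Om_ X)); pose Cv_ (X : fgmod R) := projT2 (cid (Om_ X)).
pose io (X : fgmod R) := projT1 (cid (Cv_ X)); pose io_ (X : fgmod R) := projT2 (cid (Cv_ X)).
pose pr (X : fgmod R) := projT1 (cid (io_ X)).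
have [sX pX] : (forall X : fgmod R, ses (io X) (pr X)) /\ forall X : fgmod R, projective (Cv X).
  by split=> X; [exact: proj1 (projT2 (cid (io_ X)))|exact: proj2 (projT2 (cid (io_ X)))].
pose Z i := iter i Om A.
have ex i x : pr (Z i.+1) x = 0 <-> exists y, io (Z i.+1) y = x.
  by have [_ _ h] := sX (Z i.+1); apply: h.
have io0 (X : fgmod R) y : io X y = 0 -> y = 0.
  by have [h _ _] := sX X => e; apply: h; rewrite linear0.
pose d i : {linear Cv (Z i.+1) -> Cv (Z i)} := io (Z i) \o pr (Z i.+1).
have dE i x : d i x = 0 <-> exists y, d i.+1 y = x.
  split=> [/io0 /ex [y <-]|[y <-]].
    have [_ s _] := sX (Z i.+2); have [z <-] := s y; by exists z.
  by rewrite /d /= (sesK _ (sX _)) linear0.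
have d0 x : pr A x = 0 <-> exists y, d 0%N y = x.
  have [_ _ h] := sX A; rewrite h; split=> -[y <-]; last by exists (pr (Z 1%N) y).
  by have [_ s _] := sX (Z 1%N); have [z <-] := s y; exists z.
have ps : surjective (pr A) by have [] := sX A.
pose P : projective_resolution A := @Build_projective_resolution R A
  (fun i => Cv (Z i)) d (pr A) (fun i => pX _) ps d0 dE.
exists P => i B zA phi phid.
have zi j k : extS_zero (j + k) A B -> extS_zero j (Z k) B.
  elim: k j => [|k IH] j; first by rewrite addn0.
  by rewrite addnS -addSn => /IH; apply: extS_syzygy (sX _) (pX _).
have ei : ext1_zero (Z i) B by apply: (zi 0%N).
have [|psi psiE] := ses_desc (f := phi : {linear Cv (Z i.+1) -> B}) (sX (Z i.+1)).
  move=> y; have [_ s _] := sX (Z i.+2); have [z <-] := s y; exact: phid.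
have [h hE] := ei _ _ _ _ (sX (Z i)) psi.
by exists h => x /=; rewrite hE psiE.
Qed.

Lemma Ext_zeroS i (A : fgmod R) B : Ext_zero i.+1 A B <-> extS_zero i A B.
Proof.
split=> [[P]|zA]; first exact: cohomology_extS.
by have [P h] := free_resolution A; exists P; apply: h.
Qed.

Lemma extS_injective i (A : fgmod R) I : injective_mod I -> extS_zero i A I.
Proof.
move=> inI; elim: i A => [|i IH] A; last first.
  by have [K [P [u [p [sup pP]]]]] := syzygy A; exists K, P, u, p; split.
by move=> K E j p [ij _ _] g; have [h hE] := inI _ _ j g ij; exists h.
Qed.

Lemma extS_projective i P B : projective P -> extS_zero i P B.
Proof.
have p0 : projective 'rV[R]_0 by apply: projective_free.
elim: i P => [|i IH] P pP.
  move=> K E j p sjp g; have [ij ps pj] := sjp.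
  have [s sE] := pP _ _ p idfun ps.
  have [|r rE] := ses_lift (f := idfun \- (s \o p) : {linear E -> E}) sjp.
    by move=> x; rewrite /= linearB; have /= -> := sE (p x); rewrite subrr.
  exists (g \o r) => x /=; congr (g _); apply: ij.
  by rewrite rE /= (sesK _ sjp) linear0 subr0.
exists 'rV[R]_0, P, \0, idfun; split=> //; last exact: IH.
split=> [x y _|x|x]; first by apply/rowP => -[].
  by exists x.
by split=> [x0|[y <-]] //; exists 0; rewrite linear0 -x0.
Qed.

End Ext.

(** * Equivalences of preadditive categories *)

Section FunctorZero.
Variables (C D : precat) (F : functor C D).

Lemma fhom0 X Y : fhom F (hzero : mor X Y) ≡ hzero.
Proof. by apply: (@haddI _ _ _ (fhom F hzero)); rewrite -fhom_add haddm0 haddm0. Qed.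

End FunctorZero.

Lemma hopp0 (C : precat) (X Y : C) : hopp (hzero : mor X Y) ≡ hzero.
Proof. by apply: hopp_uniq; rewrite hadd0m. Qed.

Lemma heq_sub0 (C : precat) (X Y : C) (f g : mor X Y) :
  hadd f (hopp g) ≡ hzero <-> f ≡ g.
Proof.
split=> [e|->]; last exact: haddmN.
by rewrite -(hopp_uniq e) hoppK.
Qed.

Section FullFaithful.
Variables C D : precat.

Definition full (F : functor C D) : Prop :=
  forall X Y (g : mor (F X) (F Y)), exists f, fhom F f ≡ g.
Definition faithful (F : functor C D) : Prop :=
  forall X Y (f g : mor X Y), fhom F f ≡ fhom F g -> f ≡ g.
Definition dense (F : functor C D) : Prop :=
  forall Y, exists X, isomorphic (F X) Y.
Definition weak_equivalence (F : functor C D) : Prop :=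
  [/\ full F, faithful F & dense F].

Lemma weak_equivalence_equivalent (F : functor C D) :
  weak_equivalence F -> equivalent C D.
Proof.
move=> [fu fa de].
pose G Y := projT1 (cid (de Y)).
have iso Y : {e : mor (F (G Y)) Y & {e' : mor Y (F (G Y)) |
    e' ∘ e ≡ idm _ /\ e ∘ e' ≡ idm _}}.
  have [e He] := cid (projT2 (cid (de Y))); have [e' He'] := cid He.
  by exists e, e'.
pose e Y := projT1 (iso Y); pose e' Y := proj1_sig (projT2 (iso Y)).
have e'e Y : e' Y ∘ e Y ≡ idm _ by have [] := proj2_sig (projT2 (iso Y)).
have ee' Y : e Y ∘ e' Y ≡ idm _ by have [] := proj2_sig (projT2 (iso Y)).
pose gh Y Z (f : mor Y Z) := projT1 (cid (fu _ _ (e' Z ∘ (f ∘ e Y)))).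
have ghE Y Z (f : mor Y Z) : fhom F (gh _ _ f) ≡ e' Z ∘ (f ∘ e Y).
  by rewrite /gh; case: cid.
have ghK Y Z (f : mor Y Z) : e Z ∘ fhom F (gh _ _ f) ≡ f ∘ e Y.
  by rewrite ghE compA ee' comp1m.
have eI Y X (a b : mor X (F (G Y))) : e Y ∘ a ≡ e Y ∘ b -> a ≡ b.
  move=> h; have : e' Y ∘ (e Y ∘ a) ≡ e' Y ∘ (e Y ∘ b) by rewrite h.
  by rewrite !compA e'e !comp1m.
have g1 Y Z (f g : mor Y Z) : f ≡ g -> gh _ _ f ≡ gh _ _ g.
  by move=> h; apply: fa; apply: eI; rewrite !ghK h.
have g2 Y : gh _ _ (idm Y) ≡ idm (G Y).
  by apply: fa; apply: (eI Y); rewrite ghK fhom_id comp1m compm1.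
have g3 X Y Z (g : mor Y Z) (f : mor X Y) : gh _ _ (g ∘ f) ≡ gh _ _ g ∘ gh _ _ f.
  by apply: fa; apply: (eI Z); rewrite ghK fhom_comp compA ghK -!compA ghK.
have g4 Y Z (f g : mor Y Z) : gh _ _ (hadd f g) ≡ hadd (gh _ _ f) (gh _ _ g).
  by apply: fa; apply: (eI Z); rewrite ghK fhom_add compDr !ghK compDl.
pose GF := @Functor D C G gh g1 g2 g3 g4.
pose a X := projT1 (cid (fu (G (F X)) X (e (F X)))).
have aE X : fhom F (a X) ≡ e (F X) by rewrite /a; case: cid.
pose b X := projT1 (cid (fu X (G (F X)) (e' (F X)))).
have bE X : fhom F (b X) ≡ e' (F X) by rewrite /b; case: cid.
have e'K Y Z (f : mor Y Z) : fhom F (gh _ _ f) ∘ e' Y ≡ e' Z ∘ f.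
  by rewrite ghE -!compA ee' compm1.
exists F, GF; split.
- unshelve eexists; last unshelve eexists.
  + exists a => X Y f /=; apply: fa; rewrite !fhom_comp !aE.
    by rewrite ghK.
  + exists b => X Y f /=; apply: fa; rewrite !fhom_comp !bE.
    by rewrite e'K.
  + by split=> X /=; apply: fa; rewrite fhom_comp aE bE fhom_id.
- unshelve eexists; last unshelve eexists.
  + by exists e => X Y f /=; rewrite ghK.
  + by exists e' => X Y f /=; rewrite e'K.
  + by split=> X /=.
Qed.

End FullFaithful.

Lemma equivalent_sym (C D : precat) : equivalent C D -> equivalent D C.
Proof. by move=> [F [G [h1 h2]]]; exists G, F. Qed.

Lemma equivalent_weak (C D : precat) : equivalent C D ->
  exists F : functor C D, weak_equivalence F.
Proof.
have faith C' D' (F : functor C' D') (G : functor D' C') :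
    isomorphic (comp_functor G F : functor_cat C' C') (id_functor C') -> faithful F.
  move=> [a [b [_ ab]]] X Y f g e.
  have H (h : mor X Y) : h ≡ a Y ∘ fhom G (fhom F h) ∘ b X.
    have /= <- := ncomp_nat a h.
    by have /= E := ab X; rewrite -compA E compm1.
  by rewrite (H f) (H g) e.
move=> [F [G [i1 i2]]]; exists F; split; last first.
- move=> Y; exists (G Y); case: i2 => a [b [ba ab]]; exists (a Y), (b Y).
  by split; [exact: (ba Y)|exact: (ab Y)].
- exact: faith i1.
move=> X Y g; case: (i1) => a [b [ba ab]].
(* The preimage of [g] is G g conjugated by the isomorphism of G F with the identity. That F sends
   it to [g] is tested after applying G, which is faithful by the other isomorphism. *)
exists (a Y ∘ fhom G g ∘ b X); apply: (faith _ _ _ _ i2).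
set f := _ ∘ b X.
have E : f ∘ a X ≡ a Y ∘ fhom G (fhom F f) by exact: (ncomp_nat a f).
have baE Z : b Z ∘ a Z ≡ idm _ by exact: (ba Z).
have {E} : b Y ∘ (f ∘ a X) ≡ b Y ∘ (a Y ∘ fhom G (fhom F f)) by rewrite E.
rewrite (compA _ (a Y)) baE comp1m => <-.
by rewrite /f -!compA baE compm1 compA baE comp1m.
Qed.

Lemma weak_equivalence_comp (C D E : precat) (F : functor C D) (G : functor D E) :
  weak_equivalence F -> weak_equivalence G -> weak_equivalence (comp_functor G F).
Proof.
move=> [fuF faF deF] [fuG faG deG]; split.
- move=> X Y h; have [g gE] := fuG _ _ h; have [f fE] := fuF _ _ g.
  by exists f; rewrite /= fE.
- by move=> X Y f g /= /faG /faF.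
- move=> Z; have [Y [a [b [ba ab]]]] := deG Z; have [X [c [d [dc cd]]]] := deF Y.
  have E1 : fhom G d ∘ fhom G c ≡ idm _ by rewrite -fhom_comp dc fhom_id.
  have E2 : fhom G c ∘ fhom G d ≡ idm _ by rewrite -fhom_comp cd fhom_id.
  exists X, (a ∘ fhom G c), (fhom G d ∘ b); split.
    by rewrite -compA (compA b) ba comp1m E1.
  by rewrite -compA (compA (fhom G c)) E2 comp1m ab.
Qed.

Lemma equivalent_trans (C D E : precat) :
  equivalent C D -> equivalent D E -> equivalent C E.
Proof.
move=> /equivalent_weak [F wF] /equivalent_weak [G wG].
exact: weak_equivalence_equivalent (weak_equivalence_comp wF wG).
Qed.

Definition op_functor (C D : precat) (F : functor C D) : functor (op C) (op D).
Proof.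
exists (fun X : op C => F X : op D) (fun X Y f => fhom F (f : @mor C Y X)).
- by move=> X Y f g; apply: (@fhom_heq C D F).
- by move=> X; apply: (@fhom_id C D F).
- by move=> X Y Z g f; apply: (@fhom_comp C D F).
- by move=> X Y f g; apply: (@fhom_add C D F).
Defined.

Lemma isomorphic_op (C : precat) (X Y : C) :
  isomorphic X Y -> @isomorphic (op C) X Y.
Proof. by move=> [f [g [gf fg]]]; exists g, f. Qed.

Lemma weak_equivalence_op (C D : precat) (F : functor C D) :
  weak_equivalence F -> weak_equivalence (op_functor F).
Proof.
move=> [fu fa de]; split.
- by move=> X Y g; apply: (fu Y X).
- by move=> X Y f g; apply: (fa Y X).
- by move=> Y; have [X h] := de Y; exists X; apply: isomorphic_op.
Qed.

Lemma equivalent_op (C D : precat) : equivalent C D -> equivalent (op C) (op D).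
Proof.
move=> /equivalent_weak [F wF].
exact: weak_equivalence_equivalent (weak_equivalence_op wF).
Qed.

Lemma equivalent_opK (C : precat) : equivalent (op (op C)) C.
Proof.
pose F : functor (op (op C)) C := @Functor (op (op C)) C id (fun X Y f => f)
  (fun _ _ _ _ e => e) (fun _ => ltac:(reflexivity))
  (fun _ _ _ _ _ => ltac:(reflexivity)) (fun _ _ _ _ => ltac:(reflexivity)).
apply: (@weak_equivalence_equivalent _ _ F); split.
- by move=> X Y g; exists g.
- by [].
- by move=> Y; exists Y, (idm Y), (idm Y); rewrite comp1m.
Qed.

(* An equivalence given by a correspondence rather than by a functor: O relates objects,
   R relates morphisms between related objects, and R is bijective up to [≡]. *)
Lemma correspondence (C D : precat) (O : C -> D -> Type)
    (R : forall X x (o : O X x) Y y (o' : O Y y), mor X Y -> mor x y -> Prop) :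
  (forall X, exists x, inhabited (O X x)) ->
  (forall x, exists X, inhabited (O X x)) ->
  (forall X x (o : O X x) Y y (o' : O Y y) f, exists g, R _ _ o _ _ o' f g) ->
  (forall X x (o : O X x) Y y (o' : O Y y) g, exists f, R _ _ o _ _ o' f g) ->
  (forall X x (o : O X x), R _ _ o _ _ o (idm X) (idm x)) ->
  (forall X x (o : O X x) Y y (o' : O Y y) Z z (o'' : O Z z) f g f' g',
    R _ _ o _ _ o' f g -> R _ _ o' _ _ o'' f' g' ->
    R _ _ o _ _ o'' (f' ∘ f) (g' ∘ g)) ->
  (forall X x (o : O X x) Y y (o' : O Y y) f g f' g',
    R _ _ o _ _ o' f g -> R _ _ o _ _ o' f' g' ->
    R _ _ o _ _ o' (hadd f f') (hadd g g')) ->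
  (forall X x (o : O X x) Y y (o' : O Y y) f g,
    R _ _ o _ _ o' f g -> R _ _ o _ _ o' (hopp f) (hopp g)) ->
  (forall X x (o : O X x) Y y (o' : O Y y) f g,
    R _ _ o _ _ o' f g -> (f ≡ hzero <-> g ≡ hzero)) ->
  equivalent C D.
Proof.
move=> Ol Or Rl Rr Rid Rcomp Radd Ropp R0.
have RU X x (o : O X x) Y y (o' : O Y y) f g f' g' :
    R _ _ o _ _ o' f g -> R _ _ o _ _ o' f' g' -> (f ≡ f' <-> g ≡ g').
  move=> Rfg /Ropp Rfg'; have := R0 _ _ _ _ _ _ _ _ (Radd _ _ _ _ _ _ _ _ _ _ Rfg Rfg').
  by rewrite !heq_sub0.
have OL X : {x & O X x}.
  by have [x /inhabited_witness o] := cid (Ol X); exists x.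
pose h X Y (f : mor X Y) := projT1 (cid (Rl _ _ (projT2 (OL X)) _ _ (projT2 (OL Y)) f)).
have hR X Y (f : mor X Y) : R _ _ (projT2 (OL X)) _ _ (projT2 (OL Y)) f (h _ _ f).
  by rewrite /h; case: cid.
have h1 X Y (f g : mor X Y) : f ≡ g -> h _ _ f ≡ h _ _ g.
  by move=> e; apply/(RU _ _ _ _ _ _ _ _ _ _ (hR _ _ f) (hR _ _ g)).
have h2 X : h _ _ (idm X) ≡ idm (projT1 (OL X)).
  by apply/(RU _ _ _ _ _ _ _ _ _ _ (hR _ _ (idm X)) (Rid _ _ _)).
have h3 X Y Z (g : mor Y Z) (f : mor X Y) : h _ _ (g ∘ f) ≡ h _ _ g ∘ h _ _ f.
  by apply/(RU _ _ _ _ _ _ _ _ _ _ (hR _ _ (g ∘ f))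
    (Rcomp _ _ _ _ _ _ _ _ _ _ _ _ _ (hR _ _ f) (hR _ _ g))).
have h4 X Y (f g : mor X Y) : h _ _ (hadd f g) ≡ hadd (h _ _ f) (h _ _ g).
  by apply/(RU _ _ _ _ _ _ _ _ _ _ (hR _ _ (hadd f g))
    (Radd _ _ _ _ _ _ _ _ _ _ (hR _ _ f) (hR _ _ g))).
pose F := @Functor C D (fun X => projT1 (OL X)) h h1 h2 h3 h4.
apply: (@weak_equivalence_equivalent _ _ F); split.
- move=> X Y g; have [f Rfg] := Rr _ _ (projT2 (OL X)) _ _ (projT2 (OL Y)) g.
  by exists f; apply/(RU _ _ _ _ _ _ _ _ _ _ (hR _ _ f) Rfg).
- by move=> X Y f g /(RU _ _ _ _ _ _ _ _ _ _ (hR _ _ f) (hR _ _ g)).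
- move=> y; have [Y [o]] := Or y; exists Y.
  have o' := projT2 (OL Y).
  have [a Ra] := Rl _ _ (projT2 (OL Y)) _ _ o (idm Y).
  have [b Rb] := Rl _ _ o _ _ (projT2 (OL Y)) (idm Y).
  exists a, b; split.
    by apply/(RU _ _ _ _ _ _ _ _ _ _ (Rcomp _ _ _ _ _ _ _ _ _ _ _ _ _ Ra Rb)
      (Rid _ _ _)); rewrite comp1m.
  by apply/(RU _ _ _ _ _ _ _ _ _ _ (Rcomp _ _ _ _ _ _ _ _ _ _ _ _ _ Rb Ra)
    (Rid _ _ _)); rewrite comp1m.
Qed.

(** * Transport of abelian structure *)

Lemma zero_object_op (C : precat) (Z : C) : zero_object Z -> @zero_object (op C) Z.
Proof. by move=> h X; have [h1 h2] := h X; split=> f; [apply: h2|apply: h1]. Qed.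

Lemma direct_sum_op (C : precat) (X Y S : C) :
  direct_sum X Y S -> @direct_sum (op C) X Y S.
Proof.
move=> [i1 [i2 [p1 [p2 [e1 e2 e3 e4 e5]]]]].
by exists p1, p2, i1, i2; split.
Qed.

Lemma additive_op (C : precat) : additive_cat C -> additive_cat (op C).
Proof.
move=> [[Z hZ] hS]; split; first by exists Z; apply: zero_object_op.
by move=> X Y; have [S h] := hS X Y; exists S; apply: direct_sum_op.
Qed.

Lemma abelian_op (C : precat) : abelian_cat C -> abelian_cat (op C).
Proof.
move=> [hA hk hc hm he]; split; first exact: additive_op.
- by move=> X Y f; exact: (hc Y X f).
- by move=> X Y f; exact: (hk Y X f).
- by move=> X Y f; exact: (he Y X f).
- by move=> X Y f; exact: (hm Y X f).
Qed.

Section Transport.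
Variables (C D : precat) (G : functor D C).
Hypothesis wG : weak_equivalence G.

Lemma weak_full X Y (g : mor (G X) (G Y)) : exists f, fhom G f ≡ g.
Proof. by case: wG => h _ _; apply: h. Qed.

Lemma weak_faithful X Y (f g : mor X Y) : fhom G f ≡ fhom G g -> f ≡ g.
Proof. by case: wG => _ h _; apply: h. Qed.

Lemma kernel_reflect X Y (f : mor X Y) K (k : mor K X) :
  is_kernel (fhom G f) (fhom G k) -> is_kernel f k.
Proof.
move=> [fk0 U]; split.
  by apply: weak_faithful; rewrite fhom_comp fk0 fhom0.
move=> W g fg0; have [|h [hE hU]] := U (G W) (fhom G g).
  by rewrite -fhom_comp fg0 fhom0.
have [h' h'E] := weak_full h; exists h'; split.
  by apply: weak_faithful; rewrite fhom_comp h'E.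
move=> h'' e; apply: weak_faithful; rewrite h'E; apply: hU.
by rewrite -fhom_comp e.
Qed.

Lemma kernel_iso (X Y : C) (f f' : mor X Y) K K' (k : mor K X) (k' : mor K' X)
    (a : mor K' K) (b : mor K K') : a ∘ b ≡ idm K -> b ∘ a ≡ idm K' ->
  k' ≡ k ∘ a -> f ≡ f' -> is_kernel f k -> is_kernel f' k'.
Proof.
move=> ab ba k'E ff' [fk U]; split.
  by rewrite -ff' k'E compA fk comp0m.
move=> W g; rewrite -ff' => /U [h [hE hU]]; exists (b ∘ h); split.
  by rewrite k'E -compA (compA a) ab comp1m.
move=> h'' e; rewrite -(hU (a ∘ h'')).
  by rewrite compA ba comp1m.
by rewrite compA -k'E.
Qed.

Lemma kernels_transport :
  (forall (X Y : C) (f : mor X Y), exists K (k : mor K X), is_kernel f k) ->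
  forall (X Y : D) (f : mor X Y), exists K (k : mor K X), is_kernel f k.
Proof.
move=> hk X Y f; have [K [k kk]] := hk _ _ (fhom G f).
have [_ _ de] := wG; have [K' [a [b [ba ab]]]] := de K.
have [k' k'E] := weak_full (k ∘ a).
exists K', k'; apply: kernel_reflect.
exact: (kernel_iso ab ba k'E _ kk).
Qed.

Lemma monos_transport :
  (forall (X Y : C) (f : mor X Y), mono f -> exists Z (g : mor Y Z), is_kernel g f) ->
  forall (X Y : D) (f : mor X Y), mono f -> exists Z (g : mor Y Z), is_kernel g f.
Proof.
move=> hm X Y f mf; have [_ _ de] := wG.
have [|Z [g gk]] := hm _ _ (fhom G f).
  move=> W g h e; have [W' [a [b [ba ab]]]] := de W.
  have [g' g'E] := weak_full (g ∘ a); have [h' h'E] := weak_full (h ∘ a).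
  have E : g' ≡ h'.
    by apply/mf/weak_faithful; rewrite !fhom_comp g'E h'E !compA e.
  have {E} : fhom G g' ∘ b ≡ fhom G h' ∘ b by rewrite E.
  by rewrite g'E h'E -!compA ab !compm1.
have [Z' [a [b [ba ab]]]] := de Z.
have [g' g'E] := weak_full (b ∘ g); exists Z', g'; apply: kernel_reflect.
case: gk => gf U; split.
  by rewrite g'E -compA gf compm0.
move=> W h; rewrite g'E => e; apply: U.
have {e} : a ∘ (b ∘ g ∘ h) ≡ a ∘ hzero by rewrite e.
by rewrite !compA ab comp1m compm0.
Qed.

Lemma additive_transport : additive_cat C -> additive_cat D.
Proof.
move=> [[Z hZ] hS]; have [_ _ de] := wG; split.
  have [Z' [a [b [ba ab]]]] := de Z; exists Z' => X.
  have [h1 h2] := hZ (G X).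
  split=> f; apply: weak_faithful; rewrite fhom0.
    by rewrite -(comp1m (fhom G f)) -ba -compA (h1 (a ∘ _)) compm0.
  by rewrite -(compm1 (fhom G f)) -ba compA (h2 (_ ∘ b)) comp0m.
move=> X Y; have [S [i1 [i2 [p1 [p2 [e1 e2 e3 e4 e5]]]]]] := hS (G X) (G Y).
have [S' [a [b [ba ab]]]] := de S.
have [j1 j1E] := weak_full (b ∘ i1); have [j2 j2E] := weak_full (b ∘ i2).
have [q1 q1E] := weak_full (p1 ∘ a); have [q2 q2E] := weak_full (p2 ∘ a).
have abE (V W : C) (p : mor S W) (i : mor V S) : p ∘ a ∘ (b ∘ i) ≡ p ∘ i.
  by rewrite -compA (compA a) ab comp1m.
exists S', j1, j2, q1, q2; split; apply: weak_faithful;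
  rewrite ?fhom_add !fhom_comp ?fhom_id ?fhom0 ?j1E ?j2E ?q1E ?q2E ?abE //.
have E V (i : mor V S) (p : mor S V) : b ∘ i ∘ (p ∘ a) ≡ b ∘ (i ∘ p) ∘ a.
  by rewrite !compA.
by rewrite !E -compDl -compDr e5 compm1 ba.
Qed.

End Transport.

Lemma abelian_equivalence (C D : precat) : equivalent C D -> abelian_cat C -> abelian_cat D.
Proof.
move=> /equivalent_sym /equivalent_weak [G wG] aC.
have wG' := weak_equivalence_op wG.
have [hA hk hc hm he] := aC; have [_ hk' _ hm' _] := abelian_op aC; split.
- exact: additive_transport wG hA.
- exact: kernels_transport wG hk.
- by move=> X Y f; apply: (kernels_transport wG' hk').
- exact: monos_transport wG hm.
- by move=> X Y f; apply: (monos_transport wG' hm').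
Qed.

(** * Functors with a presentation *)

Lemma additive_ex (A B : zmodType) (f : A -> B) :
  (forall x y, f (x + y) = f x + f y) -> exists g : {additive A -> B}, g =1 f.
Proof.
move=> fD.
have f0 : f 0 = 0 by apply: (addrI (f 0)); rewrite -fD !addr0.
pose m := GRing.isNmodMorphism.Build A B f (conj f0 fD).
by exists (HB.pack f m : {additive A -> B}).
Qed.

Section FunctorAction.
Variable C : precat.
Implicit Types F G H : functor C Ab.

Definition act F W V (u : mor W V) : {additive F W -> F V} := fhom F u.
Definition app F G (eta : nat_trans F G) W : {additive F W -> G W} := eta W.

Lemma act_heq F W V (u v : mor W V) x : u ≡ v -> act F u x = act F v x.
Proof. by move=> e; apply: (fhom_heq F e). Qed.

Lemma act_id F W x : act F (idm W) x = x.
Proof. exact: (fhom_id F W x). Qed.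

Lemma act_comp F W V U (u : mor W V) (v : mor V U) x :
  act F (v ∘ u) x = act F v (act F u x).
Proof. exact: (fhom_comp F v u x). Qed.

Lemma act_add F W V (u v : mor W V) x : act F (hadd u v) x = act F u x + act F v x.
Proof. exact: (fhom_add F u v x). Qed.

Lemma app_nat F G (eta : nat_trans F G) W V (u : mor W V) x :
  act G u (app eta W x) = app eta V (act F u x).
Proof. exact: (ncomp_nat eta u x). Qed.

(** The values of F are tied to [Z] by inverse bijections rather than by equality, so that no
    transport along equal types arises in later use. *)
Lemma functor_ex (Z : C -> zmodType) (a : forall W V, mor W V -> Z W -> Z V) :
  (forall W V (u : mor W V) x y, a _ _ u (x + y) = a _ _ u x + a _ _ u y) ->
  (forall W V (u v : mor W V), u ≡ v -> a _ _ u =1 a _ _ v) ->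
  (forall W, a _ _ (idm W) =1 id) ->
  (forall W V U (v : mor V U) (u : mor W V) x, a _ _ (v ∘ u) x = a _ _ v (a _ _ u x)) ->
  (forall W V (u v : mor W V) x, a _ _ (hadd u v) x = a _ _ u x + a _ _ v x) ->
  {F : functor C Ab & {f : forall W, Z W -> F W & {g : forall W, F W -> Z W |
    [/\ forall W, cancel (f W) (g W), forall W, cancel (g W) (f W),
      forall W x y, f W (x + y) = f W x + f W y
    & forall W V (u : mor W V) x, act F u (f W x) = f V (a _ _ u x)]}}}.
Proof.
move=> aD ae a1 aM aA.
pose h W V (u : mor W V) := projT1 (cid (additive_ex (aD _ _ u))).
have hE W V (u : mor W V) : h _ _ u =1 a _ _ u by rewrite /h; case: cid.
pose F : functor C Ab := @Functor C Ab Z h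
  (fun W V u v e x => etrans (hE _ _ u x) (etrans (ae _ _ u v e x) (esym (hE _ _ v x))))
  (fun W x => etrans (hE _ _ (idm W) x) (a1 W x))
  (fun W V U v u x => etrans (hE _ _ _ x) (etrans (aM _ _ _ v u x)
     (etrans (congr1 _ (esym (hE _ _ u x))) (esym (hE _ _ v _)))))
  (fun W V u v x => etrans (hE _ _ _ x) (etrans (aA _ _ u v x)
     (congr2 +%R (esym (hE _ _ u x)) (esym (hE _ _ v x))))).
by exists F, (fun W => id), (fun W => id); split=> // W V u x; apply: hE.
Qed.

Lemma nat_ex F G (e : forall W, F W -> G W) :
  (forall W (x y : F W), e W (x + y) = e W x + e W y) ->
  (forall W V (u : mor W V) x, act G u (e W x) = e V (act F u x)) ->
  exists eta : nat_trans F G, forall W, app eta W =1 e W.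
Proof.
move=> eD en.
pose h W := projT1 (cid (additive_ex (eD W))).
have hE W : h W =1 e W by rewrite /h; case: cid.
have hn X Y (f : mor X Y) :
    fhom G f ∘ (h X : mor (F X) (G X)) ≡ (h Y : mor (F Y) (G Y)) ∘ fhom F f.
  move=> x; have /= := en X Y f x; rewrite -(hE X) /act => ->.
  by rewrite -(hE Y).
by exists (NatTrans hn).
Qed.

Definition presents F X Y (f : mor X Y) (pi : forall W, mor X W -> F W) : Prop :=
  [/\ forall W (g h : mor X W), g ≡ h -> pi W g = pi W h,
      forall W (g h : mor X W), pi W (hadd g h) = pi W g + pi W h,
      forall W V (u : mor W V) (g : mor X W), pi V (u ∘ g) = act F u (pi W g),
      forall W x, exists g, pi W g = x
    & forall W (g : mor X W), pi W g = 0 <-> exists h : mor Y W, g ≡ h ∘ f].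

Section Presents.
Variables (F : functor C Ab) (X Y : C) (f : mor X Y) (pi : forall W, mor X W -> F W).
Hypothesis Ff : presents f pi.

Lemma pi_heq W (g h : mor X W) : g ≡ h -> pi g = pi h.
Proof. by case: Ff => h1 _ _ _ _; apply: h1. Qed.

Lemma pi_add W (g h : mor X W) : pi (hadd g h) = pi g + pi h.
Proof. by case: Ff. Qed.

Lemma pi_act W V (u : mor W V) (g : mor X W) : pi (u ∘ g) = act F u (pi g).
Proof. by case: Ff. Qed.

Lemma pi_surj W x : exists g : mor X W, pi g = x.
Proof. by case: Ff. Qed.

Lemma pi_eq0 W (g : mor X W) : pi g = 0 <-> exists h : mor Y W, g ≡ h ∘ f.
Proof. by case: Ff. Qed.

Lemma pi_id W (g : mor X W) : pi g = act F g (pi (idm X)).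
Proof. by rewrite -pi_act; apply: pi_heq; rewrite compm1. Qed.

Lemma pi_opp W (g : mor X W) : pi (hopp g) = - pi g.
Proof.
apply: (addIr (pi g)); rewrite -pi_add addNr; apply/pi_eq0.
by exists hzero; rewrite haddNm comp0m.
Qed.

Lemma pi_eq W (g h : mor X W) : pi g = pi h <-> exists u, g ≡ hadd (u ∘ f) h.
Proof.
split=> [e|[u uE]].
  have /pi_eq0 [u uE] : pi (hadd g (hopp h)) = 0 by rewrite pi_add pi_opp e subrr.
  by exists u; rewrite -uE -haddA haddNm haddm0.
rewrite (pi_heq uE) pi_add.
have -> : pi (u ∘ f) = 0 by apply/pi_eq0; exists u.
by rewrite add0r.
Qed.

Lemma act_pi_id : act F f (pi (idm X)) = 0.
Proof. by rewrite -pi_id; apply/pi_eq0; exists (idm Y); rewrite comp1m. Qed.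

(** Yoneda for a cokernel: a transformation out of Hom(X, -) is an element of G X, and it kills the
    relations as soon as [f] kills that element. *)
Lemma nat_from_presents G x : act G f x = 0 -> exists eta : nat_trans F G,
  forall W (g : mor X W), app eta W (pi g) = act G g x.
Proof.
move=> fx0.
pose r W y := projT1 (cid (pi_surj (W := W) y)).
have rK W y : pi (r W y) = y by rewrite /r; case: cid.
have wd W (g h : mor X W) : pi g = pi h -> act G g x = act G h x.
  by move=> /pi_eq [u /act_heq ->]; rewrite act_add act_comp fx0 raddf0 add0r.
have [||eta etaE] := @nat_ex F G (fun W y => act G (r W y) x).
- by move=> W y z; rewrite -act_add; apply: wd; rewrite pi_add !rK.
- by move=> W V u y; rewrite -act_comp; apply: wd; rewrite pi_act !rK.
exists eta => W g; rewrite etaE; apply: wd; exact: rK.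
Qed.

Lemma nat_presents_uniq G (eta theta : nat_trans F G) :
  app eta X (pi (idm X)) = app theta X (pi (idm X)) -> forall W, app eta W =1 app theta W.
Proof.
move=> e W y; have [g <-] := pi_surj y.
by rewrite pi_id -!app_nat e.
Qed.

End Presents.

(* The homs of an abstract [precat] live in a universe too large to carry a [zmodType];
   [hv] presents them as images of the small types [hom]. *)
Variables (hom : C -> C -> Type) (hv : forall X Y, hom X Y -> mor X Y).
Hypothesis hv_surj : forall X Y (f : mor X Y), exists x, hv x ≡ f.

Lemma cokernel_functor X Y (f : mor X Y) : exists F pi, @presents F X Y f pi.
Proof.
pose E W (g h : mor X W) := exists u : mor Y W, g ≡ hadd (u ∘ f) h.
have Ee W (g h : mor X W) : g ≡ h -> E W g h.
  by move=> e; exists hzero; rewrite comp0m hadd0m.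
have ED W (g g' h h' : mor X W) : E W g g' -> E W h h' -> E W (hadd g h) (hadd g' h').
  by move=> [u uE] [v vE]; exists (hadd u v); rewrite uE vE compDl haddACA.
have EM W V (u : mor W V) g h : E W g h -> E V (u ∘ g) (u ∘ h).
  by move=> [v vE]; exists (u ∘ v); rewrite vE compDr compA.
have eqE W : Equivalence (E W).
  split=> [g|g h [u uE]|g h k [u uE] [v vE]]; first exact: Ee.
    by exists (hopp u); rewrite uE compNm haddA haddNm hadd0m.
  by exists (hadd u v); rewrite uE vE compDl haddA.
(* Operations on the small type [hom] go through chosen representatives, so the group laws hold only
   up to [≡]; [quotient_zmod] asks for no more than that. *)
pose sm W (g : mor X W) := projT1 (cid (hv_surj g)).
have smE W (g : mor X W) : hv (sm W g) ≡ g by rewrite /sm; case: cid.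
have Q W : {Z : zmodType & {cl : hom X W -> Z |
    [/\ forall x y, cl x = cl y <-> E W (hv x) (hv y), forall y, exists x, cl x = y
      & forall x y, cl (sm _ (hadd (hv x) (hv y))) = cl x + cl y]}}.
  apply: (@quotient_zmod (hom X W) (fun x y => E W (hv x) (hv y)) (sm W hzero)
    (fun x => sm W (hopp (hv x))) (fun x y => sm W (hadd (hv x) (hv y)))).
  - have [r1 r2 r3] := eqE W; split=> [x|x y|x y z]; [exact: r1|exact: r2|exact: r3].
  - move=> x x' y y' h1 h2; have [u uE] := ED _ _ _ _ _ h1 h2.
    by exists u; rewrite !smE.
  - by move=> *; apply: Ee; rewrite !smE haddA.
  - by move=> *; apply: Ee; rewrite !smE haddC.
  - by move=> *; apply: Ee; rewrite !smE hadd0m.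
  - by move=> *; apply: Ee; rewrite !smE haddNm.
pose Z W := projT1 (Q W).
pose cl W (g : mor X W) : Z W := proj1_sig (projT2 (Q W)) (sm W g).
have clE W x y : cl W x = cl W y <-> E W x y.
  have [h _ _] := proj2_sig (projT2 (Q W)); rewrite h.
  by split=> -[u uE]; exists u; move: uE; rewrite !smE.
have clS W y : exists x, cl W x = y.
  have [h0 h _] := proj2_sig (projT2 (Q W)); have [x xE] := h y.
  by exists (hv x); rewrite -xE; apply/h0/Ee; rewrite smE.
have clD W x y : cl W (hadd x y) = cl W x + cl W y.
  have [h0 _ h] := proj2_sig (projT2 (Q W)); rewrite -h; apply/h0/Ee.
  by rewrite !smE.
pose r W y := projT1 (cid (clS W y)).
have rK W y : cl W (r W y) = y by rewrite /r; case: cid.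
pose a W V (u : mor W V) y := cl V (u ∘ r W y).
have aE W V (u : mor W V) g : a _ _ u (cl _ g) = cl _ (u ∘ g).
  by apply/clE/EM/clE; rewrite rK.
have [|||||F [i [j [ij ji iD iA]]]] := @functor_ex Z a.
- move=> W V u x y; rewrite -(rK _ x) -(rK _ y) -clD !aE -clD; apply/clE/Ee.
  by rewrite compDr.
- by move=> W V u v e x; apply/clE/Ee; rewrite e.
- by move=> W x; rewrite -{1}(rK _ x) aE -[RHS]rK; apply/clE/Ee; rewrite comp1m.
- by move=> W V U v u x; rewrite -(rK _ x) !aE; apply/clE/Ee; rewrite compA.
- by move=> W V u v x; rewrite -(rK _ x) !aE -clD; apply/clE/Ee; rewrite compDl.
exists F, (fun W g => i W (cl W g)).
have i0 W : i W 0 = 0 by apply: (addrI (i W 0)); rewrite -iD !addr0.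
split.
- by move=> W g h e; congr (i _ _); apply/clE/Ee.
- by move=> W g h; rewrite clD iD.
- by move=> W V u g; rewrite iA aE.
- by move=> W x; have [g gE] := clS W (j W x); exists g; rewrite gE ji.
- move=> W g; rewrite -(i0 W).
  have c0 : cl W hzero = 0.
    by apply: (addrI (cl W hzero)); rewrite -clD addr0; apply/clE/Ee; rewrite haddm0.
  split=> [/(can_inj (ij W))|[u uE]].
    by rewrite -c0 => /clE [u uE]; exists u; rewrite uE haddm0.
  by congr (i _ _); rewrite -c0; apply/clE; exists u; rewrite haddm0.
Qed.

End FunctorAction.

(** * Finitely presented functors form an abelian category *)

Section FpAbelian.
Variables (C : precat) (hom : C -> C -> Type) (hv : forall X Y, hom X Y -> mor X Y).
Hypothesis hv_surj : forall X Y (f : mor X Y), exists x, hv x ≡ f.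
Variable K : C -> Prop.
Hypothesis addC : additive_cat C.
Hypothesis weak_coker : forall (X Y : C) (f : mor X Y), exists Z (g : mor Y Z),
  g ∘ f ≡ hzero /\ forall W (h : mor Y W), h ∘ f ≡ hzero -> exists u, h ≡ u ∘ g.
Notation FP := (fp_functors K).
Implicit Types F G H : FP.
Local Notation "[ F ]" := (proj1_sig F).

Lemma weak_pushout (A B D : C) (f : mor A B) (g : mor A D) :
  exists P (i : mor B P) (j : mor D P), i ∘ f ≡ j ∘ g /\
    forall W (u : mor B W) (v : mor D W), u ∘ f ≡ v ∘ g ->
      exists t, u ≡ t ∘ i /\ v ≡ t ∘ j.
Proof.
have [_ sums] := addC; have [S [i1 [i2 [p1 [p2 [e11 e22 e12 e21 eS]]]]]] := sums B D.
have [P [c [c0 cU]]] := weak_coker (hadd (i1 ∘ f) (hopp (i2 ∘ g))).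
exists P, (c ∘ i1), (c ∘ i2); split.
  by rewrite -heq_sub0 -!compA -compmN -compDr c0.
move=> W u v e; have [|t tE] := cU W (hadd (u ∘ p1) (v ∘ p2)).
  rewrite compDl !compDr !compmN !compA -!(compA _ p1) -!(compA _ p2) e11 e22 e12 e21.
  by rewrite !compm1 !compm0 !comp0m e hadd0m hopp0 haddm0 haddmN.
exists t; rewrite !compA -tE !compDl -!compA e11 e12 e21 e22.
by rewrite !compm0 !compm1 haddm0 hadd0m.
Qed.

Definition pw_exact F G H (k : mor F G) (e : mor G H) : Prop :=
  forall W x, app e W x = 0 <-> exists y, app k W y = x.

Lemma pw_kernel F G H (k : mor F G) (e : mor G H) :
  (forall W, injective (app k W)) -> pw_exact k e -> is_kernel e k.
Proof.
move=> ik ek; split=> [W x|L g eg0]; first by apply/(ek W); exists x.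
have ex W x : exists y, app k W y = app g W x by apply/ek; apply: eg0.
pose r W x := projT1 (cid (ex W x)).
have rE W x : app k W (r W x) = app g W x by rewrite /r; case: cid.
have [||h hE] := @nat_ex C [L] [F] r.
- by move=> W x y; apply: (ik W); rewrite raddfD !rE raddfD.
- by move=> W V u x; apply: (ik V); rewrite -app_nat !rE app_nat.
exists h; split=> [W x|h' h'E W x]; first by rewrite -[RHS]rE -(hE W x).
by apply: (ik W); have /= E := h'E W x; rewrite [LHS]E -rE -(hE W x).
Qed.

Lemma pw_cokernel F G H (e : mor F G) (q : mor G H) :
  (forall W y, exists x, app q W x = y) -> pw_exact e q -> is_cokernel e q.
Proof.
move=> sq eq; split=> [W x|L g ge0]; first by apply/(eq W); exists x.
pose r W x := projT1 (cid (sq W x)).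
have rK W x : app q W (r W x) = x by rewrite /r; case: cid.
have wd W x y : app q W x = app q W y -> app g W x = app g W y.
  move=> E; have /eq [z zE] : app q W (x - y) = 0 by rewrite raddfB E subrr.
  by apply/eqP; rewrite -subr_eq0 -raddfB -zE; apply/eqP; exact: (ge0 W z).
have [||h hE] := @nat_ex C [H] [L] (fun W x => app g W (r W x)).
- by move=> W x y; rewrite -raddfD; apply: wd; rewrite raddfD !rK.
- by move=> W V u x; rewrite app_nat; apply: wd; rewrite -app_nat !rK.
exists h; split=> [W x|h' h'E W x].
  by rewrite [LHS](hE W (app q W x)); apply: wd; rewrite rK.
have := h'E W (r W x); rewrite /= => E.
by rewrite [RHS](hE W x) -[RHS]E; congr (_ _); rewrite -[LHS]rK.
Qed.

(** Let a : X' -> X induce [e]. Maps g on X with g a factoring through f' are those that factor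
    through the weak pushout c : X -> W0 of a and f', so Hom(W0, -) covers the kernel. Its relations
    are given by the weak pushout [p] of c and f. *)
Lemma fp_kernel F G (e : mor F G) : exists H (k : mor H F),
  (forall W, injective (app k W)) /\ pw_exact k e.
Proof.
case: F e => F [[X [Y [f [pi Ff]]]] FK] e; case: G e => G [[X' [Y' [f' [pi' Gf]]]] GK] e.
change (nat_trans F G) in e; change (presents f pi) in Ff; change (presents f' pi') in Gf.
have [a aE] := pi_surj Gf (app e X (pi X (idm X))).
have eE W (g : mor X W) : app e W (pi W g) = pi' W (g ∘ a).
  by rewrite (pi_id Ff) -app_nat -aE -(pi_act Gf).
have [W0 [c [d [cad W0U]]]] := weak_pushout a f'.
have [W1 [p [q [pcq W1U]]]] := weak_pushout c f.
have [H [rho Hp]] := cokernel_functor hv_surj p.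
have [|k kE] := @nat_from_presents C _ _ _ _ _ Hp F (pi W0 c).
  by rewrite -(pi_act Ff); apply/(pi_eq0 Ff); exists q.
have ik W x : app k W x = 0 -> x = 0.
  have [g <-] := pi_surj Hp x; rewrite kE -(pi_act Ff) => /(pi_eq0 Ff) [v vE].
  by have [t [tE _]] := W1U _ _ _ vE; apply/(pi_eq0 Hp); exists t.
have HK : vanishes_on H K.
  by move=> W KW x; apply: ik; apply: FK.
have Hfp : finitely_presented H by exists W0, W1, p, rho.
exists (exist _ H (conj Hfp HK)), k; split=> [W x y E|W x].
  by apply/eqP; rewrite -subr_eq0; apply/eqP/ik; rewrite raddfB E subrr.
have [g <-] := pi_surj Ff x; rewrite eE (pi_eq0 Gf); split=> [[u uE]|[y yE]].
  have [t [tE _]] := W0U _ _ _ uE; exists (rho W t).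
  by rewrite kE -(pi_act Ff); apply: (pi_heq Ff); rewrite tE.
have [t tE] := pi_surj Hp y; rewrite -tE kE -(pi_act Ff) in yE.
have /(pi_eq Ff) [u uE] := yE.
have : pi' W (g ∘ a) = 0.
  rewrite -eE -yE eE; apply/(pi_eq0 Gf); exists (t ∘ d).
  by rewrite -!compA cad.
by move=> /(pi_eq0 Gf).
Qed.

(** The relations f' of [G] are enlarged by the map [a] that induces [e], giving an arrow X' -> Y' +
    X. *)
Lemma fp_cokernel F G (e : mor F G) : exists H (q : mor G H),
  (forall W y, exists x, app q W x = y) /\ pw_exact e q.
Proof.
case: F e => F [[X [Y [f [pi Ff]]]] FK] e; case: G e => G [[X' [Y' [f' [pi' Gf]]]] GK] e.
change (nat_trans F G) in e; change (presents f pi) in Ff; change (presents f' pi') in Gf.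
have [a aE] := pi_surj Gf (app e X (pi X (idm X))).
have eE W (g : mor X W) : app e W (pi W g) = pi' W (g ∘ a).
  by rewrite (pi_id Ff) -app_nat -aE -(pi_act Gf).
have [_ sums] := addC; have [S [i1 [i2 [p1 [p2 [e11 e22 e12 e21 eS]]]]]] := sums Y' X.
have [H [rho Hp]] := cokernel_functor hv_surj (hadd (i1 ∘ f') (i2 ∘ a)).
have [|q qE] := @nat_from_presents C _ _ _ _ _ Gf H (rho X' (idm X')).
  rewrite -(pi_act Hp); apply/(pi_eq0 Hp); exists p1.
  by rewrite compm1 compDr !compA e11 e21 comp1m comp0m haddm0.
have qE' W (g : mor X' W) : app q W (pi' W g) = rho W g by rewrite qE -(pi_id Hp).
have sq W y : exists x, app q W x = y.
  by have [g <-] := pi_surj Hp y; exists (pi' W g).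
have HK : vanishes_on H K.
  move=> W KW x; have [y <-] := sq W x; have -> : y = 0 by apply: GK.
  exact: raddf0.
have Hfp : finitely_presented H by exists X', S, (hadd (i1 ∘ f') (i2 ∘ a)), rho.
exists (exist _ H (conj Hfp HK)), q; split=> // W x.
have [g <-] := pi_surj Gf x; rewrite qE' (pi_eq0 Hp); split=> [[u uE]|[y yE]].
  exists (pi W (u ∘ i2)); rewrite eE; apply/(pi_eq Gf).
  exists (hopp (u ∘ i1)); rewrite uE compDr !compA haddA compNm haddNm hadd0m.
  by [].
have [t tE] := pi_surj Ff y; rewrite -tE eE in yE.
have /(pi_eq Gf) [u uE] := yE.
exists (hadd (hopp u ∘ p1) (t ∘ p2)).
rewrite compDl !compDr -!compA !(compA p1) !(compA p2) e11 e12 e21 e22.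
rewrite !comp1m !comp0m !compm0 haddm0 hadd0m uE compNm haddA haddNm hadd0m.
by [].
Qed.

Lemma fp_zero : exists Z : FP, zero_object Z.
Proof.
have [[Z _] _] := addC.
have [H [rho Hp]] := cokernel_functor hv_surj (idm Z).
have H0 W x : x = 0 :> H W.
  have [g <-] := pi_surj Hp x; apply/(pi_eq0 Hp); exists g; by rewrite compm1.
have Hfp : finitely_presented H by exists Z, Z, (idm Z), rho.
exists (exist _ H (conj Hfp (fun W _ => H0 W))) => F; split=> e W x.
  by rewrite [LHS]H0 [RHS]H0.
by rewrite (H0 W x) [LHS](raddf0 (app e W)).
Qed.

Lemma fp_sum F G : exists S : FP, direct_sum F G S.
Proof.
case: F => F [[X [Y [f [pi Ff]]]] FK]; case: G => G [[X' [Y' [f' [pi' Gf]]]] GK].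
change (presents f pi) in Ff; change (presents f' pi') in Gf.
have [|||||S [i [j [ij ji iD iA]]]] := @functor_ex C (fun W => (F W * G W)%type)
  (fun W V u x => (act F u x.1, act G u x.2)).
- by move=> W V u x y; rewrite !raddfD.
- by move=> W V u v e x; rewrite (act_heq _ e) (act_heq _ e).
- by move=> W [x y]; rewrite !act_id.
- by move=> W V U v u [x y]; rewrite !act_comp.
- by move=> W V u v x; rewrite !act_add.
have jD W x y : j W (x + y) = j W x + j W y.
  by apply: (can_inj (ij W)); rewrite iD !ji.
have jA W V (u : mor W V) x : j V (act S u x) = (act F u (j W x).1, act G u (j W x).2).
  by apply: (can_inj (ij V)); rewrite ji -iA ji.
have i0 W : i W 0 = 0 by apply: (addrI (i W 0)); rewrite -iD !addr0.
have [||i1 i1E] := @nat_ex C F S (fun W x => i W (x, 0)).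
- by move=> W x y; rewrite -iD; congr (i W _); congr pair; rewrite /= addr0.
- by move=> W V u x; rewrite iA /= raddf0.
have [||i2 i2E] := @nat_ex C G S (fun W x => i W (0, x)).
- by move=> W x y; rewrite -iD; congr (i W _); congr pair; rewrite /= addr0.
- by move=> W V u x; rewrite iA /= raddf0.
have [||p1 p1E] := @nat_ex C S F (fun W x => (j W x).1).
- by move=> W x y; rewrite jD.
- by move=> W V u x; rewrite jA.
have [||p2 p2E] := @nat_ex C S G (fun W x => (j W x).2).
- by move=> W x y; rewrite jD.
- by move=> W V u x; rewrite jA.
have SK : vanishes_on S K.
  move=> W KW x; rewrite -(ji W x) -(i0 W); congr (i W _).
  by case: (j W x) => a b; congr pair; [apply: FK|apply: GK].
have [_ sums] := addC.
have [A [a1 [a2 [b1 [b2 [e11 e22 e12 e21 eA]]]]]] := sums X X'.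
have [B [c1 [c2 [d1 [d2 [g11 g22 g12 g21 gB]]]]]] := sums Y Y'.
have Sfp : finitely_presented S.
  exists A, B, (hadd (c1 ∘ f ∘ b1) (c2 ∘ f' ∘ b2)),
    (fun W g => i W (pi W (g ∘ a1), pi' W (g ∘ a2))); split.
  - move=> W g h e; congr (i W _); congr pair.
      by apply: (pi_heq Ff); rewrite e.
    by apply: (pi_heq Gf); rewrite e.
  - move=> W g h; rewrite -iD; congr (i W _); congr pair.
      by rewrite -(pi_add Ff); apply: (pi_heq Ff); rewrite compDl.
    by rewrite -(pi_add Gf); apply: (pi_heq Gf); rewrite compDl.
  - move=> W V u g; rewrite [RHS]iA; congr (i V _); congr pair => /=.
      by rewrite -(pi_act Ff); apply: (pi_heq Ff); rewrite compA.
    by rewrite -(pi_act Gf); apply: (pi_heq Gf); rewrite compA.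
  - move=> W x; have [g gE] := pi_surj Ff (j W x).1; have [h hE] := pi_surj Gf (j W x).2.
    exists (hadd (g ∘ b1) (h ∘ b2)); rewrite -[RHS](ji W x); congr (i W _).
    rewrite [RHS]surjective_pairing -gE -hE; congr pair.
      by apply: (pi_heq Ff); rewrite compDl -!compA e11 e12 compm1 compm0 haddm0.
    by apply: (pi_heq Gf); rewrite compDl -!compA e21 e22 compm1 compm0 hadd0m.
  - move=> W g; split=> [E|[h hE]].
      have := congr1 (j W) E; rewrite ij -(i0 W) ij => -[/(pi_eq0 Ff) [u uE] /(pi_eq0 Gf) [v vE]].
      exists (hadd (u ∘ d1) (v ∘ d2)).
      have -> : g ≡ hadd (g ∘ a1 ∘ b1) (g ∘ a2 ∘ b2).
        by rewrite -!compA -compDr eA compm1.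
      rewrite uE vE compDl !compDr.
      have E2 (M N P : C) (x : mor P W) (d : mor B P) (c : mor N B) (y : mor M N) (z : mor A M) :
          x ∘ d ∘ (c ∘ y ∘ z) ≡ x ∘ (d ∘ c) ∘ y ∘ z by rewrite !compA.
      by rewrite !E2 g11 g22 g12 g21 !compm1 !compm0 !comp0m haddm0 hadd0m.
    rewrite -(i0 W); congr (i W _); congr pair.
      apply/(pi_eq0 Ff); exists (h ∘ c1); rewrite hE compDr compDl -!compA e11 e12.
      by rewrite compm1 !compm0 haddm0.
    apply/(pi_eq0 Gf); exists (h ∘ c2); rewrite hE compDr compDl -!compA e21 e22.
    by rewrite compm1 !compm0 hadd0m.
exists (exist _ S (conj Sfp SK)), i1, i2, p1, p2; split=> W x.
- by rewrite [LHS](p1E W (app i1 W x)) i1E ij.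
- by rewrite [LHS](p2E W (app i2 W x)) i2E ij.
- by rewrite [LHS](p2E W (app i1 W x)) i1E ij.
- by rewrite [LHS](p1E W (app i2 W x)) i2E ij.
- transitivity (app i1 W (app p1 W x) + app i2 W (app p2 W x)); first by [].
  rewrite p1E p2E i1E i2E -iD -[RHS](ji W x); congr (i W _).
  by case: (j W x) => a b; congr pair; rewrite /= ?addr0 ?add0r.
Qed.

Lemma fp_abelian : abelian_cat FP.
Proof.
split.
- by split; [exact: fp_zero|exact: fp_sum].
- move=> F G e; have [H [k [ik ek]]] := fp_kernel e.
  by exists H, k; apply: pw_kernel.
- move=> F G e; have [H [q [sq eq]]] := fp_cokernel e.
  by exists H, q; apply: pw_cokernel.
- move=> F G e me; have [H [k [ik ek]]] := fp_kernel e.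
  have [Q [q [sq eq]]] := fp_cokernel e.
  exists Q, q; apply: pw_kernel => // W.
  have k0 : k ≡ hzero.
    apply: me => W' x; rewrite [RHS](raddf0 (app e W')).
    by apply/(ek W'); exists x.
  move=> x y E; apply/eqP; rewrite -subr_eq0; apply/eqP.
  have /(ek W) [z <-] : app e W (x - y) = 0 by rewrite raddfB E subrr.
  exact: (k0 W z).
- move=> F G e ee; have [H [k [ik ek]]] := fp_kernel e.
  have [Q [q [sq eq]]] := fp_cokernel e.
  exists H, k; apply: pw_cokernel => // W y.
  have q0 : q ≡ hzero.
    apply: ee => W' x; rewrite [RHS](_ : _ = 0) //.
    by apply/(eq W'); exists x.
  by apply/(eq W); exact: (q0 W y).
Qed.

End FpAbelian.

(** * Finitely presented functors and arrows *)

Section FpArrows.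
Variables (C : precat) (hom : C -> C -> Type) (hv : forall X Y, hom X Y -> mor X Y).
Hypothesis hv_surj : forall X Y (f : mor X Y), exists x, hv x ≡ f.
Variables (K : C -> Prop) (D : precat) (A : D -> arrow C).
(** Only the source component of a square is kept, since it determines the map of cokernels; it is
    contravariant like X in Hom(X, -). The pair ([C], [D]) will be M with the opposite of S(M)/V,
    and the opposite of M with F(M)/V', whose targets thus become sources. *)
Variable h : forall d e : D, mor d e -> mor (src (A e)) (src (A d)).
Hypothesis h_id : forall d, h (idm d) ≡ idm _.
Hypothesis h_comp : forall d e k (q : mor e k) (p : mor d e), h (q ∘ p) ≡ h p ∘ h q.
Hypothesis h_add : forall d e (p q : mor d e), h (hadd p q) ≡ hadd (h p) (h q).
Hypothesis h_opp : forall d e (p : mor d e), h (hopp p) ≡ hopp (h p).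
Hypothesis h_square : forall d e (p : mor d e), exists a, a ∘ arr (A e) ≡ arr (A d) ∘ h p.
Hypothesis h_full : forall d e (b : mor (src (A e)) (src (A d))) a,
  a ∘ arr (A e) ≡ arr (A d) ∘ b -> exists p : mor d e, h p ≡ b.
Hypothesis h_zero : forall d e (p : mor d e),
  p ≡ hzero <-> exists u, h p ≡ u ∘ arr (A e).
Hypothesis A_dense : forall F : functor C Ab, finitely_presented F -> vanishes_on F K ->
  exists d pi, presents (F := F) (arr (A d)) pi.
Hypothesis A_vanishes : forall d (F : functor C Ab) pi,
  presents (F := F) (arr (A d)) pi -> vanishes_on F K.

Lemma fp_equivalent_arrows : equivalent (fp_functors K) D.
Proof.
pose O (F : fp_functors K) d := {rho | presents (F := proj1_sig F) (arr (A d)) rho}.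
pose R F d (o : O F d) G e (o' : O G e) (eta : mor F G) (p : mor d e) :=
  app eta _ (proj1_sig o _ (idm _)) = proj1_sig o' _ (h p).
apply: (@correspondence _ _ O R) => /=.
- by move=> [F [fF vF]]; have [d [pi Ff]] := A_dense fF vF; exists d; split; exists pi.
- move=> d; have [F [pi Ff]] := cokernel_functor hv_surj (arr (A d)).
  have fF : finitely_presented F by exists (src (A d)), (tgt (A d)), (arr (A d)), pi.
  exists (exist _ F (conj fF (A_vanishes Ff))); split; by exists pi.
- move=> F d [pi Ff] G e [pi' Gf] eta; rewrite /R /=.
  have [b bE] := pi_surj Gf (app eta _ (pi _ (idm _))).
  have [|a aE] := (proj1 (pi_eq0 Gf (arr (A d) ∘ b))).
    by rewrite (pi_act Gf) bE app_nat (act_pi_id Ff) raddf0.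
  have [|p pE] := h_full (d := d) (e := e) (b := b) (a := a); first by rewrite aE.
  by exists p; rewrite (pi_heq Gf pE) bE.
- move=> F d [pi Ff] G e [pi' Gf] p; rewrite /R /=.
  have [a aE] := h_square p.
  have [|eta etaE] := nat_from_presents Ff (G := proj1_sig G) (x := pi' _ (h p)).
    by rewrite -(pi_act Gf); apply/(pi_eq0 Gf); exists a; rewrite aE.
  by exists eta; rewrite etaE act_id.
- move=> F d [pi Ff]; rewrite /R /=.
  by apply: esym; apply: (pi_heq Ff).
- move=> F d [pi Ff] G e [pi' Gf] H k [pi'' Hf] eta p theta q; rewrite /R /= => E1 E2.
  transitivity (app theta _ (app eta _ (pi _ (idm _)))); first by [].
  rewrite E1 (pi_id Gf) -app_nat E2 -(pi_act Hf).
  by apply: (pi_heq Hf); rewrite h_comp.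
- move=> F d [pi Ff] G e [pi' Gf] eta p theta q; rewrite /R /= => E1 E2.
  by rewrite (pi_heq Gf (h_add p q)) (pi_add Gf) -E1 -E2.
- move=> F d [pi Ff] G e [pi' Gf] eta p; rewrite /R /= => E1.
  by rewrite (pi_heq Gf (h_opp p)) (pi_opp Gf) -E1.
- move=> F d [pi Ff] G e [pi' Gf] eta p; rewrite /R /= => E1.
  rewrite h_zero -(pi_eq0 Gf) -E1; split=> [e0|e0 W]; first exact: e0.
  exact: (@nat_presents_uniq _ _ _ _ _ _ Ff _ eta (nat_zero _ _) e0 W).
Qed.

End FpArrows.

(** * Arrows of modules up to homotopy *)

Section HomotopyArrows.
Variables (C : precat) (P : arrow C -> Prop).

Definition sq_homotopic (f g : arrow C) (a b : square f g) : Prop :=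
  exists h : mor (tgt f) (src g), sq2 a ≡ hadd (arr g ∘ h) (sq2 b).

Lemma sq_homotopic_heq (f g : arrow C) (a b : square f g) :
  sq2 a ≡ sq2 b -> sq_homotopic a b.
Proof. by move=> e; exists hzero; rewrite compm0 hadd0m. Qed.

(* A surjective arrow of modules is taken up to homotopy as a short exact sequence: a square
   is null iff the induced map of kernels extends along the inclusion of the kernel. *)
Definition homotopy_cat : precat.
Proof.
refine {| Ob := {f : arrow C | P f};
  mor := fun f g => square (proj1_sig f) (proj1_sig g);
  heq := fun f g => @sq_homotopic (proj1_sig f) (proj1_sig g);
  idm := fun f => sq_id (proj1_sig f);
  mcomp := fun f g h => @sq_comp C _ _ _; hadd := fun f g => @sq_add C _ _;
  hzero := fun f g => sq_zero _ _; hopp := fun f g => @sq_opp C _ _ |}.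
- move=> f g; split=> [a|a b [h e]|a b c [h e] [h' e']].
  + exact: sq_homotopic_heq.
  + by exists (hopp h); rewrite e compmN haddA haddNm hadd0m.
  + by exists (hadd h h'); rewrite e e' compDr haddA.
- move=> f g k b b' a a' [h e] [h' e'].
  exists (hadd (h ∘ sq2 a) (sq1 b' ∘ h')) => /=.
  by rewrite e compDl {2}e' !compDr !compA sq_comm haddA.
- by move=> *; apply: sq_homotopic_heq; rewrite /= compA.
- by move=> *; apply: sq_homotopic_heq; rewrite /= comp1m.
- by move=> *; apply: sq_homotopic_heq; rewrite /= compm1.
- move=> f g a a' b b' [h e] [h' e']; exists (hadd h h') => /=.
  by rewrite e e' compDr haddACA.
- by move=> *; apply: sq_homotopic_heq; rewrite /= haddA.
- by move=> *; apply: sq_homotopic_heq; rewrite /= haddC.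
- by move=> *; apply: sq_homotopic_heq; rewrite /= hadd0m.
- by move=> *; apply: sq_homotopic_heq; rewrite /= haddNm.
- by move=> *; apply: sq_homotopic_heq; rewrite /= compDl.
- by move=> *; apply: sq_homotopic_heq; rewrite /= compDr.
Defined.

End HomotopyArrows.

Section ModuleCategory.
Variable R : pzRingType.
Notation Mod := (fgmod_cat R).

Lemma mono_injective (A B : Mod) (f : mor A B) :
  mono f <-> injective (f : {linear A -> B}).
Proof.
split=> [mf|fi W g h e x]; last exact/fi/(e x).
apply: linear_inj0 => x fx0.
have [||g gE] := @linear_ex _ 'rV[R]_1 A (fun u => u 0 0 *: x).
- by move=> u v; rewrite mxE scalerDl.
- by move=> c u; rewrite mxE scalerA.
have g0 : forall u, g u = 0.
  apply: (mf (FGMod (@fg_free R 1)) g \0) => u /=.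
  by rewrite gE linearZ linear0 /= fx0 scaler0.
by have := g0 (const_mx 1); rewrite gE mxE scale1r.
Qed.

Lemma epi_surjective (A B : Mod) (f : mor A B) :
  epi f <-> surjective (f : {linear A -> B}).
Proof.
split=> [ef|fs W g h e x]; last by have [y <-] := fs x; exact: (e y).
have [Q [q [qs qE]]] := ex_quot (submod_im (f : {linear A -> B})).
have fQ := fg_surj qs (fgmod_fg B).
move=> y; apply/qE; apply: (ef (FGMod fQ) q \0) => x /=.
by apply/qE; exists x.
Qed.

Lemma zero_object_eq0 (P : Mod -> Prop) (Z : full_sub P) :
  zero_object Z -> forall x : (proj1_sig Z : fgmod R), x = 0.
Proof. by move=> h x; have [_ h2] := h Z; apply: (h2 (idm Z) x). Qed.

Lemma eq0_zero_object (Z : Mod) : (forall x : (Z : fgmod R), x = 0) -> zero_object Z.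
Proof.
move=> h X; split=> f x /=; first exact: h.
by rewrite (h x) linear0.
Qed.

(** * Squares factoring through V and V' *)

Section Ideals.
Variable M : Mod -> Prop.
Hypothesis Madd : additive_cat (full_sub M).

(** Being a split epimorphism passes to direct sums of arrows. The induction is done twice because
    [V_epi] already consists of finite sums, and the quotient sums its objects again. *)
Lemma V_epi_split (S : epi_cat M) : finite_sum (@V_epi R M) S ->
  exists h : {linear tgt (proj1_sig S) -> src (proj1_sig S)},
    forall x, arr (proj1_sig S) (h x) = x.
Proof.
have Q0 (Z : epi_cat M) : zero_object Z ->
    exists h : {linear tgt (proj1_sig Z) -> src (proj1_sig Z)},
      forall x, arr (proj1_sig Z) (h x) = x.
  move=> h; exists \0 => x; have [_ h2] := h Z.
  have [_ e] := h2 (idm Z); have /= -> := e x; exact: linear0.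
have QD (X Y T : epi_cat M) :
    (exists h : {linear tgt (proj1_sig X) -> src (proj1_sig X)},
      forall x, arr (proj1_sig X) (h x) = x) ->
    (exists h : {linear tgt (proj1_sig Y) -> src (proj1_sig Y)},
      forall x, arr (proj1_sig Y) (h x) = x) -> direct_sum X Y T ->
    exists h : {linear tgt (proj1_sig T) -> src (proj1_sig T)},
      forall x, arr (proj1_sig T) (h x) = x.
  move=> [h hE] [k kE] [i1 [i2 [p1 [p2 [_ _ _ _ [_ e]]]]]].
  exists ((sq1 i1 \o (h \o sq2 p1)) \+ (sq1 i2 \o (k \o sq2 p2))) => x /=.
  rewrite linearD; have /= <- := sq_comm i1 (h (sq2 p1 x)).
  have /= <- := sq_comm i2 (k (sq2 p2 x)); rewrite hE kE.
  exact: (e x).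
elim=> [Z|X|X Y T _ QX _ QY]; [exact: Q0| |exact: QD QX QY].
elim=> [Z|[f Hf] /= [[A e]|[A [Z [Z0 e]]]]|Y T U _ QX _ QY]; [exact: Q0| | |exact: QD QX QY].
- by move: Hf; rewrite e => Hf; exists idfun.
- move: Hf; rewrite e => Hf; exists \0 => x /=.
  by have [h _] := Z0 Z; rewrite [RHS](h (idm (Z : Mod)) x).
Qed.

(* If [a2 = q h], then [(a1, a2) = (h p, q h) + (a1 - h p, 0)], where the first square factors
   through the identity of the target of [p] and the second one through [E -> 0]. *)
Lemma V_epi_ideal (f g : epi_cat M) (a : mor f g) : ideal_of (@V_epi R M) a <->
  exists h : {linear tgt (proj1_sig f) -> src (proj1_sig g)},
    forall x, sq2 a x = arr (proj1_sig g) (h x).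
Proof.
split.
  elim=> {a} [a [S [/V_epi_split [h hE] [b [c [_ e]]]]]|a [_ e]|a b c _ [h hE] _ [k kE] [_ e]].
  - exists (sq1 c \o (h \o sq2 b)) => x /=; rewrite [LHS](e x) /=.
    by have /= <- := sq_comm c (h (sq2 b x)); rewrite hE.
  - by exists \0 => x; rewrite [LHS](e x) /= linear0.
  - by exists (h \+ k) => x; rewrite [LHS](e x) /= hE kE linearD.
case: f a => [[E T p] [ME MT ep]]; case: g => [[E' T' q] [ME' MT' eq]] [a1 a2 ac] /= [h hE].
have [[[Z MZ] Z0] _] := Madd; have Ze := zero_object_eq0 Z0.
have eid : epi (idm T) by apply/epi_surjective => x; exists x.
have e0 : epi (hzero : mor E Z) by apply/epi_surjective => x; exists 0; rewrite [RHS]Ze linear0.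
pose V1 : epi_cat M := exist _ (Arrow (idm T)) (And3 MT MT eid).
pose V2 : epi_cat M := exist _ (Arrow (hzero : mor E Z)) (And3 ME MZ e0).
pose X : epi_cat M := exist _ (Arrow p) (And3 ME MT ep).
pose Y : epi_cat M := exist _ (Arrow q) (And3 ME' MT' eq).
rewrite /= in a1 a2 ac hE *.
pose d : {linear E -> E'} := a1 \- (h \o p).
pose b1 : mor X V1 := @Square _ (Arrow p) (Arrow (idm T)) p (idm T) (fun x => erefl).
pose c1 : mor V1 Y := @Square _ (Arrow (idm T)) (Arrow q) h (q ∘ h) (fun x => erefl).
have b2c : (hzero : mor T Z) ∘ p ≡ (hzero : mor E Z) ∘ idm E by [].
pose b2 : mor X V2 := @Square _ (Arrow p) (Arrow (hzero : mor E Z)) (idm E) hzero b2c.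
have c2c : (hzero : mor Z T') ∘ (hzero : mor E Z) ≡ q ∘ (d : mor E E').
  move=> x /=; rewrite linearB; have /= <- := ac x.
  by rewrite hE subrr.
pose c2 : mor V2 Y := @Square _ (Arrow (hzero : mor E Z)) (Arrow q)
  (d : mor E E') hzero c2c.
apply: (@ideal_ofD _ _ X Y (c1 ∘ b1) (c2 ∘ b2)).
- apply: ideal_of1; exists V1; split; last by exists b1, c1.
  by apply: finite_sum1; apply: finite_sum1; left; exists T.
- apply: ideal_of1; exists V2; split; last by exists b2, c2.
  apply: finite_sum1; apply: finite_sum1; right; exists E, Z; split=> //.
  exact: eq0_zero_object.
- split=> x /=; first by rewrite addrC subrK.
  by rewrite addr0 hE.
Qed.

Lemma V_mono_split (S : mono_cat M) : finite_sum (@V_mono R M) S ->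
  exists h : {linear tgt (proj1_sig S) -> src (proj1_sig S)},
    forall x, h (arr (proj1_sig S) x) = x.
Proof.
have Q0 (Z : mono_cat M) : zero_object Z ->
    exists h : {linear tgt (proj1_sig Z) -> src (proj1_sig Z)},
      forall x, h (arr (proj1_sig Z) x) = x.
  move=> h; exists \0 => x; have [_ h2] := h Z.
  have [e _] := h2 (idm Z); by have /= -> := e x.
have QD (X Y T : mono_cat M) :
    (exists h : {linear tgt (proj1_sig X) -> src (proj1_sig X)},
      forall x, h (arr (proj1_sig X) x) = x) ->
    (exists h : {linear tgt (proj1_sig Y) -> src (proj1_sig Y)},
      forall x, h (arr (proj1_sig Y) x) = x) -> direct_sum X Y T ->
    exists h : {linear tgt (proj1_sig T) -> src (proj1_sig T)},
      forall x, h (arr (proj1_sig T) x) = x.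
  move=> [h hE] [k kE] [i1 [i2 [p1 [p2 [_ _ _ _ [e _]]]]]].
  exists ((sq1 i1 \o (h \o sq2 p1)) \+ (sq1 i2 \o (k \o sq2 p2))) => x /=.
  have /= -> := sq_comm p1 x; have /= -> := sq_comm p2 x.
  rewrite hE kE; exact: (e x).
elim=> [Z|X|X Y T _ QX _ QY]; [exact: Q0| |exact: QD QX QY].
elim=> [Z|[f Hf] /= [[A e]|[Z [A [Z0 e]]]]|Y T U _ QX _ QY]; [exact: Q0| | |exact: QD QX QY].
- by move: Hf; rewrite e => Hf; exists idfun.
- move: Hf; rewrite e => Hf; exists \0 => x /=.
  by have [h _] := Z0 Z; rewrite [RHS](h (idm (Z : Mod)) x).
Qed.

(** If a1 = h p, then (a1, a2) = (h p, q h) + (0, a2 - q h), where the first square factors through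
    the identity of the target of [p] and the second one through 0 -> T'. *)
Lemma V_mono_ideal (f g : mono_cat M) (a : mor f g) : ideal_of (@V_mono R M) a <->
  exists h : {linear tgt (proj1_sig f) -> src (proj1_sig g)},
    forall x, sq1 a x = h (arr (proj1_sig f) x).
Proof.
split.
  elim=> {a} [a [S [/V_mono_split [h hE] [b [c [e _]]]]]|a [e _]|a b c _ [h hE] _ [k kE] [e _]].
  - exists (sq1 c \o (h \o sq2 b)) => x /=; rewrite [LHS](e x) /=.
    by have /= -> := sq_comm b x; rewrite hE.
  - by exists \0 => x; rewrite [LHS](e x) /=.
  - by exists (h \+ k) => x; rewrite [LHS](e x) /= hE kE.
case: f a => [[E T p] [ME MT ep]]; case: g => [[E' T' q] [ME' MT' eq]] [a1 a2 ac] /= [h hE].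
have [[[Z MZ] Z0] _] := Madd; have Ze := zero_object_eq0 Z0.
have eid : mono (idm T) by apply/mono_injective => x y.
have e0 : mono (hzero : mor Z T') by apply/mono_injective => x y _; rewrite (Ze x) (Ze y).
pose V1 : mono_cat M := exist _ (Arrow (idm T)) (And3 MT MT eid).
pose V2 : mono_cat M := exist _ (Arrow (hzero : mor Z T')) (And3 MZ MT' e0).
pose X : mono_cat M := exist _ (Arrow p) (And3 ME MT ep).
pose Y : mono_cat M := exist _ (Arrow q) (And3 ME' MT' eq).
rewrite /= in a1 a2 ac hE *.
pose d : {linear T -> T'} := a2 \- (q \o h).
pose b1 : mor X V1 := @Square _ (Arrow p) (Arrow (idm T)) p (idm T) (fun x => erefl).
pose c1 : mor V1 Y := @Square _ (Arrow (idm T)) (Arrow q) h (q ∘ h) (fun x => erefl).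
have b2c : (d : mor T T') ∘ p ≡ (hzero : mor Z T') ∘ (hzero : mor E Z).
  by move=> x /=; have /= -> := ac x; rewrite hE subrr.
pose b2 : mor X V2 := @Square _ (Arrow p) (Arrow (hzero : mor Z T')) hzero (d : mor T T') b2c.
have c2c : idm T' ∘ (hzero : mor Z T') ≡ q ∘ (hzero : mor Z E').
  by move=> x /=; rewrite linear0.
pose c2 : mor V2 Y := @Square _ (Arrow (hzero : mor Z T')) (Arrow q) hzero (idm T') c2c.
apply: (@ideal_ofD _ _ X Y (c1 ∘ b1) (c2 ∘ b2)).
- apply: ideal_of1; exists V1; split; last by exists b1, c1.
  by apply: finite_sum1; apply: finite_sum1; left; exists T.
- apply: ideal_of1; exists V2; split; last by exists b2, c2.
  apply: finite_sum1; apply: finite_sum1; right; exists Z, T'; split=> //.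
  exact: eq0_zero_object.
- split=> x /=; first by rewrite addr0 hE.
  by rewrite addrC subrK.
Qed.

End Ideals.
End ModuleCategory.

(** * Shifting along n-exact sequences *)

Section ClusterTilting.
Variable R : pzRingType.
Hypothesis noeth : forall (A : lmodType R) (U : A -> Prop), finitely_generated A ->
  submod U -> exists (K : fgmod R) (i : {linear K -> A}),
    injective i /\ forall x, U x <-> exists y, i y = x.
Variables (n : nat) (M : fgmod_cat R -> Prop).
Hypothesis hM : cluster_tilting n M.

Lemma ct_right (A : fgmod R) : M A <->
  forall X : fgmod R, M X -> forall i, (i.+1 < n)%N -> extS_zero i X A.
Proof.
rewrite (ct_perp_right hM); split=> h X MX i hi.
  by apply/(Ext_zeroS noeth)/h.
by case: i hi => // i /= hi; apply/(Ext_zeroS noeth)/h.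
Qed.

Lemma ct_left (A : fgmod R) : M A <->
  forall X : fgmod R, M X -> forall i, (i.+1 < n)%N -> extS_zero i A X.
Proof.
rewrite (ct_perp_left hM); split=> h X MX i hi.
  by apply/(Ext_zeroS noeth)/h.
by case: i hi => // i /= hi; apply/(Ext_zeroS noeth)/h.
Qed.

Lemma ct_ext (X Y : fgmod R) i : M X -> M Y -> (i.+1 < n)%N -> extS_zero i X Y.
Proof. by move=> MX MY; apply: (proj1 (ct_right Y)). Qed.

Lemma ct_projective (P : fgmod R) : projective P -> M P.
Proof. by move=> pP; apply/ct_left => X MX i _; apply: extS_projective. Qed.

Lemma ct_injective (I : fgmod R) : injective_mod I -> M I.
Proof. by move=> pI; apply/ct_right => X MX i _; apply: extS_injective. Qed.

Lemma right_approx_surj (A : fgmod R) : exists (X : fgmod R) (f : {linear X -> A}),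
  [/\ M X, surjective f & forall (N : fgmod R) (g : {linear N -> A}), M N ->
      exists h : {linear N -> X}, forall x, f (h x) = g x].
Proof.
have [X [f [MX hf]]] := ct_right_approx hM A.
exists X, f; split=> // [y|N g MN].
  have [Y [g [MY gs]]] := ct_generating hM A.
  have [h hE] := hf Y g MY; have [x <-] := gs y; exists (h x); exact: (esym (hE x)).
by have [h hE] := hf N g MN; exists h => x; exact: (esym (hE x)).
Qed.

Lemma left_approx_inj (A : fgmod R) : exists (X : fgmod R) (f : {linear A -> X}),
  [/\ M X, injective f & forall (N : fgmod R) (g : {linear A -> N}), M N ->
      exists h : {linear X -> N}, forall x, h (f x) = g x].
Proof.
have [X [f [MX hf]]] := ct_left_approx hM A.
exists X, f; split=> // [x y e|N g MN].
  have [Y [g [MY gi]]] := ct_cogenerating hM A.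
  have [h hE] := hf Y g MY; apply: gi; have /= -> := hE x; have /= -> := hE y.
  by rewrite e.
by have [h hE] := hf N g MN; exists h => x; exact: (esym (hE x)).
Qed.

(* The j-th syzygies of the n-exact sequences in M; for j = 0 and j = n they are all of M. *)
Definition mid_syzygy j (K : fgmod R) : Prop := forall N : fgmod R, M N ->
  (forall i, (i.+1 < j)%N -> extS_zero i N K) /\
  (forall i, (i.+1 < n - j)%N -> extS_zero i K N).

Lemma mid_syzygy0 K : mid_syzygy 0 K <-> M K.
Proof.
split=> [h|MK N MN]; last by split=> // i; rewrite subn0; apply: ct_ext.
by apply/ct_left => N MN i hi; have [_] := h N MN; apply; rewrite subn0.
Qed.

Lemma mid_syzygyn K : mid_syzygy n K <-> M K.
Proof.
split=> [h|MK N MN]; last by split=> i; [apply: ct_ext|rewrite subnn].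
by apply/ct_right => N MN i hi; have [h1 _] := h N MN; apply: h1.
Qed.

(** Ext^1(N, K) vanishes because maps from N lift along [p]; the other groups shift to those of [A].
    For j = 0 no condition on Ext(N, K) arises, and any surjection [p] will do. *)
Lemma mid_syzygyS j (K E A : fgmod R) (i : {linear K -> E}) (p : {linear E -> A}) :
  (j < n)%N -> ses i p -> M E -> mid_syzygy j A ->
  ((0 < j)%N -> forall (N : fgmod R) (g : {linear N -> A}), M N ->
      exists h : {linear N -> E}, forall x, p (h x) = g x) ->
  mid_syzygy j.+1 K.
Proof.
move=> jn sip ME hA apx N MN; have [h1 h2] := hA N MN; split.
  case=> [|m] hm.
    apply: (ext1_kernel noeth sip) => [g|]; first exact: apx.
    by apply: (ct_ext MN ME (i := 0)); apply: leq_trans jn.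
  apply: (extS_kernel noeth sip); first exact: h1.
  by apply: ct_ext => //; apply: leq_trans jn.
move=> m hm; apply: (extS_sub noeth sip).
  by apply: ct_ext => //; apply: leq_trans (leq_subr j.+1 n).
by apply: h2; lia.
Qed.

(** Dually, Ext^1(A, N) vanishes because maps into N extend along [i]. For j + 1 = n no condition on
    Ext(A, N) arises, and any injection [i] will do. *)
Lemma mid_syzygyP j (K E A : fgmod R) (i : {linear K -> E}) (p : {linear E -> A}) :
  (j < n)%N -> ses i p -> M E -> mid_syzygy j.+1 K ->
  ((j.+1 < n)%N -> forall (N : fgmod R) (g : {linear K -> N}), M N ->
      exists h : {linear E -> N}, forall x, h (i x) = g x) ->
  mid_syzygy j A.
Proof.
move=> jn sip ME hK apx N MN; have [h1 h2] := hK N MN; split.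
  move=> m hm; apply: (extS_cokernel noeth sip).
    by apply: ct_ext => //; lia.
  by apply: h1; lia.
case=> [|m] hm.
  apply: (ext1_quotient sip) => [g|]; first by apply: apx => //; lia.
  by apply: (ct_ext ME MN (i := 0)); lia.
apply: (extS_quotient noeth sip); first by apply: h2; lia.
by apply: ct_ext => //; lia.
Qed.

(** The kernel is merely required to exist: the surjection determines it up to isomorphism, so the
    objects remain plain arrows. *)
Definition stage j (f : arrow (fgmod_cat R)) : Prop :=
  [/\ surjective (arr f), M (src f), mid_syzygy j (tgt f)
    & exists (K : fgmod R) (i : {linear K -> src f}), ses i (arr f) /\ mid_syzygy j.+1 K].

Notation H j := (homotopy_cat (stage j)).

Lemma sq_arr (f g : arrow (fgmod_cat R)) (a : square f g) x :
  arr g (sq1 a x) = sq2 a (arr f x).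
Proof. exact: (esym (sq_comm a x)). Qed.

Lemma sq_ex (E A E' A' : fgmod R) (p : {linear E -> A}) (q : {linear E' -> A'})
    (m : {linear E -> E'}) (a : {linear A -> A'}) :
  (forall x, q (m x) = a (p x)) ->
  exists s : @square (fgmod_cat R) (@Arrow (fgmod_cat R) E A p) (@Arrow (fgmod_cat R) E' A' q),
    sq1 s = m /\ sq2 s = a.
Proof.
move=> e.
by exists (@Square (fgmod_cat R) (@Arrow (fgmod_cat R) E A p)
  (@Arrow (fgmod_cat R) E' A' q) m a (fun x => esym (e x))).
Qed.

Lemma H_zero j (f g : H j) (s : mor f g) : s ≡ hzero <->
  exists h : {linear tgt (proj1_sig f) -> src (proj1_sig g)},
    forall x, sq2 s x = arr (proj1_sig g) (h x).
Proof.
split=> -[h e]; exists h => x; first by rewrite [LHS](e x) /= addr0.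
by rewrite [LHS](e x) /= addr0.
Qed.

(* The arrows p : E -> A and f : X -> K correspond when K is the kernel of p; squares over p and
   over f correspond when they induce the same map on K. *)
Lemma stage_equivalent j : (j.+1 < n)%N -> equivalent (H j) (H j.+1).
Proof.
move=> jn.
pose O (p : H j) (p' : H j.+1) :=
  {i : {linear tgt (proj1_sig p') -> src (proj1_sig p)} | ses i (arr (proj1_sig p))}.
pose Rel (p : H j) (p' : H j.+1) (o : O p p') (q : H j) (q' : H j.+1) (o' : O q q')
    (s : mor p q) (s' : mor p' q') :=
  forall x, sq1 s (proj1_sig o x) = proj1_sig o' (sq2 s' x).
apply: (@correspondence _ _ O Rel).
- move=> [[E A p] [ps ME hA [K [i [sip hK]]]]]; simpl in *.
  have [X [f [MX fs hf]]] := right_approx_surj K.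
  have [L [u [ui uL]]] := fg_ker noeth f (fgmod_fg X).
  have suf : ses u f by [].
  have st : stage j.+1 (@Arrow (fgmod_cat R) X K f).
    split=> //; exists L, u; split=> //.
    exact: (mid_syzygyS jn suf MX hK (fun _ => hf)).
  by exists (exist _ _ st); apply: inhabits; exists i; exact: sip.
- move=> [[X K f] [fs MX hK [L [u [suf hL]]]]]; simpl in *.
  have [E [i [ME ii hi]]] := left_approx_inj K.
  have [Q [q [qs qE]]] := ex_quot (submod_im i).
  pose A := FGMod (fg_surj qs (fgmod_fg E)).
  have siq : ses i (q : {linear E -> A}) by [].
  have st : stage j (@Arrow (fgmod_cat R) E A q).
    split=> //; last by exists K, i.
    by apply: (mid_syzygyP _ siq ME hK (fun _ => hi)); apply: ltnW.
  by exists (exist _ _ st); apply: inhabits; exists i; exact: siq.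
- move=> [[E A p] hp] [[X K f] hf] [i /= sip] [[E' A' p'] hp'] [[X' K' f'] hf'] [i' /= sip'] s.
  rewrite /Rel /=.
  have [_ MX _ _] := hf; have [_ _ _ [L [u [suf hL]]]] := hf'.
  simpl in *.
  have [|a aE] := ses_lift (f := sq1 s \o i) sip'.
    by move=> x /=; have /= -> := sq_arr s (i x); rewrite (sesK _ sip) linear0.
  (* The induced map of kernels lifts to X -> X' because Ext^1(X, L) = 0, [L] being a syzygy of
     index j + 2. *)
  have [|m mE] := ext1_lift noeth (a \o f) suf.
    by have [h _] := hL X MX; apply: (h 0%N).
  have [s' [_ s'E]] := sq_ex (p := f) (q := f') (m := m) (a := a) mE.
  by exists s' => x; rewrite s'E aE.
- move=> [[E A p] hp] [[X K f] hf] [i /= sip] [[E' A' p'] hp'] [[X' K' f'] hf'] [i' /= sip'] s.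
  rewrite /Rel /=.
  have [_ _ hA _] := hp; have [_ ME' _ _] := hp'; simpl in *.
  (* The conditions on Ext(A, -) include degree one precisely when j + 1 < n. *)
  have eA : ext1_zero A E'.
    by have [_ h] := hA E' ME'; apply: (h 0%N); lia.
  have [m mE] := eA _ _ _ _ sip (i' \o sq2 s).
  have [|a aE] := ses_desc (f := p' \o m) sip.
    by move=> x /=; rewrite mE /= (sesK _ sip').
  have [s' [s'E _]] := sq_ex (p := p) (q := p') (m := m) (a := a) (fun x => esym (aE x)).
  by exists s' => x; rewrite s'E mE.
- by move=> p p' o x.
- move=> p p' o q q' o' r r' o'' s t s' t' h h' x.
  by rewrite /= h h'.
- by move=> p p' o q q' o' s t s' t' h h' x; rewrite /= h h' linearD.
- by move=> p p' o q q' o' s t h x; rewrite /= h linearN.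
move=> p0 p0' o q0 q0' o' s s' rel.
apply: (iff_trans (H_zero s)); apply: (iff_trans _ (iff_sym (H_zero s'))).
case: p0 o s rel => [[E A p] hp]; case: p0' s' => [[X K f] hf] s' [i /= sip].
case: q0 o' => [[E' A' p'] hp']; case: q0' s' => [[X' K' f'] hf'] /= s' [i' /= sip'] s.
rewrite /Rel /= => rel.
have [ps ME hA _] := hp; have [_ ME' _ _] := hp'; have [_ _ _ [L [u [suf hL]]]] := hf'.
have [_ MX' _ _] := hf'; simpl in *.
split=> [[h hE]|[h hE]].
(* Corrected by the homotopy [h], the map E -> E' lands in K'. Its lift to X', restricted to [K], is
   the homotopy for s'. *)
- have [|w wE] := ses_lift (f := sq1 s \- (h \o p) : {linear E -> E'}) sip'.
    by move=> x /=; rewrite linearB -hE; have /= -> := sq_arr s x; rewrite subrr.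
  have [|w' w'E] := ext1_lift noeth w suf.
    by have [hh _] := hL E ME; apply: (hh 0%N).
  exists (w' \o i) => x /=; have [ii' _ _] := sip'; apply: ii'.
  by rewrite w'E wE /= (sesK _ sip) linear0 subr0 rel.
(* Conversely a homotopy K -> X' extends to [E], and subtracting the extension leaves a map that
   vanishes on [K] and descends to [A]. *)
- have eA : ext1_zero A X'.
    by have [_ hh] := hA X' MX'; apply: (hh 0%N); lia.
  have [w wE] := eA _ _ _ _ sip h.
  have [|g gE] := ses_desc (f := sq1 s \- (i' \o (f' \o w)) : {linear E -> E'}) sip.
    by move=> x /=; rewrite rel wE hE subrr.
  exists g => y; have [x <-] := ps y.
  by rewrite gE /= linearB (sesK _ sip') subr0; have /= -> := sq_arr s x.
Qed.

Hypothesis n_gt0 : (0 < n)%N.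

Lemma stages_equivalent j : (j < n)%N -> equivalent (H 0) (H j).
Proof.
elim: j => [_|j IH jn].
  apply: (@weak_equivalence_equivalent _ _ (id_functor _)); split=> [X Y g|//|Y].
    by exists g.
  by exists Y, (idm Y), (idm Y); rewrite comp1m.
by apply: equivalent_trans (stage_equivalent jn); apply: IH; apply: ltnW.
Qed.

Lemma epi_stage (f : arrow (fgmod_cat R)) :
  [/\ M (src f), M (tgt f) & epi (arr f)] <-> stage 0 f.
Proof.
case: f => E A p; split=> [[ME MA /epi_surjective ps]|[/= ps ME /mid_syzygy0 MA _]].
  have [K [i [ii iK]]] := fg_ker noeth (p : {linear E -> A}) (fgmod_fg E).
  have sip : ses i (p : {linear E -> A}) by [].
  have hA : mid_syzygy 0 A by apply/mid_syzygy0.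
  split=> //; exists K, i; split=> //.
  exact: mid_syzygyS sip ME hA _.
by split=> //; apply/epi_surjective.
Qed.

Lemma quotient_heq (C : precat) (K : C -> Prop) (X Y : C) (f g : mor X Y) :
  @heq (quotient_cat K) X Y f g = ideal_of K (hadd f (hopp g)).
Proof. by []. Qed.

Lemma epi_cat_stage : equivalent (quotient_cat (@V_epi R M)) (H 0).
Proof.
have @F : functor (quotient_cat (@V_epi R M)) (H 0).
  exists (fun X : epi_cat M => exist (stage 0) (proj1_sig X) (proj1 (epi_stage _) (proj2_sig X)))
    (fun X Y f => f).
  - move=> X Y f g; rewrite quotient_heq => /(V_epi_ideal (ct_additive hM)) [h hE].
    by exists h => x; have /= <- := hE x; rewrite subrK.
  - by move=> X; apply: sq_homotopic_heq.
  - by move=> X Y Z g f; apply: sq_homotopic_heq.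
  - by move=> X Y f g; apply: sq_homotopic_heq.
apply: (@weak_equivalence_equivalent _ _ F); split=> [X Y g|X Y f g [h hE]|[f hf]].
- by exists g.
- rewrite quotient_heq; apply/(V_epi_ideal (ct_additive hM)); exists h => x.
  by rewrite /= [sq2 f x](hE x) /= addrK.
- have hf' := proj2 (epi_stage f) hf.
  exists (exist _ f hf' : epi_cat M), (sq_id f), (sq_id f).
  by split; apply: sq_homotopic_heq.
Qed.

Lemma mono_cat_stage : equivalent (H n.-1) (quotient_cat (@V_mono R M)).
Proof.
have nE : n.-1.+1 = n by rewrite prednK.
(* The target of [g] and the source of [p] are identified by an isomorphism [t], since an equality
   of objects would force transports in the morphism types. *)
pose O (p : H n.-1) (g : quotient_cat (@V_mono R M)) :=
  {t : {linear tgt (proj1_sig g) -> src (proj1_sig p)} &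
    {t' : {linear src (proj1_sig p) -> tgt (proj1_sig g)} |
    [/\ cancel t t', cancel t' t
      & ses (t \o (arr (proj1_sig g) : {linear _ -> _})) (arr (proj1_sig p))]}}.
pose Rel (p : H n.-1) (g : quotient_cat (@V_mono R M)) (o : O p g)
    (q : H n.-1) (g' : quotient_cat (@V_mono R M)) (o' : O q g')
    (s : mor p q) (b : @square (fgmod_cat R) (proj1_sig g) (proj1_sig g')) :=
  forall x, sq1 s (projT1 o x) = projT1 o' (sq2 b x).
apply: (@correspondence _ _ O Rel).
- move=> [[E A p] [ps ME hA [K [i [sip hK]]]]]; simpl in *.
  have mi : mono (i : @mor (fgmod_cat R) K E) by apply/mono_injective; case: sip.
  have MK : M K by apply/mid_syzygyn; rewrite -nE.
  exists (exist _ (@Arrow (fgmod_cat R) K E i) (And3 MK ME mi) : mono_cat M).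
  apply: inhabits; exists idfun, idfun; split=> //.
- move=> [[K E i] [MK ME mi]]; simpl in *.
  have ii : injective (i : {linear K -> E}) by apply/mono_injective.
  have [Q [q [qs qE]]] := ex_quot (submod_im (i : {linear K -> E})).
  pose A := FGMod (fg_surj qs (fgmod_fg E)).
  have siq : ses (i : {linear K -> E}) (q : {linear E -> A}) by [].
  have hK : mid_syzygy n.-1.+1 K by rewrite nE; apply/mid_syzygyn.
  have st : stage n.-1 (@Arrow (fgmod_cat R) E A q).
    split=> //; last by exists K, i.
    (* At the last index the approximation condition is void, so every monomorphism in [M]
       occurs. *)
    by apply: (mid_syzygyP _ siq ME hK); rewrite nE // ltnn.
  exists (exist _ _ st); apply: inhabits; exists idfun, idfun; split=> //.

- move=> p g [t [t' [tK t'K sip]]] q g' [u [u' [uK u'K siq]]] s; rewrite /Rel /=.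
  case: p t t' tK t'K sip s => [[E A p] hp] t t' tK t'K sip s.
  case: q u u' uK u'K siq s => [[E' A' q] hq] u u' uK u'K siq s.
  case: g t t' tK t'K sip => [[K T i] [MK MT mi]] t t' tK t'K sip.
  case: g' u u' uK u'K siq => [[K' T' i'] [MK' MT' mi']] u u' uK u'K siq.
  simpl in *.
  have [|b bE] := ses_lift (f := sq1 s \o (t \o (i : {linear K -> T}))) siq.
    by move=> x /=; have /= -> := sq_arr s (t (i x)); rewrite (sesK _ sip) linear0.
  have e x : i' (b x) = u' (sq1 s (t (i x))).
    by rewrite -[LHS]uK; congr (u' _); exact: bE.
  have [c [_ cE]] := sq_ex (p := i) (q := i') (m := b) (a := u' \o (sq1 s \o t)) e.
  by exists c => x; rewrite cE /= u'K.
- move=> p g [t [t' [tK t'K sip]]] q g' [u [u' [uK u'K siq]]] b; rewrite /Rel /=.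
  case: p t t' tK t'K sip => [[E A p] hp] t t' tK t'K sip.
  case: q u u' uK u'K siq => [[E' A' q] hq] u u' uK u'K siq.
  simpl in *.
  have [|a aE] := ses_desc (f := (q : {linear E' -> A'}) \o (u \o (sq2 b \o t'))) sip.
    move=> x /=; rewrite tK; have /= <- := sq_arr b x.
    exact: (sesK _ siq).
  have [s [sE _]] := sq_ex (p := p) (q := q) (m := u \o (sq2 b \o t')) (a := a)
    (fun x => esym (aE x)).
  by exists s => x; rewrite sE /= tK.
- by move=> p g o x.
- by move=> p g o q g' o' r g'' o'' s b s' b' h h' x; rewrite /= h h'.
- by move=> p g o q g' o' s b s' b' h h' x; rewrite /= h h' linearD.
- by move=> p g o q g' o' s b h x; rewrite /= h linearN.
move=> p g o q g' o' s b rel.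
apply: (iff_trans (H_zero s)).
apply: (iff_trans _ (iff_sym (V_mono_ideal (ct_additive hM) (f := g) (g := g') _))) => /=.
case: o rel => [t [t' [tK t'K sip]]]; case: o' => [u [u' [uK u'K siq]]]; rewrite /Rel /= => rel.
have ps : surjective (arr (proj1_sig p)) by case: sip.
split=> [[h hE]|[w wE]].
- have [|w wE] := ses_lift (f := sq1 s \- (h \o (arr (proj1_sig p) : {linear _ -> _}))) siq.
    by move=> x /=; rewrite linearB -hE; have /= -> := sq_arr s x; rewrite subrr.
  exists (w \o t) => x /=; rewrite oppr0 addr0.
  have [ii _ _] := siq; apply: ii; rewrite /=; have /= -> := wE (t (arr (proj1_sig g) x)).
  have /= -> := sesK x sip; rewrite linear0 subr0 rel.
  by have /= -> := sq_arr b x.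
- have [|h hE] := ses_desc (f := sq1 s \-
      (u \o ((arr (proj1_sig g') : {linear _ -> _}) \o (w \o t')))) sip.
    move=> x /=; rewrite tK rel; have /= := wE x; rewrite oppr0 addr0 => <-.
    by have /= -> := sq_arr b x; rewrite subrr.
  exists h => y; have [x <-] := ps y.
  rewrite hE /= linearB; have /= -> := sesK (w (t' x)) siq.
  by rewrite subr0; have /= -> := sq_arr s x.
Qed.

Lemma epi_cat_mono_cat :
  equivalent (quotient_cat (@V_epi R M)) (quotient_cat (@V_mono R M)).
Proof.
apply: equivalent_trans epi_cat_stage _; apply: equivalent_trans _ mono_cat_stage.
by apply: stages_equivalent; rewrite prednK.
Qed.

End ClusterTilting.

(** * Conclusion *)

Section FunctorCategories.
Variable R : pzRingType.
Hypothesis noeth : forall (A : lmodType R) (U : A -> Prop), finitely_generated A ->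
  submod U -> exists (K : fgmod R) (i : {linear K -> A}),
    injective i /\ forall x, U x <-> exists y, i y = x.
Hypothesis enough_inj : forall X : fgmod R, exists (I : fgmod R) (i : {linear X -> I}),
  injective i /\ injective_mod I.
Variables (n : nat) (M : fgmod_cat R -> Prop).
Hypothesis hM : cluster_tilting n M.

Let hom (X Y : full_sub M) : Type := {linear (proj1_sig X : fgmod R) -> (proj1_sig Y : fgmod R)}.
Let hv (X Y : full_sub M) (f : hom X Y) : mor X Y := f.

Lemma hv_surj (X Y : full_sub M) (f : mor X Y) : exists x, @hv X Y x ≡ f.
Proof. by exists f. Qed.

(** The cokernel taken in modules need not lie in [M]; following it with a left approximation keeps
    existence of factorizations and loses uniqueness. *)
Lemma weak_cokernel (X Y : full_sub M) (f : mor X Y) : exists Z (g : mor Y Z),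
  g ∘ f ≡ hzero /\ forall W (h : mor Y W), h ∘ f ≡ hzero -> exists u, h ≡ u ∘ g.
Proof.
case: X Y f => [X MX] [Y MY] f.
have [Q [q [qs qE]]] := ex_quot (submod_im (f : {linear X -> Y})).
have [Z [a [MZ ai aU]]] := left_approx_inj hM (FGMod (fg_surj qs (fgmod_fg Y))).
exists (exist _ Z MZ), (a \o q : {linear Y -> Z}); split=> [x|[W MW] h hf] /=.
  by have -> : q (f x) = 0; [apply/qE; exists x|rewrite linear0].
have [|h' h'E] := factor_surj (h := h : {linear Y -> W}) qs.
  by move=> x /qE [y <-]; exact: (hf y).
have [u uE] := aU W h' MW; exists u => x /=.
by rewrite uE h'E.
Qed.

Lemma inj_mod_abelian : abelian_cat (inj_mod M).
Proof. exact: (fp_abelian (@hv_surj) _ (ct_additive hM) weak_cokernel). Qed.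

(** Vanishing at an injective module that contains X makes the embedding factor through [f], so [f]
    is injective. Such a module belongs to [M]. *)
Lemma vanishes_injective (X Y : full_sub M) (f : mor X Y) (F : functor (full_sub M) Ab)
    (pi : forall W, mor X W -> F W) : presents f pi ->
  (vanishes_on F (fun I => injective_mod (proj1_sig I : fgmod R)) <->
   injective (f : {linear (proj1_sig X : fgmod R) -> (proj1_sig Y : fgmod R)})).
Proof.
move=> Ff; split=> [v|fi W inW x].
  have [I [i [ii inI]]] := enough_inj (proj1_sig X : fgmod R).
  have MI := ct_injective noeth hM inI.
  have /(pi_eq0 Ff) [h hE] : pi (exist _ I MI) i = 0 by apply: v.
  by move=> x y e; apply: ii; rewrite [LHS](hE x) [RHS](hE y) /= e.
have [g <-] := pi_surj Ff x.
have [h hE] := inW _ _ _ g fi.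
by apply/(pi_eq0 Ff); exists h => y; rewrite -[LHS](hE y).
Qed.

Definition mono_arrow (g : mono_cat M) : arrow (full_sub M) :=
  @Arrow (full_sub M)
    (exist M (src (proj1_sig g)) (let: And3 MS _ _ := proj2_sig g in MS))
    (exist M (tgt (proj1_sig g)) (let: And3 _ MT _ := proj2_sig g in MT))
    (arr (proj1_sig g)).

Lemma inj_mod_mono_cat : equivalent (inj_mod M) (op (quotient_cat (@V_mono R M))).
Proof.
apply: (@fp_equivalent_arrows (full_sub M) hom hv hv_surj _
  (op (quotient_cat (@V_mono R M))) mono_arrow
  (fun d e (p : @square (fgmod_cat R) (proj1_sig e) (proj1_sig d)) => sq1 p)).
- by move=> d /= x.
- by move=> d e r q p /= x.
- by move=> d e p q /= x.
- by move=> d e p /= x.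
- by move=> d e p; exists (sq2 p) => x; exact: (sq_comm p x).
- by move=> d e b a E; exists (@Square _ (proj1_sig e) (proj1_sig d) b a E).
- move=> d e p; apply: (iff_trans (V_mono_ideal (ct_additive hM) (f := e) (g := d) _)) => /=.
  split=> -[u uE]; exists u => x; have := uE x; rewrite /= oppr0 addr0; exact.
- move=> F [X [Y [f [pi Ff]]]] vF; change (presents f pi) in Ff.
  have fi := proj1 (vanishes_injective Ff) vF.
  case: X Y f pi Ff fi => [X MX] [Y MY] f pi Ff /mono_injective mf.
  by exists (exist _ (@Arrow (fgmod_cat R) X Y f) (And3 MX MY mf) : mono_cat M), pi.
- move=> d F pi Ff; apply/(vanishes_injective Ff)/mono_injective.
  have [_ _ mf] := proj2_sig d; exact: mf.
Qed.

Lemma vanishes_projective (X Y : full_sub M) (f : @mor (op (full_sub M)) X Y)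
    (F : functor (op (full_sub M)) Ab)
    (pi : forall W, @mor (op (full_sub M)) X W -> F W) : presents f pi ->
  (vanishes_on F (fun P => projective (proj1_sig P : fgmod R)) <->
   surjective (f : {linear (proj1_sig Y : fgmod R) -> (proj1_sig X : fgmod R)})).
Proof.
move=> Ff; split=> [v|fs W prW x].
  have [P [p [pP ps]]] := free_cover (proj1_sig X : fgmod R).
  have MP := ct_projective noeth hM pP.
  pose q : @mor (op (full_sub M)) X (exist _ P MP) := p.
  have [h hE] := proj1 (pi_eq0 Ff q) (v (exist _ P MP) pP (pi _ q)).
  by move=> y; have [x <-] := ps y; exists ((h : {linear P -> _}) x); rewrite [RHS](hE x).
have [g gx] := pi_surj Ff x; rewrite -gx.
have [h hE] := prW _ _ _ g fs.
apply: (proj2 (pi_eq0 Ff g)); exists h => y; exact: (esym (hE y)).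
Qed.

Definition epi_arrow (g : epi_cat M) : arrow (op (full_sub M)) :=
  @Arrow (op (full_sub M))
    (exist M (tgt (proj1_sig g)) (let: And3 _ MT _ := proj2_sig g in MT))
    (exist M (src (proj1_sig g)) (let: And3 MS _ _ := proj2_sig g in MS))
    (arr (proj1_sig g)).

Lemma mod_proj_epi_cat : equivalent (mod_proj M) (quotient_cat (@V_epi R M)).
Proof.
apply: (@fp_equivalent_arrows (op (full_sub M)) (fun X Y => hom Y X)
  (fun X Y => @hv Y X) (fun X Y => @hv_surj Y X) _
  (quotient_cat (@V_epi R M)) epi_arrow
  (fun d e (p : @square (fgmod_cat R) (proj1_sig d) (proj1_sig e)) => sq2 p)).
- by move=> d /= x.
- by move=> d e r q p /= x.
- by move=> d e p q /= x.
- by move=> d e p /= x.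
- by move=> d e p; exists (sq1 p) => x; exact: (esym (sq_comm p x)).
- by move=> d e b a E; exists (@Square _ (proj1_sig d) (proj1_sig e) a b (fun x => esym (E x))).
- move=> d e p; apply: (iff_trans (V_epi_ideal (ct_additive hM) (f := d) (g := e) _)) => /=.
  split=> -[u uE]; exists u => x; have := uE x; rewrite /= oppr0 addr0; exact.
- move=> F [X [Y [f [pi Ff]]]] vF; change (presents f pi) in Ff.
  have fs := proj1 (vanishes_projective Ff) vF.
  case: X Y f pi Ff fs => [X MX] [Y MY] f pi Ff /epi_surjective ef.
  by exists (exist _ (@Arrow (fgmod_cat R) Y X f) (And3 MY MX ef) : epi_cat M), pi.
- move=> d F pi Ff; apply/(vanishes_projective Ff)/epi_surjective.
  have [_ _ mf] := proj2_sig d; exact: mf.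
Qed.

End FunctorCategories.

Theorem corollary7p2 (k : comPzRingType) (Lambda : algType k)
    (hLambda : artin_algebra Lambda) (n : nat) (hn : (0 < n)%N)
    (M : rmod Lambda -> Prop) (hM : cluster_tilting n M) :
  [/\ abelian_equivalent (quotient_cat (@V_mono _ M)) (mod_proj M),
      abelian_equivalent (mod_proj M) (op (inj_mod M))
    & abelian_equivalent (op (inj_mod M)) (quotient_cat (@V_epi _ M))].
Proof.
have noeth := submod_fg hLambda; have inj := enough_injectives hLambda.
have e1 : equivalent (op (inj_mod M)) (quotient_cat (@V_mono _ M)).
  apply: equivalent_trans (equivalent_opK _).
  exact: equivalent_op (inj_mod_mono_cat noeth inj hM).
have e2 := mod_proj_epi_cat noeth hM.
have e3 := epi_cat_mono_cat noeth hM hn.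
(* Only the covariant functor category is shown to be abelian directly; the property then travels
   along S(M)/V and F(M)/V' to the contravariant one. *)
have a1 := abelian_op (inj_mod_abelian hM).
have a2 := abelian_equivalence e1 a1.
have a3 := abelian_equivalence (equivalent_sym e3) a2.
have a4 := abelian_equivalence (equivalent_sym e2) a3.
have e23 := equivalent_trans e2 e3.
split; split=> //.
- exact: equivalent_sym.
- exact: equivalent_trans e23 (equivalent_sym e1).
- exact: equivalent_trans e1 (equivalent_sym e3).
Qed.
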